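(* Let $k$ be a field, $a\in k$, $P(x)\in k[x]$, and assume: (1) $a\notin k^2$; (2) $\deg P\ge 3$ and $P(x)$ is a product of mutually different (pairwise non-associate) irreducible polynomials of $k[x]$; (3) $k(\sqrt a)\subset l$, where $l$ is the splitting field of $P(x)$ over $k$; (4) every irreducible factor of $P(x)$ in $k[x]$ is irreducible also over $k(\sqrt a)$; (5) $\mathrm{char}\, k\ne 2$ and every irreducible factor of $P(x)$ is separable over $k$. Let $\mathfrak G=\mathrm{Gal}(l/k)$, let $X$ be the blown-up surface described in the context, and regard $\mathrm{Pic}(X)$ as a $\mathfrak G$-module by the action described in the context. Let $r'$ be the number of irreducible components (irreducible factors in $k[x]$) of $P(x)$. Then $$H^1(\mathfrak G,\mathrm{Pic}(X))\simeq(\mathbb Z/2\mathbb Z)^j,$$ where $j$ is as follows. If $\deg P$ is odd, then $j=r'-1$. If $\deg P$ is even and every irreducible component of $P$ has even degree, then $j=r'-1$. If $\deg P$ is even and some irreducible component of $P$ has odd degree, then $j=r'-2$.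
   Context: Let $K=k(x,y,z)$ be the fraction field of $k[x,y,z]/(z^2-ay^2-P(x))$. Put $u=z+\sqrt a\,y$. Then $z-\sqrt a\,y=P(x)/u$ and $\overline k\otimes_k K=\overline k(x,u)$ is the rational function field in $x,u$ over the algebraic closure $\overline k$. The group $G=\mathrm{Gal}(k_{sep}/k)$ (identified with the group of $k$-automorphisms of $\overline k$) acts on $\overline k\otimes_k K$ by $\overline\sigma=\sigma\otimes\mathrm{id}_K$: it acts naturally on $\overline k$, fixes $x$, and sends $u$ to $u$ if $\sigma(\sqrt a)=\sqrt a$ and to $P(x)/u$ if $\sigma(\sqrt a)=-\sqrt a$. Construction of $X$. Let $r=\deg P$ and let $c_1,\dots,c_r$ be the roots of $P$ in $l$. On $\mathbb P^1\times\mathbb P^1$ over $\overline k$ with affine coordinates $(x,u)$, let $T$ be the birational transformation $(x,u)\mapsto(x,P(x)/u)$. Blow up $\mathbb P^1\times\mathbb P^1$ at each of the $r$ points $P_i:(x,u)=(c_i,0)$, $1\le i\le r$, with exceptional curves $E_i$. Then blow up the point $P_{r+1}: x=u=\infty$, with exceptional curve $E_{r+1}$, and successively for $j=1,\dots,r-1$ blow up the point $P_{r+j+1}\in E_{r+j}$ at which the coordinate $t_{r+j}=u/x^j$ on $E_{r+j}$ takes the value $\infty$ (this is the point of $E_{r+j}$ on the strict transform of the curve $u=\infty$), with exceptional curve $E_{r+j+1}$. The surface obtained after these $2r$ blowings-up is $X$; on $X$ the lifting of $T$ is biregular. Each $\overline\sigma$ permutes the irreducible curves on $X$ (regarded as valuations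 of $\overline k(x,u)$) and preserves the group of principal divisors, so $G$ acts on $\mathrm{Pic}(X)=\mathrm{Div}(X)/\{\text{principal divisors}\}$; this action factors through the finite group $\mathfrak G=\mathrm{Gal}(l/k)$. $H^1$ denotes group cohomology. *)

(* Defs.v *)
From HB Require Import structures.
From mathcomp Require Import all_boot all_order all_fingroup all_algebra all_field.
From mathcomp Require Import boolp.
From mathcomp Require Import freeg.

Set Implicit Arguments.
Unset Strict Implicit.
Unset Printing Implicit Defensive.

Import GRing.Theory.
Local Open Scope ring_scope.
Local Open Scope quotient_scope.

(* Elements of a Galois group compose in MathComp as (g * h) y = h (g y), so   *)
(* the usual left modules over Gal(l/k) are right modules over 'Gal(l / k):    *)
(* gact g is the action of the automorphism g, and g * h is "g, then h".       *)
Record gmodule (gT : finGroupType) (G : {group gT}) (M : zmodType) := GModule {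
  gact :> gT -> M -> M;
  gactB : {in G, forall g, {morph gact g : m n / m - n}};
  gact1 : forall m, gact 1%g m = m;
  gactM : {in G &, forall g h m, gact (g * h)%g m = gact h (gact g m)} }.

Section FirstCohomology.
Variables (gT : finGroupType) (G : {group gT}) (M : zmodType).
Variable act : gmodule G M.

Definition Z1 : {pred {ffun gT -> M}} :=
  [pred c : {ffun gT -> M} |
    [forall g in G, forall h in G,
       c (g * h)%g == act h (c g) + c h]].

Fact gact0 g : g \in G -> act g 0 = 0.
Proof. by move=> Gg; have := gactB act Gg 0 0; rewrite !subrr. Qed.

Fact Z1_zmod_closed : zmod_closed Z1.
Proof.
split=> [|c d /forall_inP Zc /forall_inP Zd].
  by apply/forall_inP=> g _; apply/forall_inP=> h Gh; rewrite !ffunE gact0 ?addr0.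
apply/forall_inP=> g Gg; apply/forall_inP=> h Gh; rewrite !ffunE gactB //.
have /forall_inP/(_ h Gh)/eqP-> := Zc g Gg.
have /forall_inP/(_ h Gh)/eqP-> := Zd g Gg.
by rewrite opprD addrACA.
Qed.

HB.instance Definition _ :=
  GRing.isZmodClosed.Build {ffun gT -> M} Z1 Z1_zmod_closed.

Record cocycle := Cocycle { cocycle_fun :> {ffun gT -> M}; _ : cocycle_fun \in Z1 }.

HB.instance Definition _ := [isSub for cocycle_fun].
HB.instance Definition _ := [Choice of cocycle by <:].
HB.instance Definition _ := [SubChoice_isSubZmodule of cocycle by <:].

Definition B1 : {pred cocycle} :=
  [pred c : cocycle | `[< exists m : M, {in G, forall g, c g = act g m - m} >]].

Fact B1_zmod_closed : zmod_closed B1.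
Proof.
split=> [|c d /asboolP[m Bc] /asboolP[n Bd]]; apply/asboolP.
  by exists 0 => g Gg; rewrite ffunE gact0 ?subrr.
exists (m - n) => g Gg; rewrite gactB // !ffunE Bc // Bd //.
by rewrite !opprD addrACA.
Qed.

HB.instance Definition _ :=
  GRing.isZmodClosed.Build cocycle B1 B1_zmod_closed.

Definition H1 : zmodType := {ideal_quot B1}.

End FirstCohomology.

Definition zmod_isom (A B : zmodType) : Prop :=
  exists f : {additive A -> B}, bijective f.

Section Surface.
Variable F : closedFieldType.
Implicit Types (c : F) (P : {poly F}).

(* The function field F(x, u): the inner variable is x, the outer one is u. *)
Local Notation Kxu := {fraction {poly {poly F}}}.
Definition cst c : Kxu := FracField.tofrac c%:P%:P.
Definition xK : Kxu := FracField.tofrac ('X%:P).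
Definition uK : Kxu := FracField.tofrac 'X.

(* The element f(xi, eta). *)
Definition subst (xi eta : Kxu) (f : {poly {poly F}}) : Kxu :=
  (map_poly (fun q : {poly F} => (map_poly cst q).[xi]) f).[eta].

Record valuation (v : Kxu -> int) : Prop := Valuation {
  val0 : v 0 = 0;
  valM : forall f g, f != 0 -> g != 0 -> v (f * g) = v f + v g;
  valD : forall f g, f != 0 -> g != 0 -> f + g != 0 ->
           (Num.min (v f) (v g) <= v (f + g))%R }.

Fact val1 v : valuation v -> v 1 = 0.
Proof.
case=> _ vM _; have := vM 1 1 (oner_neq0 _) (oner_neq0 _).
by rewrite mulr1 -{1}[v 1]addr0 => /addrI.
Qed.

Fact valV v f : valuation v -> f != 0 -> v f^-1 = - v f.
Proof.
move=> vv nzf; have nzV : f^-1 != 0 by rewrite invr_eq0.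
have := valM vv nzV nzf.
by rewrite (mulVf nzf) (val1 vv) => /esym/eqP; rewrite addr_eq0 => /eqP.
Qed.

Definition irreducible (f : {poly {poly F}}) : Prop :=
  [/\ f != 0, f \isn't a GRing.unit &
      forall g h, f = g * h -> g \is a GRing.unit \/ h \is a GRing.unit].

(* Vanishing order of g along the plane curve f = 0. *)
Definition order_along (f g : {poly {poly F}}) (n : nat) : Prop :=
  exists2 h, g = f ^+ n * h & forall h', h <> f * h'.

(* Multiplicity of g at the origin of the affine plane. *)
Definition order_at_origin (g : {poly {poly F}}) (n : nat) : Prop :=
  (exists i j, (i + j = n)%N /\ g`_j`_i != 0) /\
  (forall i j, (i + j < n)%N -> g`_j`_i = 0).

(* v is the valuation that, in the local coordinates xi and eta (which always *)
(* generate the function field below), is given by the order function ord.    *)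
Definition order_in (xi eta : Kxu) (ord : {poly {poly F}} -> nat -> Prop)
    (v : Kxu -> int) : Prop :=
  forall f g m n, ord f m -> ord g n ->
    v (subst xi eta f / subst xi eta g) = m%:Z - n%:Z.

(* The irreducible curves on X, as valuations of F(x, u). P^1 x P^1 is covered  *)
(* by four affine planes; a blow-up adds one curve, whose valuation is the      *)
(* multiplicity at the centre, read in local parameters there. The centre on    *)
(* the curve with coordinate t = u / x^j at which t = oo has local parameters   *)
(* 1/x (an equation of that curve) and 1/t = x^j / u; for j = 0 this is the     *)
(* point x = u = oo of P^1 x P^1.                                               *)
Variant on_X P (v : Kxu -> int) : Prop :=
| CurveP1P1 xi eta f of
    xi \in [:: xK; xK^-1] & eta \in [:: uK; uK^-1] &
    irreducible f & order_in xi eta (order_along f) v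
| CurveRoot c of
    root P c & order_in (xK - cst c) uK order_at_origin v
| CurveInfinity j of
    (j < (size P).-1)%N & order_in xK^-1 (xK ^+ j / uK) order_at_origin v.

Record curve P := Curve {
  ord_curve :> Kxu -> int;
  _ : `[< valuation ord_curve /\ on_X P ord_curve >] }.

HB.instance Definition _ P := [isSub for @ord_curve P].
HB.instance Definition _ P := [Choice of curve P by <:].

Definition Div P : zmodType := {freeg (curve P)}.

Definition principal P : {pred Div P} :=
  [pred D : Div P |
    `[< exists2 f : Kxu, f != 0 & forall C : curve P, coeff C D = C f >]].

Fact principal_zmod_closed P : zmod_closed (@principal P).
Proof.
have valC (C : curve P) : valuation C by case: C => v /= /asboolP[].
split=> [|D E /asboolP[f nzf Df] /asboolP[g nzg Eg]]; apply/asboolP.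
  by exists 1 => [|C]; rewrite ?oner_neq0 // coeff0 (val1 (valC C)).
have nzV : g^-1 != 0 by rewrite invr_eq0.
exists (f * g^-1) => [|C]; first exact: (mulf_neq0 nzf nzV).
by rewrite coeffB Df Eg (valM (valC C) nzf nzV) (valV (valC C) nzg).
Qed.

HB.instance Definition _ P :=
  GRing.isZmodClosed.Build (Div P) (@principal P) (@principal_zmod_closed P).

Definition Pic P : zmodType := {ideal_quot (@principal P)}.

Definition curve_class P (C : curve P) : Pic P := \pi_(Pic P) << C >>.

(* The automorphism of F(x, u) induced by an automorphism sigma of F, where s   *)
(* is the chosen square root of a: it extends sigma, fixes x, and sends u to u  *)
(* if sigma fixes s and to P(x) / u otherwise. It is computed on a numerator    *)
(* and a denominator.                                                           *)
Definition bar P (s : F) (sigma : {rmorphism F -> F}) (f : Kxu) : Kxu :=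
  let u' := if sigma s == s then uK else (map_poly cst P).[xK] / uK in
  let ev g := subst xK u' (map_poly (map_poly sigma) g) in
  ev \n_(generic_quotient.repr f) / ev \d_(generic_quotient.repr f).

End Surface.

(* The Gal(l/k)-module structure on Pic X through which the natural action of   *)
(* the k-automorphisms of the algebraic closure kbar factors. It is unique:     *)
(* every element of Gal(l/k) extends to kbar, and the classes of curves         *)
(* generate Pic X. The curve C' is the image of C under sigma: its valuation    *)
(* is that of C composed with the inverse of bar P s sigma.                     *)
Definition natural_action (k : fieldType) (l : splittingFieldType k)
    (kbar : closedFieldType) (i : {rmorphism l -> kbar})
    (P : {poly kbar}) (s : kbar)
    (act : gmodule 'Gal({:l} / 1%AS) (Pic P)) : Prop :=
  forall (sigma : {rmorphism kbar -> kbar}) (g : gal_of {:l}),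
    bijective sigma -> (forall c : k, sigma (i c%:A) = i c%:A) ->
    g \in 'Gal({:l} / 1%AS)%g -> (forall y : l, sigma (i y) = i (g y)) ->
    forall C : curve P, exists2 C' : curve P,
      (forall f, C' (bar P s sigma f) = C f) &
      act g (curve_class C) = curve_class C'.

(* Main.v *)
Require Import Defs.
From HB Require Import structures.
From mathcomp Require Import all_boot all_order all_fingroup all_algebra all_field.
From mathcomp Require Import boolp freeg ring zify.

Set Implicit Arguments.
Unset Strict Implicit.
Unset Printing Implicit Defensive.

Import GRing.Theory Num.Theory.
Local Open Scope ring_scope.

(* Pic X is free on the classes of the exceptional curves E_t over the roots  *)
(* y_t of P, of the components W_0, .., W_r (r = deg P) of the fibre x = oo    *)
(* and of the section u = oo: the remaining curves are affine plane curves,   *)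
(* each cut out by one irreducible polynomial of kbar[x, u]. An automorphism  *)
(* fixing sqrt a permutes the E_t and fixes the other classes; one that       *)
(* moves sqrt a sends E_t to the class (sum of the W_m) - E_t' with y_t' the  *)
(* conjugate of y_t, reverses the order of the W_m and adds to the section a  *)
(* combination of the W_m and E_t.                                            *)
(*   For each irreducible factor p_m choose a root and an element tau_m of    *)
(* the stabilizer of that root moving sqrt a; it exists because p_m stays     *)
(* irreducible over k(sqrt a). Sending a cocycle c to the parities of the     *)
(* E-coefficients of c(tau_m) at these roots yields a vector eps in (Z/2)^r'. *)
(* Since #|G| c(g) = g x - x for x = - sum c(g), the vector vanishes only if  *)
(* c is a coboundary, and coboundaries give exactly the constant vectors.     *)
(* For r odd all vectors eps occur; for r even the coefficient at the         *)
(* component W_(r/2), which a flip maps to itself, forces                     *)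
(* sum_m (deg p_m) eps_m = 0, and this condition suffices.                    *)

(** The parity map [cocycle_parity] embeds $H^1$ into $(\mathbb Z/2)^{r'}$ modulo the line of
    constant vectors ([parity_B1]). Its image is everything for odd [r] ([parity_surj]). For even
    [r] it is cut out by one linear condition ([parity_sum]), which is empty exactly when all
    factors have even degree; [picard_H1] counts the dimensions. The geometry enters only through
    [e_act], [w_act] and [s_act], which come from the divisors of the functions $x-c_i$ and $u$
    ([pic_coord_fiber], [pic_coord_zero]). Curves are treated as valuations: one with an equation
    [pi] and a coordinate [t] along it is determined by these two functions ([adapted_uniq]), so
    recognizing the image of a curve amounts to checking where [t] and [pi] go. [chart_curve] and
    [on_XP] list the curves of X, [surface_curve_bar] shows that the automorphisms permute them,
    [affine_relation] gives the freeness of Pic X on the boundary classes, and [bar_image] proves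
    that the explicit formula [pic_act] is the natural action. *)

Lemma quotient_coordinates (K : fieldType) (n p q j : nat)
    (A : 'M[K]_(p, n)) (S : 'M[K]_(q, n)) :
    (A <= S)%MS -> j = (\rank S - \rank A)%N ->
  exists L : 'M[K]_(n, j),
    (forall v : 'rV_n, (v <= S)%MS -> (v *m L == 0) = (v <= A)%MS) /\
    (forall w : 'rV_j, exists2 v : 'rV_n, (v <= S)%MS & v *m L = w).
Proof.
move=> sAS jE; pose T := S *m cokermx A.
have rkT : \rank T = j.
  have := mxrank_mul_ker S (cokermx A); rewrite -/T.
  have -> : \rank (S :&: kermx (cokermx A)) = \rank A.
    suff /eqmx_rank : (S :&: kermx (cokermx A) == A)%MS by [].
    apply/andP; split.
      by rewrite submxE; apply/eqP/sub_kermxP; exact: capmxSr.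
    by rewrite sub_capmx sAS; apply/sub_kermxP; rewrite mulmx_coker.
  by rewrite jE => <-; rewrite addnK.
subst j; rewrite -rkT.
(* [cokermx A] kills exactly the row space of [A], and [pinvmx B] reads off coordinates in a basis
   of the image of [S]. *)
pose B := row_base T; exists (cokermx A *m pinvmx B); split.
  move=> v vS; have vT : (v *m cokermx A <= B)%MS.
    by rewrite eq_row_base submxMr.
  rewrite mulmxA submxE; apply/eqP/eqP => [h|->]; last by rewrite mul0mx.
  by rewrite -[_ *m cokermx A](mulmxKpV vT) h mul0mx.
move=> w; have : (w *m B <= T)%MS by rewrite -(eq_row_base T) submxMl.
case/submxP=> u uE; exists (u *m S); first exact: submxMl.
have -> : u *m S *m (cokermx A *m pinvmx B) = u *m T *m pinvmx B.
  by rewrite /T !mulmxA.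
by rewrite -uE mulmxKp //; exact: row_base_free.
Qed.

(** The first isomorphism theorem: [f] descends by evaluation at a chosen representative, and the
    hypothesis on its kernel makes the choice harmless. *)
Lemma H1_isom (gT : finGroupType) (G : {group gT}) (M V : zmodType)
    (act : gmodule G M) (f : {additive cocycle act -> V}) :
    (forall c, (c \in @B1 _ _ _ act) = (f c == 0)) ->
    (forall v, exists c, f c = v) ->
  zmod_isom (H1 act) V.
Proof.
move=> kerf surf; pose g (x : H1 act) := f (generic_quotient.repr x).
have f_mod c d : (\pi_(H1 act) c == \pi_(H1 act) d)%qT = (f c == f d).
  by rewrite -Quotient.idealrBE kerf raddfB subr_eq0.
have gpi c : g (\pi_(H1 act) c)%qT = f c.
  by apply/eqP; rewrite -f_mod generic_quotient.reprK.
have piP (x : H1 act) : exists c, \pi_(H1 act)%qT c = x.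
  by exists (generic_quotient.repr x); exact: generic_quotient.reprK.
have gB : zmod_morphism g.
  move=> x y; case: (piP x) (piP y) => c <- [d <-].
  by rewrite -raddfB !gpi raddfB.
pose gadd : {additive H1 act -> V} :=
  HB.pack g (GRing.isZmodMorphism.Build _ _ g gB).
exists gadd; pose h v : H1 act := (\pi_(H1 act) (projT1 (cid (surf v))))%qT.
exists h => [|v]; last by rewrite /= gpi; case: cid.
move=> x; have [c <-] := piP x; rewrite /= /h gpi.
by apply/eqP; rewrite f_mod; apply/eqP; case: cid.
Qed.

(** * First cohomology of the Picard lattice *)

Section Cocycles.
Variables (gT : finGroupType) (G : {group gT}) (M : zmodType).
Variable act : gmodule G M.
Implicit Types (c : cocycle act) (x y : M).

Lemma gactN g x : g \in G -> act g (- x) = - act g x.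
Proof. by move=> Gg; rewrite -sub0r gactB // gact0 // sub0r. Qed.

Lemma gactD g x y : g \in G -> act g (x + y) = act g x + act g y.
Proof. by move=> Gg; rewrite -{1}[y]opprK gactB // gactN // opprK. Qed.

Lemma gact_sum g (J : Type) (q : seq J) (Q : pred J) (f : J -> M) :
  g \in G -> act g (\sum_(j <- q | Q j) f j) = \sum_(j <- q | Q j) act g (f j).
Proof.
by move=> Gg; apply: (big_morph (act g)) => [x y|]; rewrite ?gactD ?gact0.
Qed.

Lemma cocycleM c g h : g \in G -> h \in G -> c (g * h)%g = act h (c g) + c h.
Proof.
case: c => /= c /forall_inP cP Gg Gh.
by have /forall_inP/(_ h Gh)/eqP := cP g Gg.
Qed.

Fact coboundary_subproof x : [ffun g => act g x - x] \in Z1 act.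
Proof.
apply/forall_inP=> g Gg; apply/forall_inP=> h Gh.
by rewrite !ffunE Defs.gactM // gactB // addrA subrK.
Qed.

Definition coboundary x : cocycle act := Cocycle (coboundary_subproof x).

Lemma coboundaryE x g : coboundary x g = act g x - x.
Proof. by rewrite ffunE. Qed.

Lemma coboundary_B1 x : coboundary x \in @B1 _ _ _ act.
Proof. by apply/asboolP; exists x => g _; rewrite coboundaryE. Qed.

(** Sum the cocycle identity over the first factor: this is the usual argument that [#|G|]
    annihilates $H^1$. The coordinates used later are integers, so [#|G|] can be cancelled there. *)
Lemma cocycle_trace c h : h \in G ->
  c h *+ #|G| = act h (- \sum_(g in G) c g) - (- \sum_(g in G) c g).
Proof.
move=> Gh; rewrite gactN // opprK addrC.
rewrite {1}(reindex_inj (mulIg h)) /=.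
rewrite (eq_big (mem G) (fun g => act h (c g) + c h)) => [|g|g].
- by rewrite big_split /= gact_sum // addrC addKr sumr_const.
- by rewrite groupMr.
- by rewrite groupMr // => Gg; rewrite cocycleM.
Qed.

End Cocycles.
Lemma pchar_F2 : 2%N \in [pchar 'F_2].
Proof. exact: pchar_Fp. Qed.

Lemma intr_F2_eq0 (n : int) : (n%:~R == 0 :> 'F_2) = (2 %| n)%Z.
Proof. by rewrite (dvdz_pcharf pchar_F2). Qed.

Lemma oppr_F2 (x : 'F_2) : - x = x.
Proof. exact: oppr_pchar2 pchar_F2 x. Qed.

(** * The abstract lattice: parities of cocycles *)

Section PicardCohomology.
Variables (gT : finGroupType) (G : {group gT}) (M : zmodType).
Variable act : gmodule G M.
Variable I : finType.
Local Notation r := #|I|.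
Variables (e : I -> {additive M -> int}) (w : 'I_r.+1 -> {additive M -> int}).
Variable s : {additive M -> int}.
Hypothesis coord_inj : forall x y, (forall i, e i x = e i y) ->
  (forall m, w m x = w m y) -> s x = s y -> x = y.
Hypothesis coord_surj : forall (a : I -> int) (b : 'I_r.+1 -> int) (z : int),
  exists x, [/\ forall i, e i x = a i, forall m, w m x = b m & s x = z].

Variables (flip : gT -> bool) (rho : gT -> I -> I).
Hypothesis flipM : {in G &, forall g h, flip (g * h)%g = flip g (+) flip h}.
Hypothesis rho_inj : {in G, forall g, injective (rho g)}.
Hypothesis e_act : {in G, forall g x i,
  e (rho g i) (act g x) = if flip g then - e i x - s x else e i x}.
Hypothesis w_act : {in G, forall g x m,
  w m (act g x) =
    if flip g then (\sum_i e i x) + w (rev_ord m) x + s x *+ m else w m x}.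
Hypothesis s_act : {in G, forall g x, s (act g x) = s x}.

Variables (r' : nat) (orb : I -> 'I_r') (b : 'I_r' -> I) (tau : 'I_r' -> gT).
Hypothesis r'_gt0 : (0 < r')%N.
Hypothesis orb_rho : {in G, forall g i, orb (rho g i) = orb i}.
Hypothesis orb_trans : forall i, exists2 g, g \in G & rho g (b (orb i)) = i.
Hypothesis orb_b : forall m, orb (b m) = m.
Hypothesis tau_G : forall m, tau m \in G.
Hypothesis tau_b : forall m, rho (tau m) (b m) = b m.
Hypothesis flip_tau : forall m, flip (tau m).

Implicit Types (c : cocycle act) (x y : M).
Local Notation N := (#|G|%:Z).

Definition cocycle_parity c : 'rV['F_2]_r' :=
  \row_m (e (b m) (c (tau m)))%:~R.

Fact cocycle_parity_zmod_morphism : zmod_morphism cocycle_parity.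
Proof.
by move=> c d; apply/rowP=> m; rewrite !mxE !ffunE raddfB intrB.
Qed.

HB.instance Definition _ :=
  GRing.isZmodMorphism.Build (cocycle act) 'rV['F_2]_r' cocycle_parity
    cocycle_parity_zmod_morphism.

(** [tau m] fixes the root [b m] and flips, so the coboundary has coordinate $-2e-s$ there, whose
    parity does not depend on [m]. *)
Lemma cocycle_parity_coboundary x :
  cocycle_parity (coboundary act x) = const_mx (s x)%:~R.
Proof.
apply/rowP=> m; rewrite !mxE coboundaryE raddfB /=.
rewrite -{1}(tau_b m) e_act // flip_tau.
by rewrite !intrB intrN !oppr_F2 addrAC (addrr_pchar2 pchar_F2) add0r.
Qed.

Let tr c := - \sum_(g in G) c g.

Lemma N_neq0 : N != 0.
Proof. by rewrite eqz_nat -lt0n cardG_gt0. Qed.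

(** The coordinate [s] is invariant, so it vanishes on $\#G\cdot c(h)$, and the integers have no
    torsion. *)
Lemma s_cocycle c h : h \in G -> s (c h) = 0.
Proof.
move=> Gh; have /(congr1 s) := cocycle_trace c Gh.
rewrite raddfB /= s_act // subrr raddfMn /= => /eqP.
by rewrite -mulr_natr mulf_eq0 pnatr_eq0 eqn0Ngt cardG_gt0 orbF => /eqP.
Qed.

Lemma s_trace c : s (tr c) = 0.
Proof. by rewrite raddfN raddf_sum big1 ?oppr0 // => g; apply: s_cocycle. Qed.

Lemma e_trace c h i : h \in G ->
  N * e (rho h i) (c h) =
    (if flip h then - e i (tr c) else e i (tr c)) - e (rho h i) (tr c).
Proof.
move=> Gh; have /(congr1 (e (rho h i))) := cocycle_trace c Gh.
rewrite raddfMn raddfB /= e_act // -/(tr c) s_trace subr0 => <-.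
by rewrite -mulr_natl natz.
Qed.

Lemma w_trace c h m : h \in G ->
  N * w m (c h) = if flip h
    then (\sum_i e i (tr c)) + w (rev_ord m) (tr c) - w m (tr c) else 0.
Proof.
move=> Gh; have /(congr1 (w m)) := cocycle_trace c Gh.
rewrite raddfMn raddfB /= w_act // -/(tr c) s_trace mul0rn addr0.
by rewrite -mulr_natl natz => ->; case: ifP => // _; rewrite subrr.
Qed.

(* Half-integrality of the trace: the denominators that obstruct solving *)
(* the coboundary equation in the coordinates [e] are read off modulo 2. *)
Lemma trace_parity c i : exists2 q : int,
  2 * e i (tr c) = N * q & q%:~R = cocycle_parity c 0 (orb i).
Proof.
have [g Gg gi] := orb_trans i; set m := orb i in gi *.
have := e_trace c (b m) (tau_G m); rewrite tau_b flip_tau => eb.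
have := e_trace c (b m) Gg; rewrite gi => ei.
rewrite mxE; set eps := e (b m) _ in eb *; set d := e i (c g) in ei.
(* [eb] says that twice the trace coordinate at [b m] is [- N * eps]; [ei] carries this from [b m]
   to [i], at the cost of the even term [2 * d]. *)
exists ((if flip g then eps else - eps) - 2 * d).
  by case: (flip g) ei => ei; lia.
have d2 : (2 * d)%:~R = 0 :> 'F_2 by apply/eqP; rewrite intr_F2_eq0 dvdz_mulr.
by rewrite intrB d2 subr0; case: ifP => _; rewrite ?intrN ?oppr_F2.
Qed.

Lemma exists_flip : exists2 g, g \in G & flip g.
Proof. by exists (tau (Ordinal r'_gt0)). Qed.

(** Only the components at infinity remain, which a flip permutes by reversal. By [w_trace] the
    cocycle has the same [w] coordinates at every flip and zero ones elsewhere, so one flip [t]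
    suffices to find the bounding class. *)
Lemma e0_B1 c : {in G, forall g i, e i (c g) = 0} -> c \in @B1 _ _ _ act.
Proof.
move=> ec0; have [t Gt ft] := exists_flip.
(* The coordinates of [c t] are antisymmetric under reversal, so it is enough to place them, with a
   sign, on the upper half of the indices. *)
have [x [ex wx sx]] := coord_surj (fun=> 0)
  (fun m => if (rev_ord m < m)%N then - w m (c t) else 0) 0.
have sume : \sum_i e i (tr c) = 0.
  rewrite big1 // => i _; rewrite raddfN raddf_sum big1 ?oppr0 // => g Gg.
  exact: ec0.
apply/asboolP; exists x => g Gg; apply: coord_inj => [i|m|].
- have [j _ <-] : exists2 j, true & rho g j = i.
    by exists (invF (rho_inj Gg) i); rewrite ?f_invF.
  by rewrite ec0 // raddfB /= e_act // !ex sx !subr0 oppr0; case: ifP.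
- apply/(mulfI N_neq0); rewrite w_trace // raddfB /= w_act // sume add0r sx.
  case: ifP => // _; last by rewrite subrr mulr0.
  rewrite mul0rn addr0 big1 // add0r !wx.
  have wt k := w_trace c k Gt; rewrite ft in wt.
  rewrite mulrBr; have := wt m; have := wt (rev_ord m).
  rewrite sume !add0r rev_ordK; case: (ltngtP (rev_ord m) m) => h; rewrite ?mulrN.
  + by move=> _ ->; rewrite mulr0 opprK add0r.
  + by move=> -> _; rewrite mulr0 subr0 opprB.
  + by move=> _ _; rewrite (val_inj h) !subrr.
- by rewrite s_cocycle // raddfB /= s_act // subrr.
Qed.

(** Vanishing parities make the trace coordinates [e i] divisible by [#|G|]; the quotients are the
    coordinates of a class whose coboundary clears all [e] coordinates of the cocycle, which reduces
    to [e0_B1]. *)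
Lemma parity0_B1 c : cocycle_parity c = 0 -> c \in @B1 _ _ _ act.
Proof.
move=> pc0.
have [a aP] : exists a : I -> int, forall i, e i (tr c) = N * a i.
  have h i : exists z : int, e i (tr c) = N * z.
    have [q q2 /eqP] := trace_parity c i; rewrite pc0 mxE intr_F2_eq0.
    by case/dvdzP=> z zE; exists z; move: q2; rewrite zE; lia.
  by exists (fun i => projT1 (cid (h i))) => i; case: cid.
have [y [ey wy sy]] := coord_surj a (fun=> 0) 0.
rewrite -[c](subrK (coboundary act y)) rpredD ?coboundary_B1 //.
apply: e0_B1 => g Gg i.
have [j _ <-] : exists2 j, true & rho g j = i.
  by exists (invF (rho_inj Gg) i); rewrite ?f_invF.
rewrite !ffunE !raddfB /= e_act // !ey sy subr0.
apply/eqP; rewrite -opprD subr_eq0; apply/eqP/(mulfI N_neq0).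
by rewrite e_trace // !aP mulrBr; case: ifP => _; rewrite ?mulrN.
Qed.

(** A constant parity vector is cleared by the coboundary of a class with the right [s] coordinate,
    and then [parity0_B1] applies. *)
Lemma parity_B1 c : (c \in @B1 _ _ _ act) =
  (cocycle_parity c <= (const_mx 1 : 'rV['F_2]_r'))%MS.
Proof.
apply/asboolP/sub_rVP => [[x cx]|[z cz]].
  exists (s x)%:~R; rewrite -[RHS](_ : const_mx (s x)%:~R = _); last first.
    by apply/rowP=> m; rewrite !mxE mulr1.
  rewrite -cocycle_parity_coboundary; apply/rowP=> m.
  by rewrite !mxE coboundaryE cx.
have [x [_ _ sx]] := coord_surj (fun=> 0) (fun=> 0) (z : nat)%:Z.
suff : c - coboundary act x \in @B1 _ _ _ act.
  by move/rpredD/(_ (coboundary_B1 act x)); rewrite subrK => /asboolP.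
apply: parity0_B1; rewrite raddfB /= cz cocycle_parity_coboundary sx.
by apply/rowP=> m; rewrite !mxE mulr1 -pmulrn natr_Zp subrr.
Qed.

(** In the application these are the degrees of the irreducible factors of P, modulo 2. *)
Definition orbit_sizes : 'cV['F_2]_r' := \col_m #|[set i | orb i == m]|%:R.

Lemma sum_orbits (f : 'I_r' -> 'F_2) :
  \sum_i f (orb i) = \sum_m f m * orbit_sizes m 0.
Proof.
rewrite (partition_big orb predT) //=; apply: eq_bigr => m _.
rewrite (eq_bigr (fun=> f m)) => [|i /eqP-> //].
by rewrite sumr_const mxE mulr_natr; congr (_ *+ _); apply: eq_card => i; rewrite !inE.
Qed.

(** At the index [r./2], fixed by [rev_ord], [w_trace] says that the trace coordinates [e i] add up
    to a multiple of [#|G|]. Compared with the half-integral form of these coordinates in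
    [trace_parity], this makes the sum of the [q i] even. *)
Lemma parity_sum c : ~~ odd r -> cocycle_parity c *m orbit_sizes = 0.
Proof.
move=> r_even; apply/rowP=> k; rewrite !mxE ord1 -sum_orbits.
have [t Gt ft] := exists_flip.
have mid : (r./2 < r.+1)%N by rewrite ltnS leq_half_double -addnn; lia.
have := w_trace c (Ordinal mid) Gt; rewrite ft.
have -> : rev_ord (Ordinal mid) = Ordinal mid.
  by apply: val_inj; rewrite /= subSS; move: (even_halfK r_even); lia.
rewrite addrK => wt.
have qP i := cid2 (trace_parity c i); pose q i := projT1 (sig_of_sig2 (qP i)).
have q1 i : 2 * e i (tr c) = N * q i by rewrite /q; case: (qP i).
have q2 i : (q i)%:~R = cocycle_parity c 0 (orb i) by rewrite /q; case: (qP i).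
rewrite -(eq_bigr _ (fun i _ => q2 i)) -(raddf_sum (intmul 1)) /=.
apply/eqP; rewrite intr_F2_eq0; apply/dvdzP.
exists (w (Ordinal mid) (c t)); apply/(mulfI N_neq0).
rewrite mulrA wt mulr_sumr -(eq_bigr _ (fun i _ => q1 i)) -mulr_sumr.
by rewrite mulrC.
Qed.

(** Find [x] that every flip negates and every other element fixes; then the function equal to [x]
    on flips and to 0 elsewhere is a cocycle. Being negated leaves the parities of the coordinates
    [e] free and imposes one equation on each pair of components at infinity. *)
Lemma parity_surj (d : 'rV['F_2]_r') :
  odd r \/ d *m orbit_sizes = 0 -> exists c, cocycle_parity c = d.
Proof.
move=> dP; pose D : int := \sum_i (d 0 (orb i) : nat)%:Z.
have D2 : ~~ odd r -> exists h : int, D = h * 2.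
  case: dP => [->//|/rowP/(_ 0)]; rewrite !mxE -sum_orbits => d0 _.
  apply/dvdzP; rewrite -intr_F2_eq0 (raddf_sum (intmul 1)) /=; apply/eqP.
  by rewrite -[RHS]d0; apply: eq_bigr => i _; rewrite -pmulrn natr_Zp.
have [om omP] : exists om : 'I_r.+1 -> int, forall m, D + om (rev_ord m) + om m = 0.
  (* Each pair [m], [rev_ord m] must carry a total of [- D]. A self-paired index exists only for
     even [r], where it takes half of it; this is where [D] must be even. *)
  exists (fun m : 'I_r.+1 => if (m < rev_ord m)%N then - D
                   else if (rev_ord m < m)%N then 0 else - (D %/ 2)%Z) => m.
  rewrite rev_ordK; case: (ltngtP m (rev_ord m)) => h; rewrite ?addr0 ?subrr //.
  have [] := D2; last by move=> z ->; rewrite mulzK //; lia.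
  have : (m + m = r)%N by move: h (ltn_ord m) => /=; rewrite subSS; lia.
  by move=> <-; rewrite addnn odd_double.
have [x [ex wx sx]] := coord_surj (fun i => (d 0 (orb i) : nat)%:Z) om 0.
have act0 g : g \in G -> act g x = if flip g then - x else x.
  move=> Gg; apply: coord_inj => [i|m|].
  - have [j _ <-] : exists2 j, true & rho g j = i.
      by exists (invF (rho_inj Gg) i); rewrite ?f_invF.
    by rewrite e_act // sx subr0; case: ifP; rewrite ?raddfN /= !ex orb_rho.
  - rewrite w_act // sx mul0rn addr0; case: ifP => // _; rewrite raddfN /= !wx.
    by rewrite (eq_bigr _ (fun i _ => ex i)); apply/eqP; rewrite -addr_eq0 omP.
  - by rewrite s_act //; case: ifP; rewrite ?raddfN /= sx.
have cP : [ffun g => if flip g then x else 0] \in Z1 act.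
  apply/forall_inP=> g Gg; apply/forall_inP=> h Gh; rewrite !ffunE flipM //.
  case: (flip g); case fh: (flip h); rewrite /= ?act0 ?gact0 ?fh ?addr0 ?add0r //.
  by rewrite addNr.
exists (Cocycle cP); apply/rowP=> m; rewrite mxE /= ffunE flip_tau ex orb_b.
by rewrite -pmulrn natr_Zp.
Qed.

Theorem picard_H1 :
  let j := if odd r then (r' - 1)%N
           else if [forall m, ~~ odd #|[set i | orb i == m]|] then (r' - 1)%N
           else (r' - 2)%N in
  zmod_isom (H1 act) 'rV['Z_2]_j.
Proof.
move=> j; pose A : 'rV['F_2]_r' := const_mx 1.
have rkA : \rank A = 1%N.
  rewrite rank_rV; suff -> : A != 0 by [].
  by apply/eqP=> /rowP/(_ (Ordinal r'_gt0)); rewrite !mxE.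
(* The space of all parity vectors of cocycles. It contains the constant vector, since for even [r]
   the degrees have an even sum. *)
pose S : 'M['F_2]_r' := if odd r then 1%:M else kermx orbit_sizes.
have sumA : A *m orbit_sizes = const_mx r%:R.
  apply/rowP=> k; rewrite !mxE ord1 -(sum_orbits (A 0)).
  rewrite -sumr_const; apply: eq_bigr => i _; exact: mxE.
have sAS : (A <= S)%MS.
  rewrite /S; case: ifP => [_|/negbT r_even]; first exact: submx1.
  apply/sub_kermxP; rewrite sumA; apply/rowP=> k; rewrite !mxE.
  by apply/eqP; rewrite -(dvdn_pcharf pchar_F2) dvdn2.
have jE : j = (\rank S - \rank A)%N.
  rewrite rkA /j /S; case: ifP => _; first by rewrite mxrank1.
  rewrite mxrank_ker; case: ifP => [/forallP ev|/negbT/forallPn[m odd_m]].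
    rewrite (_ : orbit_sizes = 0) ?mxrank0 ?subn0 //.
    apply/colP=> m; rewrite !mxE; apply/eqP.
    by rewrite -(dvdn_pcharf pchar_F2) dvdn2.
  suff -> : \rank orbit_sizes = 1%N by rewrite -subnDA.
  apply/eqP; rewrite eqn_leq rank_leq_col lt0n mxrank_eq0.
  apply/eqP=> /colP/(_ m); rewrite !mxE => /eqP.
  by rewrite -(dvdn_pcharf pchar_F2) dvdn2 (negPf odd_m).
have [L [kerL surL]] := quotient_coordinates sAS jE.
have parS c : (cocycle_parity c <= S)%MS.
  rewrite /S; case: ifP => [_|/negbT r_even]; first exact: submx1.
  by apply/sub_kermxP; apply: parity_sum.
(* The types ['F_2] and ['Z_2] are convertible. *)
pose f c : 'rV['Z_2]_j := cocycle_parity c *m L.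
have fB : zmod_morphism f by move=> c d; rewrite /f raddfB /= mulmxBl.
pose fadd : {additive cocycle act -> 'rV['Z_2]_j} :=
  HB.pack f (GRing.isZmodMorphism.Build _ _ f fB).
apply: (H1_isom (f := fadd)) => [c|v].
  by rewrite parity_B1 /= /f kerL.
have [d dS dL] := surL v; have [|c cd] := @parity_surj d.
  move: dS; rewrite /S; case: ifP => [|_ /sub_kermxP]; by [left | right].
by exists c; rewrite /= /f cd.
Qed.

End PicardCohomology.

(** * Irreducible polynomials in two variables *)

Section PlaneCurves.
Variable F : closedFieldType.
Local Notation R := {poly {poly F}}.
Implicit Types (f g h : R) (c : F) (q : {poly F}).

(** Divisibility in $\overline k[x][u]$ itself; the relation [%|] would allow factors from the
    coefficient ring $\overline k[x]$ to be cleared. *)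
Definition dvdR f g := exists h, g = f * h.

(** The sum of the exponents of the lexicographically leading monomial: additive on products and
    zero exactly on units, hence a measure for inductions on factors. *)
Definition bidegree g : nat := ((size g).-1 + (size (lead_coef g)).-1)%N.

Lemma bidegreeM f g : f != 0 -> g != 0 ->
  bidegree (f * g) = (bidegree f + bidegree g)%N.
Proof.
move=> f0 g0; rewrite /bidegree lead_coefM !size_mul ?lead_coef_eq0 //.
have arith : forall a b c d : nat, (0 < a)%N -> (0 < b)%N -> (0 < c)%N -> (0 < d)%N ->
  ((a + b).-2 + (c + d).-2 = a.-1 + c.-1 + (b.-1 + d.-1))%N by lia.
have pos (k : R) : k != 0 -> (0 < size k)%N /\ (0 < size (lead_coef k))%N.
  by move=> k0; rewrite !size_poly_gt0 lead_coef_eq0.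
have [[? ?] [? ?]] := (pos f f0, pos g g0).
by apply: arith.
Qed.

Lemma unitRP g : reflect (exists2 c, c != 0 & g = c%:P%:P) (g \is a GRing.unit).
Proof.
apply: (iffP idP) => [|[c c0 ->]].
  rewrite poly_unitE => /andP[/size_poly1P[q q0 ->]]; rewrite coefC eqxx.
  rewrite poly_unitE => /andP[/size_poly1P[c c0 ->] _].
  by exists c.
by rewrite !rmorph_unit // unitfE.
Qed.

Lemma bidegree_unit g : g != 0 -> (bidegree g == 0) = (g \is a GRing.unit).
Proof.
move=> g0; apply/idP/unitRP => [|[c c0 ->]]; last first.
  by rewrite /bidegree size_polyC polyC_eq0 c0 lead_coefC size_polyC c0.
rewrite addn_eq0 -!subn1 !subn_eq0 => /andP[/size1_polyC gE].
rewrite {1}gE lead_coefC => /size1_polyC hE.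
exists g`_0`_0; last by rewrite -hE -gE.
by apply: contra_neq g0 => c0; rewrite gE hE c0.
Qed.

Lemma irreducible_neq0 f : irreducible f -> f != 0.
Proof. by case. Qed.

Lemma irreducible_bidegree f : irreducible f -> (0 < bidegree f)%N.
Proof. by case=> f0 fU _; rewrite lt0n bidegree_unit. Qed.

Lemma irreducible_ndvd_unit f c : irreducible f -> c != 0 -> ~ dvdR f c%:P%:P.
Proof.
case=> f0 /negP fU _ c0 [h fh]; apply: fU.
have : f * h \is a GRing.unit by rewrite -fh; apply/unitRP; exists c.
by rewrite unitrM => /andP[].
Qed.

Lemma irreducible_factor g : g != 0 -> g \isn't a GRing.unit ->
  exists f h, irreducible f /\ g = f * h.
Proof.
elim/ltn_ind: (bidegree g) {-2}g (erefl (bidegree g)) => n IH {}g gn g0 gU.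
have [irr|nirr] := pselect (irreducible g); first by exists g, 1; rewrite mulr1.
have [a [b [gE aU bU]]] :
    exists a b, [/\ g = a * b, a \isn't a GRing.unit & b \isn't a GRing.unit].
  apply: contrapT => nex; apply: nirr; split=> // a b gE.
  have [aU|aU] := boolP (a \is a GRing.unit); first by left.
  have [bU|bU] := boolP (b \is a GRing.unit); first by right.
  by case: nex; exists a, b.
have [a0 b0] : a != 0 /\ b != 0 by move: g0; rewrite gE mulf_eq0 => /norP.
have [|f [h [irr aE]]] := IH (bidegree a) _ a erefl a0 aU.
  by rewrite -gn gE bidegreeM // -[ltnLHS]addn0 ltn_add2l lt0n bidegree_unit.
by exists f, (h * b); rewrite gE aE mulrA.
Qed.

Lemma R_ind (Q : R -> Prop) :
    (forall c, c != 0 -> Q c%:P%:P) ->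
    (forall f h, irreducible f -> h != 0 -> Q h -> Q (f * h)) ->
  forall g, g != 0 -> Q g.
Proof.
move=> Qc Qi g.
elim/ltn_ind: (bidegree g) {-2}g (erefl (bidegree g)) => n IH {}g gn g0.
have [/unitRP[c c0 ->]|gU] := boolP (g \is a GRing.unit); first exact: Qc.
have [f [h [irr gE]]] := irreducible_factor g0 gU.
have h0 : h != 0 by move: g0; rewrite gE mulf_eq0 => /norP[].
rewrite gE; apply: Qi => //; apply: (IH (bidegree h)) => //.
rewrite -gn gE (bidegreeM (irreducible_neq0 irr) h0).
by rewrite -[ltnLHS]add0n ltn_add2r irreducible_bidegree.
Qed.

(** Restriction to the line $x=c$ has values in a domain, whence the primality of $x-c$ in
    [XsubC_prime]. *)
Lemma dvdR_XsubC c g :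
  dvdR ('X - c%:P)%:P g <-> map_poly (horner_eval c) g = 0.
Proof.
split=> [[h ->]|g0].
  by rewrite rmorphM /= map_polyC /= /horner_eval hornerXsubC subrr mul0r.
have gi i : {h : {poly F} | g`_i = h * ('X - c%:P)}.
  apply: cid; apply/factor_theorem; rewrite rootE; apply/eqP.
  by have := congr1 (fun p : {poly F} => p`_i) g0; rewrite coef_map coef0.
exists (\poly_(i < size g) sval (gi i)); apply/polyP=> i.
rewrite coefCM coef_poly; case: ltnP => [_|/leq_sizeP->//].
  by case: (gi i) => h /= ->; rewrite mulrC.
by rewrite mulr0.
Qed.

Lemma XsubC_prime c g h : dvdR ('X - c%:P)%:P (g * h) ->
  dvdR ('X - c%:P)%:P g \/ dvdR ('X - c%:P)%:P h.
Proof.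
rewrite !dvdR_XsubC rmorphM /= => /eqP.
by rewrite mulf_eq0 => /orP[] /eqP; [left | right].
Qed.

(** Every polynomial in [x] splits, so denominators in $\overline k[x]$ can be cleared one linear
    factor at a time. *)
Lemma polyF_ind (Q : {poly F} -> Prop) :
    (forall c, c != 0 -> Q c%:P) ->
    (forall c q, q != 0 -> Q q -> Q (('X - c%:P) * q)) ->
  forall q, q != 0 -> Q q.
Proof.
move=> Qc Qx q q0; have [rs ->] := closed_field_poly_normal q.
have l0 : lead_coef q != 0 by rewrite lead_coef_eq0.
elim: rs => [|c rs IH]; first by rewrite big_nil alg_polyC; apply: Qc.
rewrite big_cons scalerAr; apply: Qx => //.
by rewrite scaler_eq0 negb_or l0 monic_neq0 // monic_prod_XsubC.
Qed.

Lemma XsubC_neq0 c : ('X - c%:P)%:P != 0 :> R.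
Proof. by rewrite polyC_eq0 polyXsubC_eq0. Qed.

Lemma XsubC_nconst c d : ('X - c%:P)%:P <> d%:P%:P :> R.
Proof.
move/polyC_inj/(congr1 (fun p : {poly F} => size p)).
by rewrite size_XsubC size_polyC; case: (d != 0).
Qed.

Lemma size_mulC (q : {poly F}) f : q != 0 -> size (q%:P * f) = size f.
Proof. by move=> q0; rewrite mul_polyC size_scale. Qed.

(** * Gauss's lemma: irreducible elements are prime *)

Section Gauss.
Variable f : R.
Hypotheses (f_irr : irreducible f) (f_size : (1 < size f)%N).

Lemma irreducible_primitive c : ~ dvdR ('X - c%:P)%:P f.
Proof.
case=> h fE; case: f_irr => f0 _ /(_ _ _ fE)[] /unitRP[d d0 dE].
  by case: (XsubC_nconst dE).
by have := f_size; rewrite fE dE size_mulC ?polyXsubC_eq0 // size_polyC polyC_eq0 d0.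
Qed.

Lemma dvdR_clear q g : q != 0 -> dvdR f (q%:P * g) -> dvdR f g.
Proof.
move=> q0; move: q q0 g; apply: polyF_ind => [c c0|c q q0 IH] g [h gh].
  exists (c^-1%:P%:P * h); rewrite mulrCA -gh mulrA -!polyCM mulVf //.
  by rewrite mul1r.
apply: IH; move: gh; rewrite polyCM -mulrA => gh.
have /XsubC_prime[/irreducible_primitive//|[h' hE]] : dvdR ('X - c%:P)%:P (f * h).
  by exists (q%:P * g).
exists h'; apply: (mulfI (XsubC_neq0 c)).
by rewrite gh hE mulrCA.
Qed.

Lemma split_clear q a b : q != 0 -> q%:P * f = a * b ->
  (size a <= 1)%N \/ (size b <= 1)%N.
Proof.
move=> q0; move: q q0 a b; apply: polyF_ind => [c c0|c q q0 IH] a b.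
  move=> fE; case: (f_irr) => _ _ /(_ (c^-1%:P%:P * a) b)[].
  - by rewrite -mulrA -fE mulrA -!polyCM mulVf // mul1r.
  - case/unitRP=> d d0 aE; left; rewrite -(size_mulC _ (q := c^-1%:P)).
      by rewrite aE size_polyC leq_b1.
    by rewrite polyC_eq0 invr_eq0.
  - by case/unitRP=> d d0 ->; right; rewrite size_polyC leq_b1.
rewrite polyCM -mulrA => fE.
have /XsubC_prime[] : dvdR ('X - c%:P)%:P (a * b) by exists (q%:P * f).
  case=> a' aE; rewrite aE size_mulC ?polyXsubC_eq0 //; apply: IH.
  by apply: (mulfI (XsubC_neq0 c)); rewrite fE aE mulrA.
case=> b' bE; rewrite bE size_mulC ?polyXsubC_eq0 //; apply: IH.
by apply: (mulfI (XsubC_neq0 c)); rewrite fE bE mulrCA.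
Qed.

(** Argue over $\overline k(x)$, where greatest common divisors exist: by [split_clear] the one of
    [f] and [g] is either associated to [f] or constant in [u], and [dvdR_clear] brings the
    resulting divisibility back. *)
Lemma Gauss_prime g h : dvdR f (g * h) -> dvdR f g \/ dvdR f h.
Proof.
case=> k ghE; pose d := gcdp f g.
have f0 := irreducible_neq0 f_irr.
have d0 : d != 0 by rewrite gcdp_eq0 negb_and f0.
have [[q e] /= q0 fE] := Pdiv.Idomain.dvdpP _ _ (Pdiv.Idomain.dvdp_gcdl f g).
have [[q2 e2] /= q20 gE] := Pdiv.Idomain.dvdpP _ _ (Pdiv.Idomain.dvdp_gcdr f g).
rewrite -!mul_polyC in fE gE.
have [e1|d1] := split_clear q0 fE.
  left; have /size1_polyC e'E := e1; move: fE; rewrite e'E => fE.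
  have e00 : e`_0 != 0.
    rewrite -polyC_eq0 -e'E; apply: contraNneq f0 => e0.
    by move/eqP: fE; rewrite -e'E e0 mul0r mulf_eq0 polyC_eq0 (negPf q0).
  apply: (@dvdR_clear (e`_0 * q2)); first by rewrite mulf_neq0.
  exists (q%:P * e2); rewrite mulrA (mulrC f) fE polyCM -mulrA gE -/d.
  by ring.
right; have cop : coprimep f g.
  by rewrite coprimep_def eqn_leq d1 size_poly_gt0.
have : f %| h.
  rewrite -(Pdiv.Idomain.Gauss_dvdpr _ cop) ghE.
  by apply: Pdiv.Idomain.dvdp_mulr; apply: Pdiv.Idomain.dvdpp.
case/Pdiv.Idomain.dvdpP=> [[q3 e3]] /= q30; rewrite -mul_polyC => hE.
by apply: (dvdR_clear q30); exists e3; rewrite hE mulrC.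
Qed.

End Gauss.

(** If [u] occurs in [f] this is [Gauss_prime]; otherwise [f] is a polynomial in [x] alone and so a
    constant multiple of some $x-c$. *)
Lemma irreducible_prime f g h :
  irreducible f -> dvdR f (g * h) -> dvdR f g \/ dvdR f h.
Proof.
move=> irr; have [f1|] := leqP (size f) 1; last by move=> s1; exact: (Gauss_prime irr s1).
have /size1_polyC fE := f1; have [f0 fU fP] := irr.
set q := f`_0 in fE; have q0 : q != 0 by rewrite -polyC_eq0 -fE.
have [q1|q2] := leqP (size q) 1.
  case/negP: fU; apply/unitRP; exists q`_0; last by rewrite -size1_polyC.
  by rewrite -polyC_eq0 -size1_polyC.
have [c /factor_theorem[p qE]] : exists c, root q c.
  by apply/closed_rootP; rewrite gtn_eqF.
have [|/unitRP[d d0 dE]|/unitRP[d d0 dE]] := fP p%:P ('X - c%:P)%:P.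
- by rewrite -polyCM -qE.
- have XE k : dvdR f k <-> dvdR ('X - c%:P)%:P k.
    split=> [[k' ->]|[k' ->]].
      by exists (p%:P * k'); rewrite fE qE polyCM mulrCA mulrA.
    exists (d^-1%:P%:P * k'); rewrite fE qE polyCM dE.
    have dd : d%:P%:P * d^-1%:P%:P = 1 :> R by rewrite -!polyCM mulfV.
    by rewrite -[LHS]mul1r -dd; ring.
  by rewrite !XE; apply: XsubC_prime.
- by case: (XsubC_nconst dE).
Qed.

Lemma order_along_exists f g : irreducible f -> g != 0 ->
  exists n, order_along f g n.
Proof.
move=> irr.
elim/ltn_ind: (bidegree g) {-2}g (erefl (bidegree g)) => n IH {}g gn g0.
have [[h gE]|nd] := pselect (dvdR f g); last first.
  by exists 0%N, g => [|h gE]; [rewrite mul1r | apply: nd; exists h].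
have h0 : h != 0 by move: g0; rewrite gE mulf_eq0 => /norP[].
have [|m [k hE kP]] := IH (bidegree h) _ h erefl h0.
  rewrite -gn gE (bidegreeM (irreducible_neq0 irr) h0).
  by rewrite -[ltnLHS]add0n ltn_add2r irreducible_bidegree.
by exists m.+1, k => //; rewrite gE hE exprS mulrA.
Qed.

Lemma order_along_le f g h n m : irreducible f ->
  order_along f g n -> g = f ^+ m * h -> (m <= n)%N.
Proof.
move=> irr [k -> kP] gE; rewrite leqNgt; apply/negP=> nm.
apply: (kP (f ^+ (m - n.+1) * h)); apply: (mulfI (expf_neq0 n (irreducible_neq0 irr))).
by rewrite gE !mulrA -exprSr -exprD subnKC.
Qed.

Lemma order_along_uniq f g n m : irreducible f ->
  order_along f g n -> order_along f g m -> n = m.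
Proof.
move=> irr gn gm; apply/eqP; rewrite eqn_leq.
case: (gn) (gm) => h gh _ [k gk _].
by rewrite (order_along_le irr gm gh) (order_along_le irr gn gk).
Qed.

Lemma order_alongM f g h n m : irreducible f ->
  order_along f g n -> order_along f h m -> order_along f (g * h) (n + m).
Proof.
move=> irr [a -> aP] [b -> bP]; exists (a * b); first by rewrite exprD; ring.
by move=> k abE; case: (@irreducible_prime f a b irr) => [|[k' /aP]|[k' /bP]] //; exists k.
Qed.

End PlaneCurves.

(** * Valuations of the function field *)

Section FunctionField.
Variables (F : closedFieldType) (L : fieldType) (iota : {rmorphism F -> L}).
Variables (x u : L).
Local Notation R := {poly {poly F}}.
Implicit Types (f g h : R) (c d : F) (q : {poly F}) (v : L -> int) (z t pi : L).

Definition evxy (xi eta : L) : R -> L :=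
  horner_eval eta \o map_poly (horner_eval xi \o map_poly iota).

HB.instance Definition _ xi eta := GRing.RMorphism.on (evxy xi eta).

Local Notation tofrac := (evxy x u).
Hypothesis tofrac_neq0 : forall f, f != 0 -> tofrac f != 0.
Hypothesis fraction_ex : forall z, exists a b : R, b != 0 /\ z = tofrac a / tofrac b.

Lemma tofrac_eq0 f : (tofrac f == 0) = (f == 0).
Proof.
have [->|f0] := eqVneq f 0; first by rewrite rmorph0 eqxx.
exact/negbTE/tofrac_neq0.
Qed.

Lemma tofrac_inj : injective tofrac.
Proof.
by move=> f g /eqP; rewrite -subr_eq0 -rmorphB tofrac_eq0 subr_eq0 => /eqP.
Qed.

Lemma fraction_extend (psi : {rmorphism R -> L}) :
    (forall f, f != 0 -> psi f != 0) ->
  exists phi : {rmorphism L -> L}, forall f, phi (tofrac f) = psi f.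
Proof.
move=> psi_inj.
have ex z : exists y, forall a b, b != 0 -> z = tofrac a / tofrac b ->
    y = psi a / psi b.
  have [a [b [b0 zE]]] := fraction_ex z; exists (psi a / psi b) => c d d0.
  rewrite zE => /eqP; rewrite eqr_div ?tofrac_eq0 // -!rmorphM => /eqP.
  move=> /tofrac_inj/(congr1 psi); rewrite !rmorphM => adcb.
  by apply/eqP; rewrite eqr_div ?psi_inj // adcb.
pose phi0 z := projT1 (cid (ex z)).
have phi0E a b : b != 0 -> phi0 (tofrac a / tofrac b) = psi a / psi b.
  by rewrite /phi0; case: cid => y /= yP b0; apply: yP.
have phiB : zmod_morphism phi0.
  move=> z t; have [a [b [b0 ->]]] := fraction_ex z.
  have [c [d [d0 ->]]] := fraction_ex t.
  rewrite -mulNr addf_div ?tofrac_eq0 // -!(rmorphN, rmorphM, rmorphD) /=.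
  rewrite !phi0E ?mulf_neq0 // -mulNr addf_div ?psi_inj //.
  by rewrite !(rmorphN, rmorphM, rmorphD) !mulNr.
have one0 : (1 : R) != 0 by exact: oner_neq0.
have phiM : monoid_morphism phi0.
  split=> [|z t].
    by have := phi0E 1 1 one0; rewrite !rmorph1 !divr1.
  have [a [b [b0 ->]]] := fraction_ex z; have [c [d [d0 ->]]] := fraction_ex t.
  by rewrite mulf_div -!rmorphM /= !phi0E ?mulf_neq0 // !rmorphM mulf_div.
pose phi : {rmorphism L -> L} := HB.pack phi0
  (GRing.isZmodMorphism.Build _ _ phi0 phiB)
  (GRing.isMonoidMorphism.Build _ _ phi0 phiM).
exists phi => a; have := phi0E a 1 one0.
by rewrite !rmorph1 !divr1.
Qed.

Lemma iota_eq0 c : (iota c == 0) = (c == 0).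
Proof. exact: fmorph_eq0. Qed.

Lemma evxyE xi eta f :
  evxy xi eta f = (map_poly (horner_eval xi \o map_poly iota) f).[eta].
Proof. by []. Qed.

Lemma subst_polyC xi eta q : evxy xi eta q%:P = (map_poly iota q).[xi].
Proof. by rewrite /evxy /= map_polyC /horner_eval hornerC. Qed.

Lemma subst_cst xi eta c : evxy xi eta c%:P%:P = iota c.
Proof. by rewrite subst_polyC map_polyC hornerC. Qed.

Lemma substX (xi eta : L) : evxy xi eta 'X%:P = xi.
Proof. by rewrite subst_polyC map_polyX hornerX. Qed.

Lemma substY (xi eta : L) : evxy xi eta 'X = eta.
Proof. by rewrite /evxy /= map_polyX /horner_eval hornerX. Qed.

Lemma rmorph_subst (phi : {rmorphism L -> L}) (sigma : {rmorphism F -> F}) xi eta f :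
    (forall c, phi (iota c) = iota (sigma c)) ->
  phi (evxy xi eta f) =
    evxy (phi xi) (phi eta) (map_poly (map_poly sigma) f).
Proof.
move=> phi_iota; rewrite !evxyE -horner_map -!map_poly_comp.
congr (_.[_]); apply: eq_map_poly => q /=.
rewrite -horner_map -!map_poly_comp; congr (_.[_]); apply: eq_map_poly => c /=.
exact: phi_iota.
Qed.

Record is_valuation v : Prop := IsValuation {
  valuation0 : v 0 = 0;
  valuationM : forall z t, z != 0 -> t != 0 -> v (z * t) = v z + v t;
  valuationD : forall z t, z != 0 -> t != 0 -> z + t != 0 ->
    Num.min (v z) (v t) <= v (z + t) }.

Definition order_by xi eta (ord : R -> nat -> Prop) v :=
  forall f g m n, ord f m -> ord g n ->
    v (evxy xi eta f / evxy xi eta g) = m%:Z - n%:Z.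

Section Valuation.
Variables (v : L -> int) (vv : is_valuation v).

Lemma v1 : v 1 = 0.
Proof.
have := valuationM vv (oner_neq0 L) (oner_neq0 L).
by rewrite mulr1 -{1}[v 1]addr0 => /addrI.
Qed.

Lemma vM z t : z != 0 -> t != 0 -> v (z * t) = v z + v t.
Proof. exact: valuationM. Qed.

Lemma vX z n : z != 0 -> v (z ^+ n) = v z * n%:Z.
Proof.
move=> z0; elim: n => [|n IH]; first by rewrite expr0 v1 mulr0.
by rewrite exprS vM ?expf_neq0 // IH -addn1 PoszD mulrDr mulr1 addrC.
Qed.

Lemma vinv z : z != 0 -> v z^-1 = - v z.
Proof.
move=> z0; have : v (z^-1 * z) = v z^-1 + v z by rewrite vM ?invr_eq0.
by rewrite mulVf // v1 => /esym/eqP; rewrite addr_eq0 => /eqP.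
Qed.

Lemma vdiv z t : z != 0 -> t != 0 -> v (z / t) = v z - v t.
Proof. by move=> z0 t0; rewrite vM ?invr_eq0 // vinv. Qed.

Lemma vopp z : v (- z) = v z.
Proof.
have [->|z0] := eqVneq z 0; first by rewrite oppr0.
have N1 : (-1 : L) != 0 by rewrite oppr_eq0 oner_neq0.
have : v (-1) = 0 by have := vM N1 N1; rewrite mulrNN mulr1 v1; lia.
by move=> vN1; rewrite -mulN1r vM // vN1 add0r.
Qed.

Lemma vge0D z t : 0 <= v z -> 0 <= v t -> 0 <= v (z + t).
Proof.
have [->|z0] := eqVneq z 0; first by rewrite add0r.
have [->|t0] := eqVneq t 0; first by rewrite addr0.
have [->|zt0] := eqVneq (z + t) 0; first by rewrite (valuation0 vv).
by move=> vz vt; apply: Order.POrderTheory.le_trans (valuationD vv z0 t0 zt0); lia.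
Qed.

Lemma vge0M z t : 0 <= v z -> 0 <= v t -> 0 <= v (z * t).
Proof.
have [->|z0] := eqVneq z 0; first by rewrite mul0r (valuation0 vv).
have [->|t0] := eqVneq t 0; first by rewrite mulr0 (valuation0 vv).
by rewrite vM //; lia.
Qed.

(** The case [t = 0] is separate because the value of zero is set to 0 and not to infinity. *)
Lemma vD_lt z t : z != 0 -> (t = 0 \/ v z < v t) ->
  z + t != 0 /\ v (z + t) = v z.
Proof.
move=> z0; have [->|t0] := eqVneq t 0; first by rewrite addr0.
case=> [/eqP|vzt]; first by rewrite (negPf t0).
have zt0 : z + t != 0.
  by apply/eqP=> /eqP; rewrite addr_eq0 => /eqP zE; move: vzt; rewrite zE vopp; lia.
split=> //; have := valuationD vv z0 t0 zt0.
have nt0 : - t != 0 by rewrite oppr_eq0.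
have := valuationD vv zt0 nt0; rewrite addrK => /(_ z0).
by rewrite vopp; lia.
Qed.

Hypothesis v_cst : forall c, c != 0 -> v (iota c) = 0.

Lemma vge0_cst c : 0 <= v (iota c).
Proof.
have [->|c0] := eqVneq c 0; last by rewrite v_cst.
by rewrite rmorph0 (valuation0 vv).
Qed.

Lemma vge0_subst xi eta f : 0 <= v xi -> 0 <= v eta -> 0 <= v (evxy xi eta f).
Proof.
move=> vxi veta; elim/poly_ind: f => [|f q IH].
  by rewrite rmorph0 (valuation0 vv).
rewrite rmorphD rmorphM /= substY subst_polyC vge0D ?vge0M //.
elim/poly_ind: q => [|q c IHq]; first by rewrite rmorph0 horner0 (valuation0 vv).
rewrite rmorphD rmorphM /= map_polyX map_polyC hornerD hornerMX hornerC.
by rewrite vge0D ?vge0M ?vge0_cst.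
Qed.

End Valuation.

(* [v] is the valuation of the curve [pi = 0] in the plane with coordinates *)
(* [t] (along the curve) and [pi]; the field being algebraically closed, it *)
(* is enough that the linear polynomials in [t] do not vanish identically.  *)
Definition adapted t pi v :=
  [/\ is_valuation v, forall c, c != 0 -> v (iota c) = 0, v pi = 1 &
      forall c, t - iota c != 0 /\ v (t - iota c) = 0].

Lemma adapted_neq0 t pi v : adapted t pi v -> pi != 0 /\ t != 0.
Proof.
case=> vv _ vpi vt; split; last by have [] := vt 0; rewrite rmorph0 subr0.
by apply/eqP=> pi0; move: vpi; rewrite pi0 (valuation0 vv).
Qed.

Lemma adapted_t t pi v : adapted t pi v -> v t = 0.
Proof. by case=> _ _ _ /(_ 0) []; rewrite rmorph0 subr0. Qed.

Lemma unit_polyF t v q : is_valuation v -> (forall c, c != 0 -> v (iota c) = 0) ->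
    (forall c, t - iota c != 0 /\ v (t - iota c) = 0) -> q != 0 ->
  (map_poly iota q).[t] != 0 /\ v (map_poly iota q).[t] = 0.
Proof.
move=> vv v_cst vt; move: q; apply: polyF_ind => [c c0|c q q0 [IH0 IHv]].
  by rewrite map_polyC hornerC iota_eq0 v_cst.
have [tc0 vtc] := vt c.
rewrite rmorphM rmorphB /= map_polyX map_polyC hornerM hornerXsubC.
by rewrite mulf_neq0 // vM // vtc IHv.
Qed.

(** The lowest coefficient of [f] in [pi] is a nonzero polynomial in [t], hence of value 0, and the
    remaining terms have larger value. *)
Lemma adapted_order t pi v f n : adapted t pi v ->
    f`_n != 0 -> (forall j, (j < n)%N -> f`_j = 0) ->
  evxy t pi f != 0 /\ v (evxy t pi f) = n%:Z.
Proof.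
move=> ad fn0 fj0; have [vv v_cst vpi vt] := ad.
have [pi0 t0] := adapted_neq0 ad.
have fE : f = ((f`_n)%:P + drop_poly n.+1 f * 'X) * 'X^n.
  apply/polyP=> j; rewrite coefMXn; case: ltnP => [/fj0 //|nj].
  rewrite coefD coefC coefMX coef_drop_poly subn_eq0.
  case: ltngtP nj => // [nj _|-> _]; last by rewrite addr0.
  by rewrite add0r; congr (f`_ _); lia.
have [c0 vc] := unit_polyF vv v_cst vt fn0.
have [|s0 vs] := vD_lt vv (t := evxy t pi (drop_poly n.+1 f) * pi) c0.
  have [->|d0] := eqVneq (evxy t pi (drop_poly n.+1 f)) 0.
    by left; rewrite mul0r.
  right; rewrite vc vM // vpi.
  have := @vge0_subst v vv v_cst t pi (drop_poly n.+1 f).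
  by rewrite (adapted_t ad) vpi => /(_ isT isT); lia.
have -> : evxy t pi f =
    ((map_poly iota f`_n).[t] + evxy t pi (drop_poly n.+1 f) * pi) * pi ^+ n.
  by rewrite {1}fE rmorphM rmorphD rmorphM rmorphXn /= substY subst_polyC.
rewrite mulf_neq0 ?expf_neq0 // vM ?expf_neq0 // vs vc vX // vpi.
by rewrite mul1r add0r.
Qed.

Lemma order_coef_exists f : f != 0 ->
  exists2 n, f`_n != 0 & forall j, (j < n)%N -> f`_j = 0.
Proof.
move=> f0; have ex : exists n, f`_n != 0.
  by exists (size f).-1; rewrite -lead_coefE lead_coef_eq0.
exists (ex_minn ex); first by case: ex_minnP.
case: ex_minnP => n _ min j jn; apply/eqP; apply: contraTT jn => /min.
by rewrite -leqNgt.
Qed.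

Lemma adapted_subst_neq0 t pi v f : adapted t pi v -> f != 0 -> evxy t pi f != 0.
Proof.
move=> ad /order_coef_exists[n fn fj].
by have [] := adapted_order ad fn fj.
Qed.

Definition generates t pi :=
  forall z, exists f g, evxy t pi g != 0 /\ z = evxy t pi f / evxy t pi g.

(** By [adapted_order] such a valuation is the order in [pi], which only depends on the two
    coordinates. *)
Lemma adapted_uniq t pi v v' :
  generates t pi -> adapted t pi v -> adapted t pi v' -> v = v'.
Proof.
move=> gen ad ad'; apply/funext=> z; have [vv _ _ _] := ad; have [vv' _ _ _] := ad'.
have eqs f : evxy t pi f != 0 -> v (evxy t pi f) = v' (evxy t pi f).
  move=> sf0; have f0 : f != 0.
    by apply: contraNneq sf0 => ->; rewrite rmorph0.
  have [n fn fj] := order_coef_exists f0.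
  have [_ ->] := adapted_order ad fn fj.
  by have [_ ->] := adapted_order ad' fn fj.
have [f [g [g0 ->]]] := gen z.
have [->|f0] := eqVneq (evxy t pi f) 0.
  by rewrite mul0r (valuation0 vv) (valuation0 vv').
by rewrite !vdiv // !eqs.
Qed.

Lemma generatesP t pi :
    (exists f g, evxy t pi g != 0 /\ x = evxy t pi f / evxy t pi g) ->
    (exists f g, evxy t pi g != 0 /\ u = evxy t pi f / evxy t pi g) ->
  generates t pi.
Proof.
move=> Sx Su.
pose S z := exists f g, evxy t pi g != 0 /\ z = evxy t pi f / evxy t pi g.
have SD z z' : S z -> S z' -> S (z + z').
  move=> [f [g [g0 ->]]] [f' [g' [g'0 ->]]].
  exists (f * g' + f' * g), (g * g'); rewrite rmorphD !rmorphM mulf_neq0 //.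
  by split=> //; rewrite addf_div.
have SM z z' : S z -> S z' -> S (z * z').
  move=> [f [g [g0 ->]]] [f' [g' [g'0 ->]]].
  exists (f * f'), (g * g'); rewrite !rmorphM mulf_neq0 //.
  by split=> //; rewrite mulf_div.
have Scst c : S (iota c).
  by exists c%:P%:P, 1; rewrite rmorph1 oner_neq0 subst_cst divr1.
have Sfrac f : S (tofrac f).
  elim/poly_ind: f => [|f q IH].
    by rewrite rmorph0 -(rmorph0 iota).
  rewrite rmorphD rmorphM /= substY subst_polyC; apply: (SD) => //.
    exact: SM.
  elim/poly_ind: q => [|q c IHq]; first by rewrite rmorph0 horner0 -(rmorph0 iota).
  rewrite rmorphD rmorphM /= map_polyX map_polyC hornerD hornerMX hornerC.
  by apply: SD; [exact: SM | exact: Scst].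
move=> z; have [a [b [b0 ->]]] := fraction_ex z.
apply: SM => //; have [f [g [g0 bE]]] := Sfrac b.
have f0 : evxy t pi f != 0.
  apply: contraNneq b0 => f0; rewrite -tofrac_eq0 bE f0 mul0r //.
by exists g, f; rewrite bE invf_div.
Qed.

(** When [pi] has a simple pole the top term dominates. This yields the injectivity of the
    substitutions $u\mapsto 1/u$ and $u\mapsto P(x)/u$. *)
Lemma subst_pole_neq0 t pi v f : is_valuation v ->
    (forall c, c != 0 -> v (iota c) = 0) ->
    (forall c, t - iota c != 0 /\ v (t - iota c) = 0) -> v pi = -1 -> f != 0 ->
  evxy t pi f != 0 /\ v (evxy t pi f) = - (size f).-1%:Z.
Proof.
move=> vv v_cst vt vpi.
have pi0 : pi != 0 by apply/eqP=> p0; move: vpi; rewrite p0 (valuation0 vv).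
elim/poly_ind: f => [/eqP//|f q IH].
rewrite rmorphD rmorphM /= substY subst_polyC.
have [-> q0|f0 _] := eqVneq f 0.
  rewrite mul0r rmorph0 mul0r !add0r in q0 *.
  have := q0; rewrite polyC_eq0 => /(unit_polyF vv v_cst vt) [s0 vs].
  by rewrite vs size_polyC; split=> //; case: (q != 0).
have [s0 vs] := IH f0.
have sz : (size (f * 'X + q%:P)).-1 = (size f).-1.+1.
  by rewrite size_MXaddC (negPf f0) /= prednK // size_poly_gt0.
have vE : v (evxy t pi f * pi) = - (size f).-1.+1%:Z by rewrite vM // vs vpi; lia.
rewrite sz -vE; apply: vD_lt; rewrite ?mulf_neq0 // vE.
have [->|q0] := eqVneq q 0; first by left; rewrite rmorph0 horner0.
by right; have [_ ->] := unit_polyF vv v_cst vt q0; lia.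
Qed.

Lemma adapted_inv t pi v : adapted t pi v -> adapted t^-1 pi v.
Proof.
move=> ad; have [vv v_cst vpi vt] := ad; have [pi0 t0] := adapted_neq0 ad.
split=> // c; have [->|c0] := eqVneq c 0.
  by rewrite rmorph0 subr0 invr_eq0 t0 vinv // (adapted_t ad) oppr0.
have -> : t^-1 - iota c = - iota c * (t - iota c^-1) / t.
  by rewrite fmorphV; field; rewrite iota_eq0 c0 t0.
have [h0 vh] := vt c^-1; have nc0 : - iota c != 0 by rewrite oppr_eq0 iota_eq0.
by rewrite !mulf_neq0 ?invr_eq0 // !vM ?mulf_neq0 ?invr_eq0 // vinv // vh vopp //
  v_cst // (adapted_t ad).
Qed.

Lemma valuation_comp (phi : {rmorphism L -> L}) v :
  is_valuation v -> is_valuation (v \o phi).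
Proof.
move=> vv; split=> [|z t z0 t0|z t z0 t0 zt0] /=.
- by rewrite rmorph0 (valuation0 vv).
- by rewrite rmorphM vM ?fmorph_eq0.
- by rewrite rmorphD valuationD -?rmorphD ?fmorph_eq0.
Qed.

Lemma adapted_comp (phi : {rmorphism L -> L}) (sigma : {rmorphism F -> F}) v t pi :
    (forall c, phi (iota c) = iota (sigma c)) ->
  adapted (phi t) (phi pi) v -> adapted t pi (v \o phi).
Proof.
move=> phi_cst [vv v_cst vpi vt]; split=> // [|c c0|c] /=.
- exact: valuation_comp.
- by rewrite phi_cst v_cst ?fmorph_eq0.
have [h0 vh] := vt (sigma c); rewrite -(fmorph_eq0 phi).
by rewrite rmorphB phi_cst.
Qed.

Lemma order_in_comp (phi : {rmorphism L -> L}) v xi eta ord :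
    (forall c, phi (iota c) = iota c) ->
  order_by (phi xi) (phi eta) ord v -> order_by xi eta ord (v \o phi).
Proof.
move=> phi_cst vo f g m n fm gn /=; rewrite fmorph_div /=.
have phiE h : phi (evxy xi eta h) = evxy (phi xi) (phi eta) h.
  rewrite (rmorph_subst (sigma := idfun)) //; congr (evxy _ _ _).
  by apply: map_poly_id => p _; apply: map_poly_id.
by rewrite !phiE; apply: vo.
Qed.

(** * Orders of vanishing along plane curves *)

Lemma order_val_exists f : irreducible f ->
  exists v, is_valuation v /\ order_by x u (order_along f) v.
Proof.
move=> irr.
have ex g : exists n, g != 0 -> order_along f g n.
  have [->|g0] := eqVneq g 0; first by exists 0%N.
  by have [n] := order_along_exists irr g0; exists n.
pose o g := projT1 (cid (ex g)).
have oP g : g != 0 -> order_along f g (o g) by rewrite /o; case: cid.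
(* Primality of [f] makes orders additive, so the difference depends only on the quotient. *)
have exv z : exists n : int, forall a b, a != 0 -> b != 0 ->
    z = tofrac a / tofrac b -> n = (o a)%:Z - (o b)%:Z.
  have [a [b [b0 ->]]] := fraction_ex z; exists ((o a)%:Z - (o b)%:Z) => n d n0 d0.
  move/eqP; rewrite eqr_div ?tofrac_eq0 // -!rmorphM => /eqP/tofrac_inj adn.
  have a0 : a != 0.
    by apply: contraTneq (mulf_neq0 n0 b0) => a0; rewrite -adn a0 mul0r eqxx.
  have := order_alongM irr (oP _ a0) (oP _ d0); rewrite adn => /(order_along_uniq irr).
  by move/(_ _ (order_alongM irr (oP _ n0) (oP _ b0))); lia.
pose v z : int := if z == 0 then 0 else projT1 (cid (exv z)).
have vE a b : a != 0 -> b != 0 -> v (tofrac a / tofrac b) = (o a)%:Z - (o b)%:Z.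
  move=> a0 b0; rewrite /v mulf_eq0 invr_eq0 !tofrac_eq0 (negPf a0) (negPf b0) /=.
  by case: cid => n /= nP; apply: nP.
have oM (p q : R) : p != 0 -> q != 0 -> o (p * q) = (o p + o q)%N.
  move=> p0 q0; apply: (order_along_uniq irr); first by apply: oP; rewrite mulf_neq0.
  exact: order_alongM irr (oP _ p0) (oP _ q0).
have oE g n : order_along f g n -> g != 0 /\ o g = n.
  move=> gn; have g0 : g != 0.
    apply/eqP=> g0; case: gn => h; rewrite g0 => /esym/eqP.
    rewrite mulf_eq0 expf_eq0 (negPf (irreducible_neq0 irr)) andbF /= => /eqP ->.
    by move/(_ 0); rewrite mulr0.
  by split=> //; apply: (order_along_uniq irr (oP _ g0) gn).
exists v; split; last first.
  by move=> g h m n /oE[g0 gm] /oE[h0 hn]; rewrite vE // gm hn.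
have nz a b : tofrac a / tofrac b != 0 -> b != 0 -> a != 0.
  by rewrite mulf_eq0 => /norP[]; rewrite tofrac_eq0.
split=> [|z z'|z z']; first by rewrite /v eqxx.
  have [a [b [b0 ->]]] := fraction_ex z; have [c [d [d0 ->]]] := fraction_ex z'.
  move=> /nz/(_ b0) a0 /nz/(_ d0) c0.
  rewrite mulf_div -!rmorphM !vE ?mulf_neq0 //.
  by rewrite !oM //; lia.
have [a [b [b0 ->]]] := fraction_ex z; have [c [d [d0 ->]]] := fraction_ex z'.
move=> /nz/(_ b0) a0 /nz/(_ d0) c0.
rewrite addf_div ?tofrac_eq0 // -!rmorphM -rmorphD => /nz s0.
have {}s0 : a * d + c * b != 0 by apply: s0; rewrite mulf_neq0.
have oD (p q : R) : p != 0 -> q != 0 -> p + q != 0 -> (minn (o p) (o q) <= o (p + q)%R)%N.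
  move=> p0 q0 pq0; have [p' pE _] := oP _ p0; have [q' qE _] := oP _ q0.
  apply: (order_along_le irr (oP _ pq0) (h := f ^+ (o p - minn (o p) (o q)) * p' +
    f ^+ (o q - minn (o p) (o q)) * q')).
  by rewrite mulrDr !mulrA -!exprD !subnKC ?geq_minl ?geq_minr // -pE -qE.
rewrite !vE ?mulf_neq0 // !oM //.
have := oD _ _ (mulf_neq0 a0 d0) (mulf_neq0 c0 b0) s0; rewrite !oM //.
move: (o (a * d + c * b)) => N; lia.
Qed.

Lemma order_in_val xi eta f g n v : irreducible f ->
    order_by xi eta (order_along f) v -> order_along f g n ->
  v (evxy xi eta g) = n%:Z.
Proof.
move=> irr vo gn; have o1 : order_along f 1 0.
  exists 1 => [|h h1]; first by rewrite mul1r.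
  by apply: (@irreducible_ndvd_unit F f 1) => //; [exact: oner_neq0 | exists h].
by have := vo _ _ _ _ gn o1; rewrite rmorph1 divr1 subr0.
Qed.

Lemma order_along0 f g : ~ dvdR f g -> order_along f g 0.
Proof. by move=> nd; exists g => [|h gE]; [rewrite mul1r | apply: nd; exists h]. Qed.

Lemma order_along1 f : irreducible f -> order_along f f 1.
Proof.
move=> irr; exists 1 => [|h h1]; first by rewrite mulr1.
by apply: (@irreducible_ndvd_unit F f 1) => //; [exact: oner_neq0 | exists h].
Qed.

Lemma order_in_cst xi eta f v c : irreducible f ->
  order_by xi eta (order_along f) v -> c != 0 -> v (iota c) = 0.
Proof.
move=> irr vo c0; rewrite -(subst_cst xi eta c).
apply: (order_in_val irr vo); apply: order_along0.
exact: irreducible_ndvd_unit.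
Qed.

Lemma order_in_dvd xi eta f g v : irreducible f ->
  order_by xi eta (order_along f) v -> 0 < v (evxy xi eta g) -> dvdR f g.
Proof.
move=> irr vo; apply: contraPP => nd.
by rewrite (order_in_val irr vo (order_along0 nd)).
Qed.

Lemma order_in_ge0 xi eta f g v : is_valuation v -> irreducible f ->
  order_by xi eta (order_along f) v -> 0 <= v (evxy xi eta g).
Proof.
move=> vv irr vo; have [->|g0] := eqVneq g 0; first by rewrite rmorph0 (valuation0 vv).
by have [n /(order_in_val irr vo) ->] := order_along_exists irr g0.
Qed.

Lemma irreducible_bidegree1 f : f != 0 -> bidegree f = 1%N -> irreducible f.
Proof.
move=> f0 f1; split=> // [|g h fE]; first by rewrite -bidegree_unit // f1.
have [g0 h0] : g != 0 /\ h != 0 by move: f0; rewrite fE mulf_eq0 => /norP.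
have : (bidegree g + bidegree h = 1)%N by rewrite -bidegreeM // -fE.
rewrite -!bidegree_unit //; case: (bidegree g) => [|[|n]]; first by left.
  by case: (bidegree h) => // _; right.
by rewrite !addSn.
Qed.

Lemma irreducibleY : irreducible ('X : R).
Proof.
apply: irreducible_bidegree1; first by rewrite polyX_eq0.
by rewrite /bidegree size_polyX lead_coefX size_poly1.
Qed.

Lemma irreducible_XsubC c : irreducible ('X - c%:P)%:P.
Proof.
apply: irreducible_bidegree1; first exact: XsubC_neq0.
by rewrite /bidegree size_polyC polyXsubC_eq0 lead_coefC size_XsubC.
Qed.

Lemma irreducible_dvdR f g : irreducible f -> irreducible g -> dvdR f g ->
  exists2 c, c != 0 & f = c%:P%:P * g.
Proof.
move=> [_ fU _] [_ _ gP] [h gE]; have [|/unitRP[c c0 hE]] := gP _ _ gE.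
  by rewrite (negPf fU).
exists c^-1; rewrite ?invr_eq0 //.
by rewrite gE hE mulrCA -!polyCM mulVf // mulr1.
Qed.

Lemma dvdR_scale c f g : c != 0 -> dvdR (c%:P%:P * f) g -> dvdR f g.
Proof. by move=> _ [h ->]; exists (c%:P%:P * h); rewrite mulrCA mulrA. Qed.

(** The only curve of a chart on which [eta] vanishes is the axis, with [xi] as a coordinate along
    it. *)
Lemma chartY xi eta f v : is_valuation v -> irreducible f ->
    order_by xi eta (order_along f) v -> 0 < v eta ->
  (forall d, xi - iota d != 0) -> adapted xi eta v.
Proof.
move=> vv irr vo veta xi_d.
have fY : dvdR f 'X by apply: (order_in_dvd irr vo); rewrite substY.
split=> // [c c0||d]; first exact: order_in_cst irr vo c0.
  rewrite -[eta](substY xi); apply: (order_in_val irr vo).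
  have [c c0 fE] := irreducible_dvdR irr irreducibleY fY.
  exists c^-1%:P%:P => [|h' h'E].
    by rewrite expr1 fE mulrC mulrA -!polyCM mulVf // mul1r.
  apply: (@irreducible_ndvd_unit F f c^-1) => //; first by rewrite invr_eq0.
  by exists h'.
split=> //; have -> : xi - iota d = evxy xi eta ('X - d%:P)%:P.
  by rewrite polyCB rmorphB /= substX subst_cst.
apply: (order_in_val irr vo); apply: order_along0.
have [c c0 ->] := irreducible_dvdR irr irreducibleY fY.
move=> /(dvdR_scale c0)[h /(congr1 (fun p : R => p`_0))].
by rewrite coefC /= coefXM /= => /eqP; rewrite polyXsubC_eq0.
Qed.

Lemma chartX xi eta f v : is_valuation v -> irreducible f ->
    order_by xi eta (order_along f) v -> 0 < v xi ->
  (forall d, eta - iota d != 0) -> adapted eta xi v.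
Proof.
move=> vv irr vo vxi eta_d.
have fX : dvdR f ('X - 0%:P)%:P.
  by apply: (order_in_dvd irr vo); rewrite subr0 substX.
have [c c0 fE] := irreducible_dvdR irr (irreducible_XsubC 0) fX.
split=> // [d d0||d]; first exact: order_in_cst irr vo d0.
  rewrite -[xi](substX xi eta); apply: (order_in_val irr vo).
  exists c^-1%:P%:P => [|h' h'E].
    by rewrite expr1 fE subr0 mulrC mulrA -!polyCM mulVf // mul1r.
  apply: (@irreducible_ndvd_unit F f c^-1) => //; first by rewrite invr_eq0.
  by exists h'.
split=> //; have -> : eta - iota d = evxy xi eta ('X - d%:P%:P).
  by rewrite rmorphB /= substY subst_cst.
apply: (order_in_val irr vo); apply: order_along0; rewrite fE.
move/(dvdR_scale c0)/dvdR_XsubC; rewrite rmorphB /= map_polyX map_polyC /=.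
by rewrite /horner_eval hornerC => /eqP; rewrite polyXsubC_eq0.
Qed.

Lemma x_cst d : x - iota d != 0.
Proof.
have -> : x - iota d = tofrac ('X - d%:P)%:P.
  by rewrite polyCB rmorphB /= substX subst_cst.
by rewrite tofrac_eq0 XsubC_neq0.
Qed.

Lemma u_cst d : u - iota d != 0.
Proof.
have -> : u - iota d = tofrac ('X - d%:P%:P).
  by rewrite rmorphB /= substY subst_cst.
by rewrite tofrac_eq0 polyXsubC_eq0.
Qed.

Lemma x_neq0 : x != 0.
Proof. by have := x_cst 0; rewrite rmorph0 subr0. Qed.

Lemma u_neq0 : u != 0.
Proof. by have := u_cst 0; rewrite rmorph0 subr0. Qed.

Lemma inv_cst z d : z != 0 -> (forall d, z - iota d != 0) -> z^-1 - iota d != 0.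
Proof.
move=> z0 zd; rewrite subr_eq0; apply: contra_neq (zd d^-1) => zE.
by rewrite fmorphV -zE invrK subrr.
Qed.

(** * Existence of the valuations of the special curves *)

Lemma adapted_u0 : exists v, adapted x u v /\ order_by x u (order_along 'X) v.
Proof.
have [v [vv vo]] := order_val_exists irreducibleY; exists v; split=> //.
apply: (chartY vv irreducibleY vo); last exact: x_cst.
by rewrite -(substY x u) (order_in_val irreducibleY vo (order_along1 irreducibleY)).
Qed.

Lemma adapted_fiber c : exists v,
  adapted u (x - iota c) v /\ order_by x u (order_along ('X - c%:P)%:P) v.
Proof.
have irr := irreducible_XsubC c.
have [v [vv vo]] := order_val_exists irr; exists v; split=> //.
split=> // [d d0||d]; first exact: order_in_cst irr vo d0.
  have -> : x - iota c = evxy x u ('X - c%:P)%:P.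
    by rewrite polyCB rmorphB /= substX subst_cst.
  exact: (order_in_val irr vo (order_along1 irr)).
split; first exact: u_cst.
have -> : u - iota d = evxy x u ('X - d%:P%:P).
  by rewrite rmorphB /= substY subst_cst.
apply: (order_in_val irr vo); apply: order_along0.
move/dvdR_XsubC; rewrite rmorphB /= map_polyX map_polyC /=.
by rewrite /horner_eval hornerC => /eqP; rewrite polyXsubC_eq0.
Qed.

(** The remaining valuations are pulled back along such endomorphisms from those of the curves $u=0$
    and $x=c$. *)
Lemma subst_rmorphism xi eta : (forall f, f != 0 -> evxy xi eta f != 0) ->
  exists phi : {rmorphism L -> L},
    [/\ forall c, phi (iota c) = iota c, phi x = xi & phi u = eta].
Proof.
move=> inj; have [phi phiE] := fraction_extend (psi := evxy xi eta) inj.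
exists phi; split=> [c||].
- by rewrite -[RHS](subst_cst xi eta) -phiE subst_cst.
- by rewrite -[RHS](substX xi eta) -phiE substX.
- by rewrite -[RHS](substY xi eta) -phiE substY.
Qed.

Lemma adapted_exceptional c : exists v, adapted (u / (x - iota c)) (x - iota c) v.
Proof.
have xc0 := x_cst c; have [v0 [ad0 _]] := adapted_u0.
have [vv0 v0_cst v0u v0x] := ad0.
have ad : adapted x (u * (x - iota c)) v0.
  split=> //; rewrite (vM vv0) ?u_neq0 // v0u.
  by have [_ ->] := v0x c; rewrite addr0.
(* This endomorphism sends $u/(x-c)$ to $u$, so it turns the exceptional curve into the fibre
   $x=c$. *)
have [f|phi [phi_cst phix phiu]] := @subst_rmorphism x (u * (x - iota c)).
  exact: adapted_subst_neq0 ad.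
have [v [adv _]] := adapted_fiber c; exists (v \o phi).
apply: (adapted_comp (sigma := idfun)) => //.
by rewrite fmorph_div rmorphB phi_cst phix phiu mulfK.
Qed.

Lemma adapted_infinity m : exists v, adapted (u / x ^+ m) x^-1 v.
Proof.
have [v0 [ad0 _]] := adapted_u0; have [vv0 v0_cst v0u v0x] := ad0.
have xm0 : x ^+ m != 0 by rewrite expf_neq0 // x_neq0.
have ad : adapted x^-1 (u / x ^+ m) v0.
  apply: adapted_inv; split=> //; rewrite (vdiv vv0) ?u_neq0 // v0u.
  by rewrite (vX vv0) ?x_neq0 // (adapted_t ad0) mul0r subr0.
(* It sends $u/x^m$ to $u$ and $1/x$ to $x$; the wanted curve becomes the fibre $x=0$. *)
have [f|phi [phi_cst phix phiu]] := @subst_rmorphism x^-1 (u / x ^+ m).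
  exact: adapted_subst_neq0 ad.
have [v [adv _]] := adapted_fiber 0; exists (v \o phi).
apply: (adapted_comp (sigma := idfun)) => //.
rewrite fmorph_div fmorphV rmorphXn /= phix phiu invrK exprVn invrK divfK //.
by move: adv; rewrite rmorph0 subr0.
Qed.

Lemma adapted_infinity0 : exists2 v, adapted (u / x ^+ 0) x^-1 v &
  order_by x^-1 u (order_along 'X%:P) v.
Proof.
have [v0 [ad0 _]] := adapted_u0.
have ad : adapted x^-1 u v0 by apply: adapted_inv.
have [f|phi [phi_cst phix phiu]] := @subst_rmorphism x^-1 u.
  exact: adapted_subst_neq0 ad.
have [v [adv vo]] := adapted_fiber 0; exists (v \o phi).
  apply: (adapted_comp (sigma := idfun)) => //.
  rewrite expr0 divr1 fmorphV /= phix phiu invrK.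
  by move: adv; rewrite rmorph0 subr0.
apply: order_in_comp => //; rewrite fmorphV phix phiu invrK.
by move: vo; rewrite subr0.
Qed.

Lemma adapted_section : exists2 v, adapted x u^-1 v &
  order_by x u^-1 (order_along 'X) v.
Proof.
have [v0 [ad0 vo]] := adapted_u0; have [vv0 v0_cst v0u v0x] := ad0.
have [f f0|phi [phi_cst phix phiu]] := @subst_rmorphism x u^-1.
  have [||] // := @subst_pole_neq0 x u^-1 v0 f vv0 v0_cst v0x.
  by rewrite (vinv vv0) ?u_neq0 // v0u.
exists (v0 \o phi).
  by apply: (adapted_comp (sigma := idfun)) => //; rewrite fmorphV phix phiu invrK.
by apply: order_in_comp => //; rewrite fmorphV phix phiu invrK.
Qed.

(** * Blowing up a point *)

Definition blowup f : R := (map_poly (map_poly (@polyC F)) f).['X%:P * 'X].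

Lemma subst_blowup t pi f : evxy t pi (blowup f) = evxy pi (pi * t) f.
Proof.
rewrite /blowup -horner_map rmorphM /= substX substY (mulrC t) evxyE.
congr (_.[_]); rewrite -map_poly_comp; apply: eq_map_poly => q /=.
rewrite evxyE -map_poly_comp [RHS]/horner_eval; congr (_.[_]).
apply: eq_map_poly => c /=.
by rewrite /horner_eval map_polyC hornerC.
Qed.

(** After the substitution the inner variable is the coordinate on the exceptional curve and the
    outer one its equation, so the coefficient of index [n] is the homogeneous part of degree [n],
    and the order along the exceptional curve is the multiplicity. *)
Lemma coef_blowup f n k : (blowup f)`_n`_k = if (k <= n)%N then f`_k`_(n - k) else 0.
Proof.
rewrite /blowup horner_coef !coef_sum.
rewrite (eq_bigr (fun i : 'I_(size (map_poly (map_poly (@polyC F)) f)) =>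
    if (i == k :> nat) && (k <= n)%N then f`_k`_(n - k) else 0)); last first.
  move=> i _; rewrite coef_map /= exprMn mulrA coefMXn -polyC_exp.
  case: ltnP => ni; first by rewrite coef0; case: eqP => // <-; rewrite leqNgt ni.
  rewrite coefMC coef_map /= coefCM coefXn eq_sym.
  by case: eqP => [<-|_]; rewrite ?ni ?mulr1 ?mulr0.
case: ifP => kn; last by rewrite big1 // => i _; rewrite andbF.
have [ks|ks] := ltnP k (size (map_poly (map_poly (@polyC F)) f)).
  rewrite (bigD1 (Ordinal ks)) //= eqxx big1 ?addr0 // => i ik.
  by rewrite andbT; case: eqP => // ik'; move: ik; rewrite -val_eqE /= ik' eqxx.
rewrite big1 => [|i _]; last by rewrite ltn_eqF ?(leq_trans _ ks).
have /polyP/(_ (n - k)%N) : map_poly (@polyC F) f`_k = 0.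
  by rewrite -[LHS](coef_map (map_poly (@polyC F))) nth_default.
by rewrite coef_map coef0 /= => /eqP; rewrite polyC_eq0 => /eqP.
Qed.

Lemma order_at_origin_adapted t pi v f n : adapted t pi v ->
    order_at_origin f n ->
  evxy pi (pi * t) f != 0 /\ v (evxy pi (pi * t) f) = n%:Z.
Proof.
move=> ad [[i [j [ijn fij]]] f0]; rewrite -subst_blowup.
apply: (adapted_order ad) => [|m mn].
  apply: contra_neq fij => /polyP/(_ j); rewrite coef_blowup coef0 -ijn.
  by rewrite leq_addl addnK.
apply/polyP=> k; rewrite coef_blowup coef0; case: leqP => // km.
by rewrite f0 // subnK.
Qed.

Lemma adapted_origin t pi v : adapted t pi v ->
  order_by pi (pi * t) (@order_at_origin F) v.
Proof.
move=> ad f g m n fm gn; have [vv _ _ _] := ad.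
have [f0 vf] := order_at_origin_adapted ad fm.
have [g0 vg] := order_at_origin_adapted ad gn.
by rewrite vdiv // vf vg.
Qed.

Lemma origin_adapted t pi v v0 : adapted t pi v0 -> is_valuation v ->
  order_by pi (pi * t) (@order_at_origin F) v -> adapted t pi v.
Proof.
move=> ad vv vo; have [_ _ _ v0t] := ad; have [pi0 t0] := adapted_neq0 ad.
have ocst c : c != 0 -> order_at_origin c%:P%:P 0.
  move=> c0; split=> [|i j]; last by rewrite ltn0.
  by exists 0%N, 0%N; rewrite !coefC.
have oX : order_at_origin ('X%:P : R) 1.
  split=> [|i j]; first by exists 1%N, 0%N; rewrite coefC coefX oner_neq0.
  rewrite ltnS leqn0 addn_eq0 => /andP[/eqP-> /eqP->].
  by rewrite coefC coefX.
(* The polynomial $u-dx$ has the same multiplicity 1 as $x$; in the present coordinates their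
   quotient is [t - iota d]. *)
have oL d : order_at_origin ('X - (d%:P * 'X)%:P : R) 1.
  split=> [|i j].
    exists 0%N, 1%N; rewrite coefB coefX coefC /= subr0 coefC /=.
    by split=> //; apply: oner_neq0.
  rewrite ltnS leqn0 addn_eq0 => /andP[/eqP-> /eqP->].
  by rewrite coefB coefX coefC /= sub0r coefN coefMX eqxx oppr0.
have o1 := ocst 1 (oner_neq0 _).
split=> // [c c0||d].
- by have := vo _ _ _ _ (ocst c c0) o1; rewrite rmorph1 divr1 subst_cst.
- by have := vo _ _ _ _ oX o1; rewrite rmorph1 divr1 substX.
have [td _] := v0t d; split=> //.
have := vo _ _ _ _ (oL d) oX; rewrite rmorphB polyCM rmorphM /= substX substY subst_cst.
by rewrite (mulrC (iota d)) -mulrBr mulrC mulKf.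
Qed.

Lemma generates_exceptional c : generates (u / (x - iota c)) (x - iota c).
Proof.
have xc0 := x_cst c; apply: generatesP.
  exists ('X + c%:P%:P), 1; rewrite rmorph1 divr1 oner_neq0 rmorphD /= substY.
  by rewrite subst_cst subrK.
by exists ('X%:P * 'X), 1; rewrite rmorph1 divr1 oner_neq0 rmorphM /= substX substY divfK.
Qed.

Lemma generates_infinity m : generates (u / x ^+ m) x^-1.
Proof.
have x0 := x_neq0; apply: generatesP.
  by exists 1, 'X; rewrite rmorph1 substY invr_eq0 x0 div1r invrK.
exists 'X%:P, ('X ^+ m); rewrite rmorphXn /= substX substY expf_neq0 ?invr_eq0 //.
by split=> //; rewrite exprVn invrK divfK // expf_neq0.
Qed.

Lemma generates_section : generates x u^-1.
Proof.
apply: generatesP.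
  by exists 'X%:P, 1; rewrite rmorph1 substX oner_neq0 divr1.
by exists 1, 'X; rewrite rmorph1 substY invr_eq0 u_neq0 div1r invrK.
Qed.

(** * Curves of the affine plane *)

Definition affine v :=
  exists2 f, irreducible f & order_by x u (order_along f) v.

(** Membership in the localization of $\overline k[x,u]$ at the centre of [v]. *)
Definition local_at v z :=
  exists h M, [/\ M != 0, v (tofrac M) = 0 & z * tofrac M = tofrac h].

Lemma affine_local v z : is_valuation v -> affine v -> 0 <= v z -> local_at v z.
Proof.
move=> vv [f irr vo]; have [a [b [b0 ->]]] := fraction_ex z.
have [->|a0] := eqVneq a 0.
  move=> _; exists 0, 1; rewrite rmorph1 rmorph0 !mul0r oner_neq0.
  by rewrite (v1 vv).
have [m am] := order_along_exists irr a0; have [n bn] := order_along_exists irr b0.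
have := vo _ _ _ _ am bn => -> mn.
have {mn} nm : (n <= m)%N by lia.
have [a' aE _] := am; have [b' bE b'P] := bn.
have b'0 : b' != 0 by apply: contraNneq b0 => b'0; rewrite bE b'0 mulr0.
exists (f ^+ (m - n) * a'), b'; split=> //.
  rewrite  (order_in_val irr vo (n := 0)) //.
  by apply: order_along0 => -[k /b'P].
rewrite mulrAC; apply: (canLR (mulfK _)); first by rewrite tofrac_eq0.
rewrite -!rmorphM aE bE; congr tofrac.
by rewrite -{1}(subnKC nm) exprD; ring.
Qed.

Section Criterion.
Variable v : L -> int.
Hypotheses (vv : is_valuation v) (v_cst : forall c, c != 0 -> v (iota c) = 0).
Hypotheses (vx : 0 <= v x) (vu : 0 <= v u).

Lemma vge0_frac f : 0 <= v (tofrac f).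
Proof. by rewrite  vge0_subst. Qed.

Lemma local_frac f : local_at v (tofrac f).
Proof. by exists f, 1; rewrite rmorph1 (v1 vv) mulr1 oner_neq0. Qed.

Lemma local_cst c : local_at v (iota c).
Proof. by rewrite -(subst_cst x u); apply: local_frac. Qed.

Lemma localM z t : local_at v z -> local_at v t -> local_at v (z * t).
Proof.
move=> [h [M [M0 vM0 zE]]] [h' [M' [M'0 vM'0 tE]]].
exists (h * h'), (M * M'); rewrite mulf_neq0 // !rmorphM /= vM ?tofrac_eq0 //.
by rewrite vM0 vM'0 addr0 -zE -tE mulrACA.
Qed.

Lemma localD z t : local_at v z -> local_at v t -> local_at v (z + t).
Proof.
move=> [h [M [M0 vM0 zE]]] [h' [M' [M'0 vM'0 tE]]].
exists (h * M' + h' * M), (M * M').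
rewrite mulf_neq0 // rmorphD !rmorphM /= vM ?tofrac_eq0 //.
by rewrite vM0 vM'0 addr0 -zE -tE; split=> //; ring.
Qed.

Lemma localV z : z != 0 -> v z = 0 -> local_at v z -> local_at v z^-1.
Proof.
move=> z0 vz [h [M [M0 vM0 zE]]]; exists M, h.
have h0 : h != 0 by rewrite -tofrac_eq0 -zE mulf_neq0 // tofrac_eq0.
by rewrite h0 -zE vM ?tofrac_eq0 // vz vM0 mulKf.
Qed.

Lemma local_subst xi eta f :
  local_at v xi -> local_at v eta -> local_at v (evxy xi eta f).
Proof.
move=> lxi leta; elim/poly_ind: f => [|f q IH].
  by rewrite rmorph0 -(rmorph0 tofrac); apply: local_frac.
rewrite rmorphD rmorphM /= substY subst_polyC; apply: localD; first exact: localM.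
elim/poly_ind: q => [|q c IHq].
  by rewrite rmorph0 horner0 -(rmorph0 tofrac); apply: local_frac.
rewrite rmorphD rmorphM /= map_polyX map_polyC hornerD hornerMX hornerC.
apply: localD; first exact: localM.
exact: local_cst.
Qed.

(** Under these hypotheses the valuation ring is a localization of $\overline k[x,u]$. Some
    irreducible factor [f] of the numerator of an element of value 1 has value 1. If a polynomial
    [k] of positive value were prime to [f], writing $k/f=h/M$ with $v(M)=0$ would force [f] to
    divide [M], a contradiction. *)
Lemma affine_criterion : (exists z, v z = 1) ->
    (forall z, 0 <= v z -> exists a b,
      [/\ local_at v a, local_at v b, b != 0, v b = 0 & z = a / b]) ->
  affine v.
Proof.
move=> [z vz] loc.
have {}loc y : 0 <= v y -> local_at v y.
  move=> /loc[a [b [la lb b0 vb ->]]]; apply: localM => //; exact: localV.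
have [f irr vf] : exists2 f, irreducible f & v (tofrac f) = 1.
  have [|h [M [M0 vM0 zE]]] := loc z; first by rewrite vz.
  have z0 : z != 0 by apply/eqP=> z0; move: vz; rewrite z0 (valuation0 vv).
  have : v (tofrac h) = 1 by rewrite -zE vM ?tofrac_eq0 // vz vM0.
  have : h != 0 by rewrite -tofrac_eq0 -zE mulf_neq0 // tofrac_eq0.
  move: h {zE}; apply: R_ind => [c c0|f h irr h0 IH].
    by rewrite subst_cst v_cst.
  have f0 := irreducible_neq0 irr.
  rewrite rmorphM /= vM ?tofrac_eq0 //.
  have := vge0_frac f; have := vge0_frac h => vh vf vfh.
  have [vf1|/IH//] : v (tofrac f) = 1 \/ v (tofrac h) = 1 by lia.
  by exists f.
have f0' := irreducible_neq0 irr.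
have f0 : tofrac f != 0 by rewrite tofrac_eq0.
have key g n : order_along f g n -> g != 0 /\ v (tofrac g) = n%:Z.
  case=> k gE kP.
  have k0 : k != 0 by apply/eqP=> k0; apply: (kP 0); rewrite k0 mulr0.
  have k0' : tofrac k != 0 by rewrite tofrac_eq0.
  split; first by rewrite gE mulf_neq0 // expf_neq0 // irreducible_neq0.
  rewrite gE rmorphM rmorphXn /= vM ?expf_neq0 // vX // vf mul1r.
  have [vk|vk] := ltrP 0 (v (tofrac k)); last by have := vge0_frac k; lia.
  have [|h [M [M0 vM0 /eqP]]] := loc (tofrac k / tofrac f).
    by rewrite vdiv // vf; lia.
  rewrite mulrAC; move/eqP/(canRL (divfK f0)); rewrite -!rmorphM.
  move/tofrac_inj=> kME.
  have [|[k' /kP //]|[M' ME]] := @irreducible_prime F f k M irr.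
    by exists h; rewrite kME mulrC.
  have M'0 : M' != 0 by apply: contraNneq M0 => M'0; rewrite ME M'0 mulr0.
  move: vM0; rewrite ME rmorphM /= vM ?tofrac_eq0 // vf.
  by have := vge0_frac M'; lia.
exists f; first exact: irr.
move=> g h m n /key[g0 vg] /key[h0 vh]; rewrite vdiv ?tofrac_eq0 //.
by rewrite vg vh.
Qed.

End Criterion.

Lemma fraction_order_uniq f v v' : is_valuation v -> is_valuation v' -> irreducible f ->
    order_by x u (order_along f) v -> order_by x u (order_along f) v' -> v = v'.
Proof.
move=> vv vv' irr vo vo'; apply/funext=> z; have [a [b [b0 ->]]] := fraction_ex z.
have [->|a0] := eqVneq a 0.
  by rewrite rmorph0 mul0r (valuation0 vv) (valuation0 vv').
have [m am] := order_along_exists irr a0; have [n bn] := order_along_exists irr b0.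
by rewrite (vo _ _ _ _ am bn) (vo' _ _ _ _ am bn).
Qed.

Lemma order_pos_eq f f' v v' : is_valuation v -> is_valuation v' ->
    irreducible f -> irreducible f' -> order_by x u (order_along f) v ->
    order_by x u (order_along f') v' -> 0 < v' (tofrac f) ->
  v' = v.
Proof.
move=> vv vv' irr irr' vo vo' pos.
apply: (fraction_order_uniq vv' vv irr) => // g h m n gm hn.
have [c c0 f'E] := irreducible_dvdR irr' irr (order_in_dvd irr' vo' pos).
have along g' k : order_along f g' k -> order_along f' g' k.
  have ck j : c%:P%:P ^+ j * c^-1%:P%:P ^+ j = 1 :> R.
    by rewrite -exprMn -!polyCM mulfV // expr1n.
  case=> p -> pP; exists (c^-1%:P%:P ^+ k * p) => [|p' pE].
    by rewrite f'E exprMn -[LHS]mul1r -(ck k); ring.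
  apply: (pP (c%:P%:P ^+ k.+1 * p')).
  by rewrite -[LHS]mul1r -(ck k) -mulrA pE f'E exprS; ring.
by apply: vo'; apply: along.
Qed.

Lemma affine_equation v : is_valuation v -> affine v -> exists e,
  [/\ e != 0, v e = 1 &
      forall v', is_valuation v' -> affine v' -> v' <> v -> v' e = 0].
Proof.
move=> vv [f irr vo]; exists (tofrac f); split.
- by rewrite tofrac_eq0 irreducible_neq0.
- exact: (order_in_val irr vo (order_along1 irr)).
move=> v' vv' [f' irr' vo'] v'v.
have := order_in_ge0 f vv' irr' vo'; case: (ltrgtP (v' (tofrac f)) 0) => // pos _.
by case: v'v; apply: (order_pos_eq vv vv' irr irr').
Qed.

(** Common irreducible factors are peeled off one by one until only constants remain. *)
Lemma affine_units (a b : R) : a != 0 -> b != 0 ->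
    (forall v, is_valuation v -> affine v -> v (tofrac a) = v (tofrac b)) ->
  exists2 c, c != 0 & a = c%:P%:P * b.
Proof.
move=> a0; move: a a0 b; apply: R_ind => [c c0|f h irr h0 IH] b b0 vab.
  have [/unitRP[d d0 ->]|bU] := boolP (b \is a GRing.unit).
    exists (c / d); first by rewrite mulf_neq0 // invr_eq0.
    by rewrite -!polyCM divfK.
  have [f [h [irr bE]]] := irreducible_factor b0 bU.
  have [v [vv vo]] := order_val_exists irr.
  have := vab v vv (ex_intro2 _ _ f irr vo).
  rewrite subst_cst (order_in_cst irr vo c0) bE rmorphM /=.
  have h0 : h != 0 by apply: contraNneq b0 => h0; rewrite bE h0 mulr0.
  have f0 := irreducible_neq0 irr.
  rewrite vM ?tofrac_eq0 // (order_in_val irr vo (order_along1 irr)).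
  by have := order_in_ge0 h vv irr vo; lia.
have f0 := irreducible_neq0 irr.
have [v [vv vo]] := order_val_exists irr.
have [b' bE] : dvdR f b.
  apply: (order_in_dvd irr vo).
  have <- := vab v vv (ex_intro2 _ _ f irr vo).
  rewrite rmorphM /= vM ?tofrac_eq0 // (order_in_val irr vo (order_along1 irr)).
  by have := order_in_ge0 h vv irr vo; lia.
have b'0 : b' != 0 by apply: contraNneq b0 => b'0; rewrite bE b'0 mulr0.
have [v' vv' av'|c c0 hE] := IH b' b'0.
  have := vab v' vv' av'; rewrite bE !rmorphM /= !vM ?tofrac_eq0 //.
  exact: addrI.
by exists c => //; rewrite hE bE mulrCA.
Qed.

Lemma vexprz v z (n : int) : is_valuation v -> z != 0 -> v (z ^ n) = n * v z.
Proof.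
move=> vv z0; case: n => n; first by rewrite -exprnP vX // mulrC.
by rewrite NegzE -exprnN vinv ?expf_neq0 // vX // mulrC mulNr.
Qed.

Lemma vprod_exprz v (J : Type) (s : seq J) (e : J -> L) (n : J -> int) :
    is_valuation v -> (forall j, e j != 0) ->
  v (\prod_(j <- s) e j ^ n j) = \sum_(j <- s) n j * v (e j).
Proof.
move=> vv e0.
suff [] : \prod_(j <- s) e j ^ n j != 0 /\
  v (\prod_(j <- s) e j ^ n j) = \sum_(j <- s) n j * v (e j) by [].
elim: s => [|j s [IH0 IHv]]; first by rewrite !big_nil oner_neq0 (v1 vv).
by rewrite !big_cons mulf_neq0 ?expfz_neq0 // vM ?expfz_neq0 // IHv vexprz.
Qed.

(* The quotient of [z] by the product of the [e j ^ n j] has neither zeros nor *)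
(* poles on the affine plane, hence it is constant.                            *)
Lemma affine_relation v (J : Type) (s : seq J) (e : J -> L) (n : J -> int) z :
    is_valuation v -> (forall c, c != 0 -> v (iota c) = 0) ->
    (forall j, e j != 0) -> z != 0 ->
    (forall v', is_valuation v' -> affine v' ->
       v' z = \sum_(j <- s) n j * v' (e j)) ->
  v z = \sum_(j <- s) n j * v (e j).
Proof.
move=> vv v_cst e0 z0 rel; rewrite -(vprod_exprz s n vv e0).
set y := \prod_(j <- s) e j ^ n j.
have y0 : y != 0.
  by rewrite /y; elim/big_ind: _ => [|? ?|j _]; rewrite ?oner_neq0 ?expfz_neq0 //; apply: mulf_neq0.
have [a [b [b0 zyE]]] := fraction_ex (z / y).
have zy0 : z / y != 0 by rewrite mulf_neq0 ?invr_eq0.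
have a0 : a != 0 by apply: contraNneq zy0 => a0; rewrite zyE a0 rmorph0 mul0r.
have [v' vv' av'|c c0 aE] := affine_units a0 b0.
  have := rel v' vv' av'; rewrite -(vprod_exprz s n vv' e0) -/y => v'zy.
  have : v' (z / y) = 0 by rewrite vdiv // v'zy subrr.
  by rewrite zyE vdiv ?tofrac_eq0 // => /eqP; rewrite subr_eq0 => /eqP.
have -> : z = iota c * y.
  rewrite -(divfK y0 z) zyE aE rmorphM /= subst_cst mulfK //.
  by rewrite tofrac_eq0.
by rewrite vM ?iota_eq0 // v_cst // add0r.
Qed.

Lemma rmorphism_ext (phi psi : {rmorphism L -> L}) :
    (forall c, phi (iota c) = psi (iota c)) -> phi x = psi x -> phi u = psi u ->
  phi =1 psi.
Proof.
move=> eqc eqx equ z; have [a [b [b0 ->]]] := fraction_ex z.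
have eqR f : phi (tofrac f) = psi (tofrac f).
  elim/poly_ind: f => [|f q IH]; first by rewrite !rmorph0.
  rewrite !(rmorphD, rmorphM) /= substY subst_polyC equ IH; congr (_ + _).
  elim/poly_ind: q => [|q c IHq]; first by rewrite rmorph0 horner0 !rmorph0.
  rewrite rmorphD rmorphM /= map_polyX map_polyC hornerD hornerMX hornerC.
  by rewrite !(rmorphD, rmorphM) /= IHq eqx; congr (_ + _); apply: eqc.
by rewrite !fmorph_div !eqR.
Qed.

Lemma generates_fiber c : generates u (x - iota c).
Proof.
apply: generatesP.
  exists ('X + c%:P%:P), 1; rewrite rmorph1 divr1 oner_neq0 rmorphD /= substY.
  by rewrite subst_cst subrK.
by exists 'X%:P, 1; rewrite rmorph1 divr1 oner_neq0 substX.
Qed.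

Lemma generates_xu : generates x u.
Proof.
move=> z; have [a [b [b0 ->]]] := fraction_ex z.
by exists a, b; rewrite tofrac_eq0.
Qed.

Lemma adapted_affine_fiber c v : adapted u (x - iota c) v -> affine v.
Proof.
move=> ad; have [v' [ad' vo]] := adapted_fiber c.
rewrite (adapted_uniq (@generates_fiber c) ad ad').
exact: ex_intro2 (irreducible_XsubC c) vo.
Qed.

Lemma adapted_affine_xu v : adapted x u v -> affine v.
Proof.
move=> ad; have [v' [ad' vo]] := adapted_u0.
rewrite (adapted_uniq generates_xu ad ad').
exact: ex_intro2 irreducibleY vo.
Qed.

(** Along the curve the new coordinate is $c/t$, as good as [t]. The flip $u\mapsto P(x)/u$ has this
    form at the fibres over roots, at their exceptional curves and at infinity. *)
Lemma adapted_recip t pi v c z : adapted t pi v -> c != 0 -> 0 <= v z ->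
  adapted ((iota c + pi * z) / t) pi v.
Proof.
move=> ad c0 vz; have [vv v_cst vpi vt] := ad; have [pi0 t0] := adapted_neq0 ad.
split=> // d.
have [s0 vs] : iota c - iota d * t != 0 /\ v (iota c - iota d * t) = 0.
  have [->|d0] := eqVneq d 0; first by rewrite rmorph0 mul0r subr0 iota_eq0 v_cst.
  have -> : iota c - iota d * t = - iota d * (t - iota (c / d)).
    by rewrite fmorph_div; field; rewrite iota_eq0.
  have [h0 vh] := vt (c / d); have nd0 : - iota d != 0 by rewrite oppr_eq0 iota_eq0.
  by rewrite mulf_neq0 // vM // vopp // v_cst // vh.
have [|n0 vn] := vD_lt vv (t := pi * z) s0.
  have [->|z0] := eqVneq z 0; first by left; rewrite mulr0.
  by right; rewrite vM // vpi vs; lia.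
have -> : (iota c + pi * z) / t - iota d = (iota c - iota d * t + pi * z) / t.
  by field.
by rewrite mulf_neq0 ?invr_eq0 // vdiv // vn vs (adapted_t ad).
Qed.

(** Where a chart coordinate vanishes the curve is an axis. On any other curve [x] and [u] are
    units, and the curve is visible in the affine plane. *)
Lemma chart_curve v f xi eta : is_valuation v -> irreducible f ->
    xi \in [:: x; x^-1] -> eta \in [:: u; u^-1] ->
    order_by xi eta (order_along f) v ->
  [\/ adapted (u / x ^+ 0) x^-1 v, adapted x u^-1 v | affine v].
Proof.
move=> vv irr xiP etaP vo; have [x0 u0] := (x_neq0, u_neq0).
have v_cst c : c != 0 -> v (iota c) = 0 := order_in_cst irr vo.
have xi_d d : xi - iota d != 0.
  move: xiP; rewrite !inE => /orP[] /eqP->; first exact: x_cst.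
  exact: inv_cst x0 x_cst.
have eta_d d : eta - iota d != 0.
  move: etaP; rewrite !inE => /orP[] /eqP->; first exact: u_cst.
  exact: inv_cst u0 u_cst.
have vxi : 0 <= v xi by rewrite -(substX xi eta) (order_in_ge0 _ vv irr vo).
have veta : 0 <= v eta by rewrite -(substY xi eta) (order_in_ge0 _ vv irr vo).
have [xi_pos|xi_npos] := ltrP 0 (v xi).
  have ad := chartX vv irr vo xi_pos eta_d.
  have {}ad : adapted u xi v.
    move: etaP ad; rewrite !inE => /orP[] /eqP-> //.
    by move/adapted_inv; rewrite invrK.
  move: xiP; rewrite !inE => /orP[] /eqP xiE; last first.
    by apply: Or31; rewrite expr0 divr1 -xiE.
  by apply: Or33; apply: (@adapted_affine_fiber 0); rewrite rmorph0 subr0 -xiE.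
have [eta_pos|eta_npos] := ltrP 0 (v eta).
  have ad := chartY vv irr vo eta_pos xi_d.
  have {}ad : adapted x eta v.
    move: xiP ad; rewrite !inE => /orP[] /eqP-> //.
    by move/adapted_inv; rewrite invrK.
  move: etaP; rewrite !inE => /orP[] /eqP etaE; last first.
    by apply: Or32; rewrite -etaE.
  by apply: Or33; apply: adapted_affine_xu; rewrite -etaE.
have vxi0 : v xi = 0 by lia.
have veta0 : v eta = 0 by lia.
have vx : v x = 0.
  move: xiP vxi0; rewrite !inE => /orP[] /eqP-> //.
  by rewrite vinv // => /eqP; rewrite oppr_eq0 => /eqP.
have vu : v u = 0.
  move: etaP veta0; rewrite !inE => /orP[] /eqP-> //.
  by rewrite vinv // => /eqP; rewrite oppr_eq0 => /eqP.
have [vx0 vu0] : 0 <= v x /\ 0 <= v u by rewrite vx vu.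
have lx : local_at v x by rewrite -(substX x u); apply: local_frac.
have lu : local_at v u by rewrite -(substY x u); apply: local_frac.
have lxi : local_at v xi.
  by move: xiP; rewrite !inE => /orP[] /eqP-> //; apply: localV.
have leta : local_at v eta.
  by move: etaP; rewrite !inE => /orP[] /eqP-> //; apply: localV.
(* As [x] and [u] are units along the curve, functions regular in the chart are local on the affine
   plane; only quotients of chart polynomials remain to be treated. *)
apply: Or33; apply: affine_criterion => //.
  by exists (evxy xi eta f); rewrite (order_in_val irr vo (order_along1 irr)).
have gen : generates xi eta.
  have gx : exists f g, evxy xi eta g != 0 /\ x = evxy xi eta f / evxy xi eta g.
    move: xiP; rewrite !inE => /orP[] /eqP ->.
      by exists 'X%:P, 1; rewrite rmorph1 substX oner_neq0 divr1.
    by exists 1, 'X%:P; rewrite rmorph1 substX invr_eq0 x0 div1r invrK.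
  have gu : exists f g, evxy xi eta g != 0 /\ u = evxy xi eta f / evxy xi eta g.
    move: etaP; rewrite !inE => /orP[] /eqP ->.
      by exists 'X, 1; rewrite rmorph1 substY oner_neq0 divr1.
    by exists 1, 'X; rewrite rmorph1 substY invr_eq0 u0 div1r invrK.
  exact: generatesP.
move=> z vz; have [a [b [b0 zE]]] := gen z.
have ev0 g : evxy xi eta g != 0 -> g != 0.
  by apply: contraNneq => ->; rewrite rmorph0.
have [a0|a0] := eqVneq (evxy xi eta a) 0.
  exists 0, 1; rewrite zE a0 !mul0r oner_neq0 (v1 vv); split=> //.
    by rewrite -(rmorph0 tofrac); apply: local_frac.
  by rewrite -(rmorph1 tofrac); apply: local_frac.
have [m am] := order_along_exists irr (ev0 _ a0).
have [n bn] := order_along_exists irr (ev0 _ b0).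
have := vo _ _ _ _ am bn; rewrite -zE => vzE.
have {vzE vz} nm : (n <= m)%N by lia.
have [a' aE _] := am; have [b' bE b'P] := bn.
exists (evxy xi eta (f ^+ (m - n) * a')), (evxy xi eta b').
have eb'0 : evxy xi eta b' != 0.
  by apply: contraNneq b0 => e0; rewrite bE rmorphM /= e0 mulr0.
have ef0 : evxy xi eta f != 0.
  apply/eqP=> e0; have := order_in_val irr vo (order_along1 irr).
  by rewrite e0 (valuation0 vv).
split=> //; try by apply: local_subst.
  by apply: (order_in_val irr vo (n := 0)); apply: order_along0 => -[p /b'P].
rewrite zE aE bE -{1}(subnKC nm) exprD -mulrA !rmorphM /= -mulf_div.
by rewrite divff ?mul1r // rmorphXn expf_neq0.
Qed.

(** * The curves added by the blow-ups, and the boundary *)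

Lemma exceptional_origin c v : is_valuation v ->
  order_by (x - iota c) u (@order_at_origin F) v <->
  adapted (u / (x - iota c)) (x - iota c) v.
Proof.
move=> vv; have xc0 := x_cst c; have [v0 ad0] := adapted_exceptional c.
have uE : u = (x - iota c) * (u / (x - iota c)) by rewrite mulrC divfK.
split=> [|ad]; last by rewrite {1}uE; apply: adapted_origin.
by rewrite {1}uE; apply: origin_adapted ad0 vv.
Qed.

(** The second parameter is the product of $1/x$ and $(u/x^{j+1})^{-1}$. Hence the blow-up of index
    [j], counted from 0, adds the component on which $u\sim x^{j+1}$; the index 0 is left to the
    fibre of $\mathbb P^1\times\mathbb P^1$. *)
Lemma infinity_origin j v : is_valuation v ->
  order_by x^-1 (x ^+ j / u) (@order_at_origin F) v <->
  adapted (u / x ^+ j.+1) x^-1 v.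
Proof.
move=> vv; have x0 := x_neq0; have u0 := u_neq0.
have tE : x ^+ j / u = x^-1 * (u / x ^+ j.+1)^-1.
  by rewrite exprS; field; rewrite u0 x0 expf_neq0.
have [v0 /adapted_inv ad0] := adapted_infinity j.+1.
split=> [|/adapted_inv ad]; last by rewrite tE; apply: adapted_origin.
by rewrite tE => /(origin_adapted ad0 vv)/adapted_inv; rewrite invrK.
Qed.

Section Boundary.
Variables (I : finType) (root_of : I -> F).
Local Notation r := #|I|.

(* The curves [E_i], the components [W_0, .., W_r] of the fibre [x = oo], *)
(* with [u ~ x ^+ m] on [W_m], and the section [u = oo].                  *)
Definition boundary : Type := option (I + 'I_r.+1).

Definition boundary_coord (b : boundary) : L * L :=
  match b with
  | Some (inl i) => (u / (x - iota (root_of i)), x - iota (root_of i))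
  | Some (inr m) => (u / x ^+ m, x^-1)
  | None => (x, u^-1)
  end.

Local Notation adapted_boundary b :=
  (adapted (boundary_coord b).1 (boundary_coord b).2).

Lemma boundary_val_exists b : exists v, adapted_boundary b v.
Proof.
case: b => [[i|m]|]; first exact: adapted_exceptional.
  exact: adapted_infinity.
by have [v ad _] := adapted_section; exists v.
Qed.

Definition boundary_val b := projT1 (cid (boundary_val_exists b)).

Lemma boundary_valP b : adapted_boundary b (boundary_val b).
Proof. by rewrite /boundary_val; case: cid. Qed.

Lemma boundary_val_uniq b v : adapted_boundary b v -> v = boundary_val b.
Proof.
move=> ad; apply: adapted_uniq ad (boundary_valP b).
case: b => [[i|m]|]; [exact: generates_exceptional | exact: generates_infinity |].
exact: generates_section.
Qed.

Lemma boundary_is_valuation b : is_valuation (boundary_val b).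
Proof. by case: (boundary_valP b). Qed.

Lemma boundary_cst b c : c != 0 -> boundary_val b (iota c) = 0.
Proof. by case: (boundary_valP b) => _ + _ _; apply. Qed.

Lemma boundary_u b : boundary_val b u =
  match b with Some (inl _) => 1 | Some (inr m) => - m%:Z | None => -1 end.
Proof.
have vv := boundary_is_valuation b; have u0 := u_neq0; have x0 := x_neq0.
case: b vv (boundary_valP b) => [[i|m]|] vv ad.
- have := adapted_t ad; have [_ _ vpi _] := ad; move: vpi => /= vpi.
  by rewrite vdiv ?x_cst // vpi; lia.
- have := adapted_t ad; have [_ _ vpi _] := ad; move: vpi => /=.
  rewrite vinv // vdiv ?expf_neq0 // vX //; move: (boundary_val _ x) => k kE.
  have -> : k = -1 by lia.
  lia.
- by have [_ _ /= vpi _] := ad; move: vpi; rewrite vinv //; lia.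
Qed.

Lemma boundary_x c b : boundary_val b (x - iota c) =
  match b with
  | Some (inl i) => (root_of i == c)%:R
  | Some (inr _) => -1
  | None => 0
  end.
Proof.
have vv := boundary_is_valuation b; have x0 := x_neq0.
case: b vv (boundary_valP b) (@boundary_cst b) => [[i|m]|] vv ad v_cst.
- have [_ _ /= vpi _] := ad; case: eqP => [<-//|/eqP ic].
  have d0 : root_of i - c != 0 by rewrite subr_eq0.
  have [||_ vD] := vD_lt vv (z := iota (root_of i - c)) (t := x - iota (root_of i)).
  + by rewrite iota_eq0.
  + by right; rewrite vpi v_cst.
  have -> : x - iota c = iota (root_of i - c) + (x - iota (root_of i)).
    by rewrite rmorphB /=; ring.
  by rewrite vD v_cst.
- have [_ _ /= vpi _] := ad; move: vpi; rewrite vinv // => vpi.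
  have vx : boundary_val (Some (inr m)) x = -1 by rewrite -[LHS]opprK vpi.
  have [->|c0] := eqVneq c 0; first by rewrite rmorph0 subr0.
  have [|_ ->] := vD_lt vv (t := - iota c) x0; last by [].
  by right; rewrite vx vopp // v_cst.
- by have [_ _ _ /(_ c)[]] := ad.
Qed.

(** The components at infinity are poles of [x] and the section is a pole of [u]. An exceptional
    curve lies over a point: both [u] and $x-c_i$ vanish on it, which no plane curve allows. *)
Lemma boundary_not_affine b : ~ affine (boundary_val b).
Proof.
have vv := boundary_is_valuation b.
move=> [f irr vo].
have vu : 0 <= boundary_val b u by rewrite -(substY x u) (order_in_ge0 _ vv irr vo).
have vx c : 0 <= boundary_val b (x - iota c).
  have -> : x - iota c = tofrac ('X - c%:P)%:P.
    by rewrite polyCB rmorphB /= substX subst_cst.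
  exact: order_in_ge0 vv irr vo.
move: vu (vx 0); rewrite boundary_u boundary_x.
case: b vv vo vx => [[i|m]|] // vv vo _ _ _.
have upos : 0 < boundary_val (Some (inl i)) u by rewrite boundary_u.
have [_ _ _ /(_ (root_of i))[_]] := chartY vv irr vo upos x_cst.
by rewrite boundary_x eqxx.
Qed.

End Boundary.

(** Dividing by the top power of [x] leaves the leading coefficient plus a regular multiple of
    $1/x$, the form that [adapted_recip] takes. *)
Lemma reverse_at_infinity v q : is_valuation v ->
    (forall c, c != 0 -> v (iota c) = 0) -> 0 <= v x^-1 -> q != 0 ->
  exists2 z, 0 <= v z &
    (map_poly iota q).[x] = (iota (lead_coef q) + x^-1 * z) * x ^+ (size q).-1.
Proof.
move=> vv v_cst vx; move: q; have x0 := x_neq0.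
apply: polyF_ind => [c c0|c q q0 [z vz qE]].
  exists 0; first by rewrite (valuation0 vv).
  by rewrite map_polyC hornerC lead_coefC size_polyC c0 mulr0 addr0 mulr1.
exists (z - iota c * iota (lead_coef q) - iota c * x^-1 * z).
  have vge c' : 0 <= v (iota c') := vge0_cst vv v_cst c'.
  by rewrite !vge0D // vopp // !vge0M.
rewrite rmorphM rmorphB /= map_polyX map_polyC hornerM hornerXsubC qE.
rewrite lead_coefM lead_coefXsubC mul1r size_mul ?polyXsubC_eq0 // size_XsubC.
have sq : (0 < size q)%N by rewrite size_poly_gt0.
have -> : (2 + size q).-1.-1 = (size q).-1.+1 by rewrite prednK //.
by rewrite exprS; field.
Qed.

(** * The automorphisms of the function field *)

Section Flip.
Variables (P : {poly F}) (I : finType) (root_of : I -> F).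
Hypothesis P_fact : P = lead_coef P *: \prod_i ('X - (root_of i)%:P).
Hypotheses (P_neq0 : P != 0) (root_inj : injective root_of).
Local Notation r := #|I|.
Local Notation Px := (map_poly iota P).[x].
Local Notation boundary_val := (@boundary_val I root_of).

Lemma Px_neq0 : Px != 0.
Proof. by rewrite -(subst_polyC x u) tofrac_neq0 // polyC_eq0. Qed.

Lemma size_P : (size P).-1 = r.
Proof.
by rewrite {1}P_fact -big_enum /= size_scale ?lead_coef_eq0 // size_prod_XsubC -cardE.
Qed.

Lemma P_split i : exists2 q, P = q * ('X - (root_of i)%:P) & q.[root_of i] != 0.
Proof.
exists (lead_coef P *: \prod_(j | j != i) ('X - (root_of j)%:P)).
  by rewrite {1}P_fact (bigD1 i) //= -scalerAl mulrC.
rewrite hornerZ mulf_neq0 ?lead_coef_eq0 // horner_prod.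
apply/prodf_neq0 => j ji; rewrite hornerXsubC subr_eq0.
by rewrite (inj_eq root_inj) eq_sym.
Qed.

Section Bar.
Variables (fl : bool) (sigma : {rmorphism F -> F}) (rho : I -> I).
Hypothesis sigma_P : map_poly sigma P = P.
Hypothesis sigma_root : forall i, sigma (root_of i) = root_of (rho i).

(* [bar P s sigma], where [fl] stands for [sigma s != s]. *)
Definition is_bar (phi : {rmorphism L -> L}) :=
  [/\ forall c, phi (iota c) = iota (sigma c), phi x = x &
      phi u = if fl then Px / u else u].

Lemma bar_exists : exists2 phi, is_bar phi &
  forall f, phi (tofrac f) =
    evxy x (if fl then Px / u else u) (map_poly (map_poly sigma) f).
Proof.
have [v0 [ad0 _]] := adapted_u0; have [vv0 v0_cst v0u v0x] := ad0.
set u' := if fl then _ else _.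
have inj f : f != 0 -> evxy x u' f != 0.
  (* In the flipped case, $P(x)/u$ has a simple pole along $u=0$, so no polynomial relation with [x]
     is possible. *)
  rewrite /u'; case: fl => f0; last exact: tofrac_neq0.
  have [||] // := @subst_pole_neq0 x (Px / u) v0 f vv0 v0_cst v0x.
  have [P0 vP] := unit_polyF vv0 v0_cst v0x P_neq0.
  by rewrite vdiv ?u_neq0 // vP v0u.
pose psi : {rmorphism R -> L} := evxy x u' \o map_poly (map_poly sigma).
have [f f0|phi phiE] := @fraction_extend psi.
  apply: inj; apply: contra_neq f0 => sf0.
  apply: (map_inj_poly (f := map_poly sigma)); rewrite ?rmorph0 //.
  exact: map_poly_inj.
exists phi => //; split=> [c||].
- by rewrite -[in LHS](subst_cst x u) phiE /psi /= !map_polyC /= map_polyC subst_cst.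
- by rewrite -[in LHS](substX x u) phiE /psi /= !map_polyC /= map_polyX substX.
- by rewrite -[in LHS](substY x u) phiE /psi /= map_polyX substY.
Qed.

Variable phi : {rmorphism L -> L}.
Hypothesis phi_bar : is_bar phi.

Lemma bar_Px : phi Px = Px.
Proof.
case: phi_bar => phi_iota phix _; rewrite -horner_map phix -map_poly_comp.
rewrite -{2}sigma_P -map_poly_comp; congr (_.[_]).
by apply: eq_map_poly => c /=.
Qed.

Lemma bar_exceptional i v :
    adapted (phi (u / (x - iota (root_of i)))) (x - iota (root_of (rho i))) v ->
  v \o phi = boundary_val (Some (inl i)).
Proof.
case: phi_bar => phi_iota phix _ ad; apply: boundary_val_uniq.
apply: (adapted_comp (sigma := sigma)) => //=.
by rewrite rmorphB /= phix phi_iota sigma_root.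
Qed.

Lemma bar_E i : fl = false ->
  boundary_val (Some (inl (rho i))) \o phi = boundary_val (Some (inl i)).
Proof.
move=> fl0; case: phi_bar => phi_iota phix; rewrite fl0 => phiu.
apply: bar_exceptional; rewrite fmorph_div rmorphB /= phix phiu phi_iota sigma_root.
exact: (boundary_valP root_of (Some (inl (rho i)))).
Qed.

Lemma bar_W m : fl = false ->
  boundary_val (Some (inr m)) \o phi = boundary_val (Some (inr m)).
Proof.
move=> fl0; case: phi_bar => phi_iota phix; rewrite fl0 => phiu.
apply: boundary_val_uniq; apply: (adapted_comp (sigma := sigma)) => //=.
rewrite fmorph_div fmorphV rmorphXn /= phix phiu.
exact: (boundary_valP root_of (Some (inr m))).
Qed.

Lemma bar_U : fl = false -> boundary_val None \o phi = boundary_val None.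
Proof.
move=> fl0; case: phi_bar => phi_iota phix; rewrite fl0 => phiu.
apply: boundary_val_uniq; apply: (adapted_comp (sigma := sigma)) => //=.
rewrite fmorphV /= phix phiu; exact: (boundary_valP root_of None).
Qed.

(** The roots are simple, so $P(x)/(x-c_i)$ takes a nonzero constant value at $x=c_i$. *)
Lemma residue_at i v : is_valuation v -> (forall c, c != 0 -> v (iota c) = 0) ->
    0 <= v x -> exists c z,
  [/\ c != 0, 0 <= v z &
      Px = (iota c + (x - iota (root_of i)) * z) * (x - iota (root_of i))].
Proof.
move=> vv v_cst vx; have [q PE qi] := P_split i.
have /factor_theorem[q1 q1E] : root (q - (q.[root_of i])%:P) (root_of i).
  by rewrite rootE hornerD hornerN hornerC subrr.
exists q.[root_of i], (map_poly iota q1).[x]; split=> //.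
  by rewrite -(subst_polyC x x) vge0_subst.
have -> : Px = (map_poly iota q).[x] * (x - iota (root_of i)).
  by rewrite PE rmorphM rmorphB /= map_polyX map_polyC hornerM hornerXsubC.
congr (_ * _); rewrite -[q in LHS](subrK (q.[root_of i])%:P) q1E.
rewrite rmorphD rmorphM rmorphB /= map_polyX !map_polyC hornerD hornerM.
by rewrite hornerXsubC hornerC addrC mulrC.
Qed.

(** A flip exchanges exceptional curves and fibres over roots: it turns the coordinate $u/(x-c_i)$
    into the residue of $P(x)/(x-c_{\rho(i)})$ divided by [u]. The converse direction is
    [bar_E_flip]. *)
Lemma bar_fiber i v : fl -> adapted u (x - iota (root_of (rho i))) v ->
  v \o phi = boundary_val (Some (inl i)).
Proof.
move=> fl1 ad; case: phi_bar => phi_iota phix; rewrite fl1 => phiu.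
have [vv v_cst vpi _] := ad; have [xc0 u0] := adapted_neq0 ad.
have vx : 0 <= v x.
  rewrite -[x](subrK (iota (root_of (rho i)))) vge0D // ?vpi //.
  exact: vge0_cst.
have [c [z [c0 vz PxE]]] := residue_at (rho i) vv v_cst vx.
apply: bar_exceptional; rewrite fmorph_div rmorphB /= phix phiu phi_iota sigma_root.
have -> : Px / u / (x - iota (root_of (rho i))) =
    (iota c + (x - iota (root_of (rho i))) * z) / u.
  by rewrite PxE; field; rewrite xc0 u0.
exact: adapted_recip.
Qed.

Lemma bar_E_flip i v : fl -> v = boundary_val (Some (inl (rho i))) ->
  adapted u (x - iota (root_of i)) (v \o phi).
Proof.
move=> fl1 vE; case: phi_bar => phi_iota phix; rewrite fl1 => phiu.
have ad : adapted (u / (x - iota (root_of (rho i)))) (x - iota (root_of (rho i))) v.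
  by rewrite vE; exact: (boundary_valP root_of (Some (inl (rho i)))).
have [vv v_cst vpi _] := ad; have [xc0 _] := adapted_neq0 ad.
have vx : 0 <= v x.
  rewrite -[x](subrK (iota (root_of (rho i)))) vge0D // ?vpi //.
  exact: vge0_cst.
have [c [z [c0 vz PxE]]] := residue_at (rho i) vv v_cst vx.
apply: (adapted_comp (sigma := sigma)) => //=.
rewrite rmorphB /= phix phiu phi_iota sigma_root.
have -> : Px / u = (iota c + (x - iota (root_of (rho i))) * z) /
    (u / (x - iota (root_of (rho i)))).
  by rewrite PxE; field; rewrite xc0 u_neq0.
exact: adapted_recip.
Qed.

(** Near $x=\infty$ the flip sends $u/x^m$ to a unit times $x^{r-m}/u$. *)
Lemma bar_W_flip m : fl ->
  boundary_val (Some (inr (rev_ord m))) \o phi = boundary_val (Some (inr m)).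
Proof.
move=> fl1; case: phi_bar => phi_iota phix; rewrite fl1 => phiu.
apply: boundary_val_uniq; apply: (adapted_comp (sigma := sigma)) => //=.
rewrite fmorph_div fmorphV rmorphXn /= phix phiu.
have ad := boundary_valP root_of (Some (inr (rev_ord m))).
move: ad => /=; rewrite -/boundary_val; set v := boundary_val _ => ad.
have [vv v_cst vpi _] := ad; have [_ t0] := adapted_neq0 ad.
have [|z vz PxE] := reverse_at_infinity vv v_cst _ P_neq0; first by rewrite vpi.
have x0 := x_neq0; have u0 := u_neq0.
have -> : Px / u / x ^+ m =
    (iota (lead_coef P) + x^-1 * z) / (u / x ^+ (r.+1 - m.+1)).
  rewrite PxE size_P subSS -{1}(subnK (ltn_ord m : m <= r)%N) exprD.
  by field; rewrite u0 x0 !expf_neq0.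
by apply: adapted_recip => //; rewrite lead_coef_eq0.
Qed.

Lemma bar_section v : fl -> adapted x u v -> v \o phi = boundary_val None.
Proof.
move=> fl1 ad; case: phi_bar => phi_iota phix; rewrite fl1 => phiu.
apply: boundary_val_uniq; apply: (adapted_comp (sigma := sigma)) => //=.
have [vv v_cst vpi vt] := ad; rewrite fmorphV phix phiu.
have [P0 vP] := unit_polyF vv v_cst vt P_neq0.
by split=> //; rewrite invf_div vdiv ?u_neq0 // vP vpi.
Qed.

Lemma bar_U_flip v : fl -> v = boundary_val None -> adapted x u (v \o phi).
Proof.
move=> fl1 vE; case: phi_bar => phi_iota phix; rewrite fl1 => phiu.
apply: (adapted_comp (sigma := sigma)) => //=.
have ad : adapted x u^-1 v by rewrite vE; exact: (boundary_valP root_of None).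
have [vv v_cst vpi vt] := ad; rewrite phix phiu.
have [P0 vP] := unit_polyF vv v_cst vt P_neq0.
by split=> //; rewrite vM ?invr_eq0 ?u_neq0 // vP vpi.
Qed.

(** Along a curve on which [u] and $P(x)$ are units, or without a flip, [phi] and [psi] respect
    local functions. Writing the image of a regular function as $h/M$ and applying [psi] gives the
    quotient that [affine_criterion] asks for. *)
Lemma bar_affine (psi : {rmorphism L -> L}) (sigma' : {rmorphism F -> F}) v :
    cancel phi psi -> cancel psi phi -> (forall c, psi (iota c) = iota (sigma' c)) ->
    psi x = x -> psi u = (if fl then Px / u else u) ->
    is_valuation v -> affine v -> (fl -> v u = 0 /\ v Px = 0) ->
  affine (v \o phi).
Proof.
move=> phiK psiK psi_iota psix psiu vv av vflip.
case: phi_bar => phi_iota phix phiu.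
have [f irr vo] := av.
have v_cst c : c != 0 -> v (iota c) = 0 := order_in_cst irr vo.
have vx : 0 <= v x by rewrite -(substX x u) (order_in_ge0 _ vv irr vo).
have vu : 0 <= v u by rewrite -(substY x u) (order_in_ge0 _ vv irr vo).
have vv' := valuation_comp phi vv.
have v'_cst c : c != 0 -> (v \o phi) (iota c) = 0.
  by move=> c0; rewrite /= phi_iota v_cst // fmorph_eq0.
have v'x : 0 <= (v \o phi) x by rewrite /= phix.
have P0 := Px_neq0; have u0 := u_neq0.
have v'u : 0 <= (v \o phi) u.
  rewrite /= phiu; move: vflip; case: fl => // /(_ isT)[vu0 vP0].
  by rewrite vdiv // vu0 vP0.
have lx : local_at (v \o phi) x by rewrite -[x in X in _ X](substX x u); apply: local_frac.
have lu : local_at (v \o phi) u by rewrite -[u in X in _ X](substY x u); apply: local_frac.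
have lP : local_at (v \o phi) Px.
  by rewrite -(subst_polyC x u); apply: local_frac.
have lpu : local_at (v \o phi) (psi u).
  rewrite psiu; move: phiu vflip; case: fl => // phiu /(_ isT)[vu0 vP0].
  apply: localM => //; apply: localV => //.
  by rewrite /= phiu vdiv // vu0 vP0.
apply: affine_criterion => //.
  exists (psi (tofrac f)); rewrite /= psiK.
  exact: order_in_val irr vo (order_along1 irr).
move=> z v'z; have [h [M [M0 vM0 zE]]] := affine_local vv av v'z.
exists (psi (tofrac h)), (psi (tofrac M)); split.
- by rewrite (rmorph_subst _ _ _ psi_iota) psix; apply: local_subst.
- by rewrite (rmorph_subst _ _ _ psi_iota) psix; apply: local_subst.
- by rewrite fmorph_eq0 tofrac_eq0.
- by rewrite /= psiK.
- by rewrite -zE rmorphM phiK mulfK // fmorph_eq0 tofrac_eq0.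
Qed.

End Bar.

(** * The automorphisms permute the curves of X *)

Definition surface_curve v :=
  is_valuation v /\ ((exists b, v = boundary_val b) \/ affine v).

Lemma affine_ge0 v : is_valuation v -> affine v -> 0 <= v u.
Proof.
by move=> vv [f irr vo]; rewrite -(substY x u) (order_in_ge0 _ vv irr vo).
Qed.

Lemma affine_fiber c v : is_valuation v -> affine v ->
  v (x - iota c) = 0 \/ adapted u (x - iota c) v.
Proof.
move=> vv [f irr vo].
have xcE : x - iota c = tofrac ('X - c%:P)%:P.
  by rewrite polyCB rmorphB /= substX subst_cst.
have := order_in_ge0 ('X - c%:P)%:P vv irr vo; rewrite -xcE.
case: (ltrgtP (v (x - iota c)) 0) => // [pos _|vxc _]; [right|by left].
have [v0 [ad0 vo0]] := adapted_fiber c; have [vv0 _ _ _] := ad0.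
rewrite (order_pos_eq vv0 vv (irreducible_XsubC c) irr vo0 vo) //.
by rewrite -xcE.
Qed.

Section Inverse.
Variables (fl : bool) (sigma sigma' : {rmorphism F -> F}) (rho rho' : I -> I).
Hypothesis sigma_P : map_poly sigma P = P.
Hypothesis sigma'_P : map_poly sigma' P = P.
Hypothesis sigma_root : forall i, sigma (root_of i) = root_of (rho i).
Hypotheses (sigmaK : cancel sigma sigma') (sigma'K : cancel sigma' sigma).
Hypothesis rho'K : cancel rho' rho.
Variables phi psi : {rmorphism L -> L}.
Hypotheses (phi_bar : is_bar fl sigma phi) (psi_bar : is_bar fl sigma' psi).

Lemma bar_cancel : cancel phi psi.
Proof.
have psiP := bar_Px sigma'_P psi_bar.
case: phi_bar psi_bar => phi_iota phix phiu [psi_iota psix psiu].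
have P0 := Px_neq0; have u0 := u_neq0.
apply: (@rmorphism_ext (psi \o phi) idfun) => [c||] /=.
- by rewrite phi_iota psi_iota sigmaK.
- by rewrite phix psix.
rewrite phiu; move: psiu; case: fl => // psiu.
by rewrite fmorph_div /= psiP psiu; field; rewrite P0 u0.
Qed.

(** This is the biregularity of the lifted T, read on curves. A flip exchanges the sections $u=0$
    and $u=\infty$, exchanges fibres over roots and exceptional curves, and reverses the components
    at infinity; every other curve avoids the zeros of [u] and $P(x)$, so that [bar_affine]
    applies. *)
Lemma surface_curve_bar (phiK : cancel phi psi) (psiK : cancel psi phi) v :
  surface_curve v -> surface_curve (v \o phi).
Proof.
move=> [vv vP]; split; first exact: valuation_comp.
have [psi_iota psix psiu] := psi_bar.
case: vP => [[b ->]|av].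
  case flE: fl (phi_bar) => phi_bar'.
  - case: b => [[i|m]|].
    + right; apply: (@adapted_affine_fiber (root_of (rho' i))).
      by apply: (bar_E_flip sigma_root phi_bar') => //; rewrite rho'K.
    + left; exists (Some (inr (rev_ord m))).
      by rewrite -(bar_W_flip phi_bar' (rev_ord m)) // rev_ordK.
    + by right; apply: adapted_affine_xu; apply: (bar_U_flip phi_bar').
  - case: b => [[i|m]|]; left.
    + exists (Some (inl (rho' i))).
      by rewrite -(bar_E sigma_root phi_bar' (rho' i)) // rho'K.
    + by exists (Some (inr m)); apply: (bar_W phi_bar').
    + by exists None; apply: (bar_U phi_bar').
have [fl0|fl1] := eqVneq fl false.
  right; apply: (bar_affine phi_bar phiK psiK psi_iota psix psiu) => //.
  by rewrite fl0.
have {}fl1 : fl by case: fl fl1.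
have := affine_ge0 vv av; case: (ltrgtP (v u) 0) => // [vu _|vu _].
  left; exists None; apply: (bar_section phi_bar) => //.
  by case: av => f irr vo; apply: chartY vv irr vo vu x_cst.
have [[i ad]|nfib] := pselect (exists i, adapted u (x - iota (root_of i)) v).
  left; exists (Some (inl (rho' i))).
  by apply: (bar_fiber sigma_root phi_bar) => //; rewrite rho'K.
right; apply: (bar_affine phi_bar phiK psiK psi_iota psix psiu) => // _.
split=> //; have v_cst c : c != 0 -> v (iota c) = 0.
  by case: av => f irr vo; apply: order_in_cst irr vo.
have -> : Px = iota (lead_coef P) * \prod_i (x - iota (root_of i)) ^ (1 : int).
  rewrite {1}P_fact map_polyZ rmorph_prod /= hornerZ horner_prod.
  congr (_ * _); apply: eq_bigr => i _.
  by rewrite rmorphB /= map_polyX map_polyC hornerXsubC.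
have xr0 i : x - iota (root_of i) != 0 by exact: x_cst.
rewrite vM ?iota_eq0 ?lead_coef_eq0 //; last first.
  by apply/prodf_neq0 => i _; rewrite expfz_neq0.
rewrite v_cst ?lead_coef_eq0 // vprod_exprz // big1 // => i _.
by case: (affine_fiber (root_of i) vv av) => [->//|ad]; case: nfib; exists i.
Qed.

End Inverse.

End Flip.

End FunctionField.
(** * The Picard group of the surface *)

Lemma fractionP (A : idomainType) (z : {fraction A}) :
  z = FracField.tofrac \n_(generic_quotient.repr z) /
      FracField.tofrac \d_(generic_quotient.repr z).
Proof.
have pi_mul (q : {ratio A}) :
    (\pi_({fraction A}) q)%qT * FracField.tofrac \d_q = FracField.tofrac \n_q.
  rewrite /FracField.tofrac; unlock; rewrite -[LHS]FracField.pi_mul /FracField.mulf.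
  apply/eqP; rewrite FracField.equivf_def.
  have dq := denom_ratioP q.
  by rewrite !numden_Ratio ?mulf_neq0 ?oner_neq0 // !mulr1 mulrC.
have d0 : FracField.tofrac \d_(generic_quotient.repr z) != 0.
  by rewrite fraction.tofrac_eq0 denom_ratioP.
have := pi_mul (generic_quotient.repr z); rewrite generic_quotient.reprK.
exact: canRL (mulfK d0).
Qed.

Section Surface.
Variable F : closedFieldType.
Local Notation R := {poly {poly F}}.
Local Notation K := {fraction R}.
Implicit Types (v : K -> int).

HB.instance Definition _ := GRing.RMorphism.copy (@cst F)
  (@FracField.tofrac R \o (@polyC {poly F}) \o (@polyC F)).

Local Notation ev := (@evxy F K (@cst F)).

Lemma ev_subst xi eta f : ev xi eta f = subst xi eta f.
Proof. by []. Qed.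

Lemma ev_tofrac f : ev (xK F) (uK F) f = FracField.tofrac f.
Proof.
have tofracC : @FracField.tofrac R \o polyC =1
    horner_eval (xK F) \o map_poly (@cst F).
  move=> q /=; have -> : map_poly (@cst F) q =
      map_poly (@FracField.tofrac R \o polyC) (map_poly polyC q).
    by rewrite -map_poly_comp.
  by rewrite /horner_eval horner_map /= -/(comp_poly _ _) comp_polyXr.
rewrite evxyE -(eq_map_poly tofracC) map_poly_comp /= horner_map /=.
by rewrite -/(comp_poly _ _) comp_polyXr.
Qed.

Lemma ev_neq0 f : f != 0 -> ev (xK F) (uK F) f != 0.
Proof. by rewrite ev_tofrac fraction.tofrac_eq0. Qed.

Lemma ev_fraction (z : K) : exists a b : R,
  b != 0 /\ z = ev (xK F) (uK F) a / ev (xK F) (uK F) b.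
Proof.
exists \n_(generic_quotient.repr z), \d_(generic_quotient.repr z).
by rewrite !ev_tofrac; split; [exact: denom_ratioP | exact: fractionP].
Qed.

(* [K] and [KF] have convertible but distant [eqType] structures, on which *)
(* unification of the two readings of [z != 0] is prohibitively slow.      *)
Local Notation KF := (K : fieldType).

Lemma field_neq0 (z : K) : z != 0 -> (z : KF) != 0.
Proof. by move=> /eqP z0; apply/eqP. Qed.

Lemma fraction_neq0 (z : K) : (z : KF) != 0 -> z != 0.
Proof. by move=> /eqP z0; apply/eqP. Qed.

Lemma valuationE v : valuation v <-> is_valuation v.
Proof. by split=> [] [? ? ?]; split. Qed.

Section Curves.
Variables (P : {poly F}) (I : finType) (root_of : I -> F).
Hypothesis P_fact : P = lead_coef P *: \prod_i ('X - (root_of i)%:P).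
Hypotheses (P_neq0 : P != 0) (root_inj : injective root_of).
Local Notation r := #|I|.
Local Notation bval := (boundary_val ev_neq0 ev_fraction root_of).

(** The charts contribute the affine curves, the component at infinity of index 0 and the section
    $u=\infty$; the two kinds of blow-up contribute the exceptional curves and the components of
    positive index. *)
Lemma on_XP v : valuation v /\ on_X P v <-> surface_curve ev_neq0 ev_fraction root_of v.
Proof.
have szP := size_P P_fact P_neq0.
split=> [[/valuationE vv vX]|[vv vP]]; split.
- exact: vv.
- case: vX => [xi eta f xiP etaP irr vo|c rc vo|j jr vo].
  + have [ad|ad|av] := chart_curve ev_neq0 ev_fraction vv irr xiP etaP vo.
    * left; exists (Some (inr ord0)); exact: boundary_val_uniq.
    * left; exists None; exact: boundary_val_uniq.
    * by right.
  + have [i ci] : exists i, c = root_of i.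
      move: rc; rewrite P_fact rootZ ?lead_coef_eq0 // rootE horner_prod.
      by move=> /prodf_eq0[i _]; rewrite hornerXsubC subr_eq0 => /eqP; exists i.
    left; exists (Some (inl i)); apply: boundary_val_uniq; rewrite /= -ci.
    exact/(exceptional_origin ev_neq0 ev_fraction c vv).
  + left; have jr' : (j.+1 < r.+1)%N by rewrite -szP.
    exists (Some (inr (Ordinal jr'))); apply: boundary_val_uniq => /=.
    exact/(infinity_origin ev_neq0 ev_fraction j vv).
- exact/valuationE.
case: vP => [[b vE]|[f irr vo]]; last first.
  apply: (@CurveP1P1 F P v (xK F) (uK F) f); rewrite ?inE ?eqxx //.
have := boundary_valP ev_neq0 ev_fraction root_of b; rewrite -vE.
case: b vE => [[i|[[|j] jr]]|] vE ad.
- apply: (@CurveRoot F P v (root_of i)).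
    rewrite P_fact rootZ ?lead_coef_eq0 // rootE horner_prod.
    by apply/prodf_eq0; exists i; rewrite // hornerXsubC subrr.
  exact/(exceptional_origin ev_neq0 ev_fraction _ vv).
- have [v' ad' vo'] := adapted_infinity0 ev_neq0 ev_fraction.
  have -> : v = v' by exact: adapted_uniq (generates_infinity ev_neq0 ev_fraction 0) ad ad'.
  apply: (@CurveP1P1 F P v' (xK F)^-1 (uK F) 'X%:P); rewrite ?inE ?eqxx ?orbT //.
  by have := irreducible_XsubC (0 : F); rewrite subr0.
- apply: (@CurveInfinity F P v j); first by rewrite szP.
  exact/(infinity_origin ev_neq0 ev_fraction j vv).
- have [v' ad' vo'] := adapted_section ev_neq0 ev_fraction.
  have -> : v = v' by exact: adapted_uniq (generates_section ev_neq0 ev_fraction) ad ad'.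
  apply: (@CurveP1P1 F P v' (xK F) (uK F)^-1 'X); rewrite ?inE ?eqxx ?orbT //.
  exact: irreducibleY.
Qed.

(** [bar] is computed from a chosen numerator and denominator; here it is recognized as a field
    morphism. *)
Lemma bar_rmorphism (s : F) (sigma : {rmorphism F -> F}) :
  exists2 phi : {rmorphism KF -> KF}, forall f, phi f = bar P s sigma f &
    is_bar (@cst F) (xK F) (uK F) P (sigma s != s) sigma phi.
Proof.
have [phi phi_bar phiE] :=
  bar_exists ev_neq0 ev_fraction P_neq0 (sigma s != s) sigma.
exists phi => // f; rewrite {1}(fractionP f) fmorph_div -!ev_tofrac !phiE.
by rewrite /bar -!ev_subst; case: (sigma s == s).
Qed.

(** * The type of curves, and their equations *)

Local Notation affineK := (affine (@cst F) (xK F) (uK F)).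

Fact make_curve_subproof v : surface_curve ev_neq0 ev_fraction root_of v ->
  `[< valuation v /\ on_X P v >].
Proof. by move=> vX; apply/asboolP/on_XP. Qed.

Definition make_curve v vX : curve P := Curve (@make_curve_subproof v vX).

Lemma curve_surface (C : curve P) : surface_curve ev_neq0 ev_fraction root_of C.
Proof. by case: C => v /= /asboolP vX; apply/on_XP. Qed.

Lemma curve_valuation (C : curve P) : is_valuation C.
Proof. by case: (curve_surface C). Qed.

Lemma curve_inj (C C' : curve P) : ord_curve C = ord_curve C' -> C = C'.
Proof. exact: val_inj. Qed.

Lemma boundary_surface b : surface_curve ev_neq0 ev_fraction root_of (bval b).
Proof. by split; [exact: boundary_is_valuation | left; exists b]. Qed.

Definition boundary_curve b : curve P := make_curve (boundary_surface b).

Lemma affine_surface v : is_valuation v -> affineK v ->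
  surface_curve ev_neq0 ev_fraction root_of v.
Proof. by split; last right. Qed.

Lemma curve_cases (C : curve P) :
  (exists b, C = boundary_curve b) \/ affineK C.
Proof.
have [vv [[b Cb]|]] := curve_surface C; last by right.
by left; exists b; apply: curve_inj.
Qed.

Lemma boundary_curve_not_affine b : ~ affineK (boundary_curve b).
Proof. exact: boundary_not_affine. Qed.

Lemma boundary_curve_inj : injective boundary_curve.
Proof.
move=> b b' bb'.
have ue : bval b (uK F) = bval b' (uK F) by have := congr1 (fun C : curve P => C (uK F)) bb'.
have xe c : bval b (xK F - cst c) = bval b' (xK F - cst c).
  by have := congr1 (fun C : curve P => C (xK F - cst c)) bb'.
move: ue xe; rewrite !boundary_u => ue xe.
have {}xe c := etrans (esym (boundary_x ev_neq0 ev_fraction root_of c b))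
  (etrans (xe c) (boundary_x ev_neq0 ev_fraction root_of c b')).
case: b b' ue xe {bb'} => [[i|m]|] [[j|n]|] //= ue xe.
- by have := xe (root_of i); rewrite eqxx (inj_eq root_inj); case: eqP => [->|].
- by have := xe (root_of i); rewrite eqxx.
- by have := xe (root_of j); rewrite eqxx.
- by have [mn] := oppr_inj ue; congr (Some (inr _)); apply: val_inj.
- by have := xe 0.
- by have := xe 0.
Qed.

(** Every plane curve is principal on the affine plane. Boundary curves are invisible there and
    receive the equation 1, which gives one formula for all curves. *)
Lemma equation_exists (C : curve P) : exists e : KF, [/\ e != 0,
  forall C' : curve P, affineK C' -> C' e = (C' == C)%:R &
  forall b, C = boundary_curve b -> e = 1].
Proof.
have [[b ->]|aC] := curve_cases C.
  exists 1; split=> [|C' aC'|//]; first exact: oner_neq0.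
  rewrite (v1 (curve_valuation C')); case: eqP => // C'b.
  by case: (boundary_curve_not_affine (b := b)); rewrite -C'b.
have [e [e0 Ce eP]] := affine_equation ev_neq0 ev_fraction (curve_valuation C) aC.
exists e; split=> // [C' aC'|b Cb]; last first.
  by case: (boundary_curve_not_affine (b := b)); rewrite -Cb.
have [->//|/eqP C'C] := eqVneq C' C.
by apply: eP => //; [exact: curve_valuation | move/curve_inj/C'C].
Qed.

Definition equation C := projT1 (cid (equation_exists C)).

Lemma equation_neq0 C : equation C != 0.
Proof. by rewrite /equation; case: cid => e []. Qed.

Lemma equation_affine (C C' : curve P) : affineK C' -> C' (equation C) = (C' == C)%:R.
Proof. by rewrite /equation; case: cid => e [_ + _] /=; apply. Qed.

Lemma equation_boundary b : equation (boundary_curve b) = 1.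
Proof. by rewrite /equation; case: cid => e [_ _] /= /(_ b); apply. Qed.

Lemma bval_eq b (J : Type) (s : seq J) (C : J -> curve P) (n : J -> int) (z : KF) :
    z != 0 ->
    (forall C' : curve P, affineK C' -> C' z = \sum_(j <- s) n j * (C' == C j)%:R) ->
  bval b z = \sum_(j <- s) n j * bval b (equation (C j)).
Proof.
move=> z0 rel.
have := affine_relation ev_neq0 ev_fraction (v := bval b) (s := s)
  (e := fun j => equation (C j)) (n := n) (z := z); apply.
- exact: boundary_is_valuation.
- exact: boundary_cst.
- by move=> j; apply: equation_neq0.
- exact: z0.
move=> v' vv' av'; have := rel (make_curve (affine_surface vv' av')) av'.
by move=> /= ->; apply: eq_bigr => j _; rewrite -equation_affine.
Qed.

(** * Coordinates on Pic X *)

Lemma fgliftE (M : lmodType int) (f : curve P -> M) (D : Div P) :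
  fglift f D = \sum_(C <- dom D) coeff C D *: f C.
Proof.
have lift_sum (s : seq (curve P)) (n : curve P -> int) :
    fglift f (\sum_(C <- s) << n C *g C >>) = \sum_(C <- s) n C *: f C.
  elim: s => [|C s IH].
    by rewrite !big_nil -[0](subrr 0) lift_is_additive subrr.
  rewrite !big_cons -{}IH -liftU -[in RHS](opprK (fglift f (\sum_(_ <- _) _))).
  rewrite -[- fglift f _]sub0r -[in RHS](subrr (fglift f 0)).
  by rewrite -!lift_is_additive subrr sub0r opprK.
by rewrite -{1}(freeg_sumE D) lift_sum.
Qed.

(** Subtracting from [D] the divisors of the equations of its components leaves a divisor supported
    on the boundary; this is its coefficient at [b]. *)
Definition div_coord b (D : Div P) : int :=
  coeff (boundary_curve b) D - fglift (fun C => bval b (equation C) : int^o) D.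

Lemma div_coord_zmod_morphism b : zmod_morphism (div_coord b).
Proof.
move=> D D'; rewrite /div_coord raddfB /= lift_is_additive.
move: (coeff _ D) (coeff _ D') (fglift _ D) (fglift _ D') => a b' c d.
by rewrite !opprB addrACA [RHS]addrACA (addrC (- b')).
Qed.

(** The affine part of the divisor of a function determines the function up to a constant, hence
    also its orders along the boundary. *)
Lemma div_coord_principal b D : D \in @principal F P -> div_coord b D = 0.
Proof.
case/asboolP=> z z0 Dz; apply/eqP; rewrite subr_eq0 Dz fgliftE; apply/eqP.
apply: (bval_eq b (C := id) (field_neq0 z0)).
move=> C' _; rewrite -Dz; have [C'D|C'D] := boolP (C' \in dom D).
  rewrite (bigD1_seq C') ?uniq_dom //= eqxx mulr1 big1 ?addr0 // => C.
  by rewrite eq_sym => /negPf->; rewrite mulr0.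
rewrite coeff_outdom // big_seq big1 // => C CD; case: eqP => [C'C|].
  by rewrite C'C CD in C'D.
by rewrite mulr0.
Qed.

Definition pic_coord b (X : Pic P) : int := div_coord b (generic_quotient.repr X).

Lemma Pic_pi (X : Pic P) : exists D, X = (\pi_(Pic P) D)%qT.
Proof.
by exists (generic_quotient.repr X); rewrite generic_quotient.reprK.
Qed.

Lemma pic_coord_pi b D : pic_coord b (\pi_(Pic P) D)%qT = div_coord b D.
Proof.
apply/eqP; rewrite -subr_eq0 -div_coord_zmod_morphism div_coord_principal //.
by rewrite Quotient.idealrBE generic_quotient.reprK.
Qed.

Lemma pic_coord_zmod_morphism b : zmod_morphism (pic_coord b).
Proof.
move=> X Y; have [D ->] := Pic_pi X; have [D' ->] := Pic_pi Y.
by rewrite -ring_quotient.pi_is_zmod_morphism !pic_coord_pi div_coord_zmod_morphism.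
Qed.

HB.instance Definition _ b :=
  GRing.isZmodMorphism.Build (Pic P) int (pic_coord b) (pic_coord_zmod_morphism b).

Lemma pic_coord_class b C :
  pic_coord b (curve_class C) = (C == boundary_curve b)%:R - bval b (equation C).
Proof.
rewrite pic_coord_pi /div_coord coeffU mul1r liftU.
by congr (_ - _); rewrite /GRing.scale /= mul1r.
Qed.

Definition boundary_class b : Pic P := curve_class (boundary_curve b).

Lemma pic_coord_boundary b b' : pic_coord b (boundary_class b') = (b' == b)%:R.
Proof.
rewrite pic_coord_class equation_boundary (v1 (boundary_is_valuation _ _ _ b)).
by rewrite subr0 (inj_eq boundary_curve_inj).
Qed.

(** By [coeff_curve_relation] this is the divisor of [equation C]. *)
Definition curve_relation C : Div P :=
  << C >> - \sum_b << boundary_curve b >> *~ pic_coord b (curve_class C).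

Lemma coeff_curve_relation C C' :
  coeff C' (curve_relation C) = C' (equation C).
Proof.
rewrite /curve_relation raddfB /= raddf_sum /= coeffU mul1r.
under eq_bigr => b _ do rewrite raddfMz /= coeffU mul1r.
have [[b ->]|aC'] := curve_cases C'.
  rewrite (bigD1 b) //= eqxx big1 => [|b' b'b]; last first.
    by rewrite (inj_eq boundary_curve_inj) (negPf b'b) mul0rz.
  by rewrite addr0 pic_coord_class intz opprB addrC subrK.
rewrite big1 => [|b _]; last first.
  case: eqP => [bC'|]; last by rewrite mul0rz.
  by case: (boundary_curve_not_affine (b := b)); rewrite bC'.
by rewrite subr0 equation_affine // eq_sym.
Qed.

Lemma curve_relation_principal C : curve_relation C \in @principal F P.
Proof.
apply/asboolP; exists (equation C); first exact/fraction_neq0/equation_neq0.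
by move=> C'; exact: coeff_curve_relation.
Qed.

Lemma pi_sum (J : Type) (s : seq J) (D : J -> Div P) :
  (\pi_(Pic P) (\sum_(j <- s) D j) = \sum_(j <- s) \pi_(Pic P) (D j))%qT.
Proof. exact: (raddf_sum (\pi_(Pic P))%qT). Qed.

Lemma class_expand C :
  curve_class C = \sum_b boundary_class b *~ pic_coord b (curve_class C).
Proof.
apply/eqP; rewrite -subr_eq0; apply/eqP.
transitivity ((\pi_(Pic P) (curve_relation C))%qT); last first.
  rewrite -(raddf0 (\pi_(Pic P))%qT); apply/eqP.
  by rewrite -Quotient.idealrBE subr0 curve_relation_principal.
rewrite /curve_relation raddfB /= pi_sum; congr (_ - _); apply: eq_bigr => b _.
by rewrite raddfMz.
Qed.

Lemma pic_expand X : X = \sum_b boundary_class b *~ pic_coord b X.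
Proof.
have [D ->] := Pic_pi X; rewrite -(freeg_sumE D) pi_sum.
have -> : \sum_(C <- dom D) (\pi_(Pic P) << coeff C D *g C >>)%qT =
    \sum_(C <- dom D) curve_class C *~ coeff C D.
  apply: eq_bigr => C _; rewrite -[in LHS](intz (coeff C D)) -freegU_mulz.
  by rewrite raddfMz.
transitivity (\sum_(C <- dom D) \sum_b
    boundary_class b *~ (pic_coord b (curve_class C) * coeff C D)).
  apply: eq_bigr => C _; rewrite {1}class_expand mulrz_suml.
  by apply: eq_bigr => b _; rewrite mulrzA.
rewrite exchange_big /=; apply: eq_bigr => b _.
rewrite -mulrz_sumr; congr (_ *~ _); rewrite raddf_sum /=.
by apply: eq_bigr => C _; rewrite raddfMz /= -mulrzz.
Qed.

Lemma pic_coord_inj X Y : (forall b, pic_coord b X = pic_coord b Y) -> X = Y.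
Proof.
by move=> XY; rewrite (pic_expand X) (pic_expand Y); apply: eq_bigr => b _; rewrite XY.
Qed.

Lemma pic_coord_sum b (n : boundary I -> int) :
  pic_coord b (\sum_b' boundary_class b' *~ n b') = n b.
Proof.
rewrite raddf_sum (bigD1 b) //= raddfMz /= pic_coord_boundary eqxx intz.
rewrite big1 ?addr0 // => b' b'b.
by rewrite raddfMz /= pic_coord_boundary (negPf b'b) mul0rz.
Qed.

(** * Classes of the fibres over roots and of the section u = 0 *)

Lemma fiber_exists c : exists C : curve P, adapted (@cst F) (uK F) (xK F - cst c) C.
Proof.
have [v [ad vo]] := adapted_fiber ev_neq0 ev_fraction c; have [vv _ _ _] := ad.
by exists (make_curve (affine_surface vv (adapted_affine_fiber ev_neq0 ev_fraction ad))).
Qed.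

Definition fiber_curve i := projT1 (cid (fiber_exists (root_of i))).

Lemma fiber_curveP i :
  adapted (@cst F) (uK F) (xK F - cst (root_of i)) (fiber_curve i).
Proof. by rewrite /fiber_curve; case: cid. Qed.

Lemma zero_exists : exists C : curve P, adapted (@cst F) (xK F) (uK F) C.
Proof.
have [v [ad vo]] := adapted_u0 ev_neq0 ev_fraction; have [vv _ _ _] := ad.
by exists (make_curve (affine_surface vv (adapted_affine_xu ev_neq0 ev_fraction ad))).
Qed.

Definition zero_curve := projT1 (cid zero_exists).

Lemma zero_curveP : adapted (@cst F) (xK F) (uK F) zero_curve.
Proof. by rewrite /zero_curve; case: cid. Qed.

Lemma fiber_curve_uniq i (C : curve P) :
  adapted (@cst F) (uK F) (xK F - cst (root_of i)) C -> C = fiber_curve i.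
Proof.
move=> ad; apply: curve_inj.
exact: adapted_uniq (@generates_fiber _ _ _ _ _ ev_neq0 ev_fraction _) ad (fiber_curveP i).
Qed.

Lemma zero_curve_uniq (C : curve P) :
  adapted (@cst F) (xK F) (uK F) C -> C = zero_curve.
Proof.
move=> ad; apply: curve_inj.
exact: adapted_uniq (@generates_xu _ _ _ _ _ ev_neq0 ev_fraction) ad zero_curveP.
Qed.

Lemma pic_coord_affine b (C : curve P) (z : KF) : affineK C -> z != 0 ->
    (forall C' : curve P, affineK C' -> C' z = (C' == C)%:R) ->
  pic_coord b (curve_class C) = - bval b z.
Proof.
move=> aC z0 zC; rewrite pic_coord_class.
have := bval_eq b (s := [:: tt]) (C := fun=> C) (n := fun=> 1) z0.
rewrite !big_seq1 mul1r => -> => [|C' aC']; last by rewrite big_seq1 mul1r zC.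
case: eqP => [Cb|]; last by rewrite sub0r.
by case: (boundary_curve_not_affine (b := b)); rewrite -Cb.
Qed.

(** Read off the divisor of $x-c_i$: the fibre, plus its exceptional curve, minus every component at
    infinity. *)
Lemma pic_coord_fiber b i : pic_coord b (curve_class (fiber_curve i)) =
  match b with Some (inl j) => - (j == i)%:R | Some (inr _) => 1 | None => 0 end.
Proof.
have ad := fiber_curveP i; have [vv _ vpi _] := ad.
rewrite (pic_coord_affine b (z := xK F - cst (root_of i))).
- rewrite boundary_x; case: b => [[j|m]|]; rewrite ?oppr0 ?opprK //.
  by rewrite (inj_eq root_inj).
- exact: (@adapted_affine_fiber F KF (@cst F) _ _ ev_neq0 ev_fraction _ _ ad).
- exact: (adapted_neq0 ad).1.
move=> C aC; have [CF|/eqP CF] := eqVneq C (fiber_curve i); first by rewrite CF.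
have [->//|adC] := affine_fiber ev_neq0 ev_fraction (root_of i) (curve_valuation C) aC.
by case: CF; apply: fiber_curve_uniq.
Qed.

(** Read off the divisor of [u]: its zeros are this curve and the exceptional curves; its poles are
    the section $u=\infty$ and, with multiplicity [m], the component of index [m]. *)
Lemma pic_coord_zero b : pic_coord b (curve_class zero_curve) =
  match b with Some (inl j) => -1 | Some (inr m) => m%:Z | None => 1 end.
Proof.
have ad := zero_curveP; have [vv _ vpi _] := ad.
rewrite (pic_coord_affine b (z := uK F)).
- by rewrite boundary_u; case: b => [[j|m]|]; rewrite ?opprK.
- exact: (@adapted_affine_xu F KF (@cst F) _ _ ev_neq0 ev_fraction _ ad).
- exact: (adapted_neq0 ad).1.
move=> C aC; have [CZ|/eqP CZ] := eqVneq C zero_curve; first by rewrite CZ.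
have := affine_ge0 (curve_valuation C) aC.
case: (ltrgtP (C (uK F)) 0) => // Cu _; case: CZ; apply: zero_curve_uniq.
case: aC => f irr vo; apply: (chartY (curve_valuation C) irr vo Cu).
exact: x_cst ev_neq0.
Qed.

(** * The action in coordinates *)

Definition image_class (fl : bool) (rho : I -> I) (b : boundary I) : Pic P :=
  match b with
  | Some (inl i) =>
      if fl then curve_class (fiber_curve (rho i)) else boundary_class (Some (inl (rho i)))
  | Some (inr m) => boundary_class (Some (inr (if fl then rev_ord m else m)))
  | None => if fl then curve_class zero_curve else boundary_class None
  end.

(** It depends only on the flip and on the permutation of the roots, hence only on the restriction
    of an automorphism to [l]. *)
Definition pic_act fl rho (X : Pic P) : Pic P :=
  \sum_b image_class fl rho b *~ pic_coord b X.

Lemma pic_act_zmod_morphism fl rho : zmod_morphism (pic_act fl rho).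
Proof.
move=> X Y; rewrite /pic_act -sumrB; apply: eq_bigr => b _.
by rewrite pic_coord_zmod_morphism mulrzBr.
Qed.

Lemma sum_boundary (f : boundary I -> int) :
  \sum_b f b = \sum_i f (Some (inl i)) + \sum_m f (Some (inr m)) + f None.
Proof.
rewrite (bigD1 None) //= addrC; congr (_ + _).
rewrite (reindex_omap Some id) => [|[b|]] //=.
rewrite (eq_bigl xpredT) => [|b]. by rewrite big_sumType.
by rewrite eqxx.
Qed.

Lemma pic_coord_act fl rho b X : pic_coord b (pic_act fl rho X) =
  \sum_b' pic_coord b (image_class fl rho b') * pic_coord b' X.
Proof.
by rewrite raddf_sum; apply: eq_bigr => b' _; rewrite raddfMz /= mulrzz.
Qed.

Local Notation e i := (pic_coord (Some (inl i))).
Local Notation w m := (pic_coord (Some (inr m))).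
Local Notation s := (pic_coord None).

Lemma sum_delta (T : finType) (t : T) (f : T -> int) :
  \sum_t' (t' == t)%:R * f t' = f t.
Proof.
rewrite (bigD1 t) //= eqxx mul1r big1 ?addr0 // => t' /negPf->.
by rewrite mul0r.
Qed.

Lemma e_act fl rho X i : injective rho ->
  e (rho i) (pic_act fl rho X) = if fl then - e i X - s X else e i X.
Proof.
move=> rho_inj; rewrite pic_coord_act sum_boundary /=.
rewrite [X in _ + X + _]big1 => [|m _]; last by rewrite pic_coord_boundary mul0r.
rewrite addr0 -(sum_delta i (fun j => e j X)).
case: fl; last first.
  rewrite pic_coord_boundary mul0r addr0; apply: eq_bigr => j _.
  by rewrite pic_coord_boundary (inj_eq (@Some_inj _)) (inj_eq inl_inj) (inj_eq rho_inj).
rewrite pic_coord_zero mulN1r -sumrN; congr (_ - _); apply: eq_bigr => j _.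
by rewrite pic_coord_fiber (inj_eq rho_inj) eq_sym mulNr.
Qed.

Lemma w_act fl rho X m : w m (pic_act fl rho X) =
  if fl then (\sum_i e i X) + w (rev_ord m) X + s X *+ m else w m X.
Proof.
rewrite pic_coord_act sum_boundary /=; case: fl.
  congr (_ + _ + _).
  - by apply: eq_bigr => i _; rewrite pic_coord_fiber mul1r.
  - rewrite -(sum_delta (rev_ord m) (fun n => w n X)); apply: eq_bigr => n _.
    rewrite pic_coord_boundary (inj_eq (@Some_inj _)) (inj_eq inr_inj).
    by rewrite -(inj_eq rev_ord_inj) rev_ordK.
  - by rewrite pic_coord_zero mulrC -mulrzz -pmulrn.
rewrite [\sum_i _]big1 ?add0r => [|i _]; last by rewrite pic_coord_boundary mul0r.
rewrite pic_coord_boundary mul0r addr0 -(sum_delta m (fun n => w n X)).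
apply: eq_bigr => n _.
by rewrite pic_coord_boundary (inj_eq (@Some_inj _)) (inj_eq inr_inj).
Qed.

Lemma s_act fl rho X : s (pic_act fl rho X) = s X.
Proof.
rewrite pic_coord_act sum_boundary /=.
rewrite ![\sum_i _]big1 ?add0r => [|m _|i _].
- by case: fl; rewrite ?pic_coord_zero ?pic_coord_boundary mul1r.
- by rewrite pic_coord_boundary mul0r.
- by case: fl; rewrite ?pic_coord_fiber ?pic_coord_boundary mul0r.
Qed.

Lemma pic_coord_inj3 X Y : (forall i, e i X = e i Y) -> (forall m, w m X = w m Y) ->
  s X = s Y -> X = Y.
Proof. by move=> eXY wXY sXY; apply: pic_coord_inj => -[[i|m]|]. Qed.

Lemma pic_coord_surj (a : I -> int) (b : 'I_r.+1 -> int) (z : int) :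
  exists X, [/\ forall i, e i X = a i, forall m, w m X = b m & s X = z].
Proof.
exists (\sum_b' boundary_class b' *~
  match b' with Some (inl i) => a i | Some (inr m) => b m | None => z end).
by split=> [i|m|]; rewrite pic_coord_sum.
Qed.

Lemma pic_act_id X : pic_act false id X = X.
Proof.
apply: pic_coord_inj3 => [i|m|]; rewrite ?w_act ?s_act //.
by rewrite (@e_act false id X i (@inj_id _)).
Qed.

(** Checked in coordinates. The order [rho' \o rho] matches the right-module convention of
    [gmodule]. *)
Lemma pic_act_comp fl rho fl' rho' X : injective rho -> injective rho' ->
  pic_act fl' rho' (pic_act fl rho X) = pic_act (fl (+) fl') (rho' \o rho) X.
Proof.
move=> inj inj'; have inj'' := inj_comp inj' inj.
have sum_e : \sum_i e i (pic_act fl rho X) =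
    if fl then - (\sum_i e i X) - s X *+ r else \sum_i e i X.
  rewrite (reindex_inj inj) /= (eq_bigr _ (fun i _ => e_act fl X i inj)).
  by case: fl; rewrite // big_split /= !sumrN sumr_const.
apply: pic_coord_inj3 => [i|m|]; last by rewrite !s_act.
- have [j <-] : exists j, (rho' \o rho) j = i.
    by exists (invF inj'' i); rewrite f_invF.
  rewrite (e_act _ _ _ inj'') /= !e_act // s_act.
  by move: sum_e => _; case: fl; case: fl' => //=; ring.
rewrite !w_act s_act sum_e rev_ordK.
move: sum_e => _; case: fl; case: fl' => //=.
have -> : (r.+1 - m.+1 = r - m)%N by rewrite subSS.
have mr : (m <= r)%N by rewrite -ltnS.
(* For two flips the contributions [m] and [r - m] of the section at infinity cancel the [r] copies
   coming from the sum of the [e] coordinates. *)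
have -> : s X *+ r = s X *+ m + s X *+ (r - m) by rewrite -mulrnDr subnKC.
ring.
Qed.

(** * The formula gives the natural action *)

Section Image.
Variables (q : F) (sigma sigma' : {rmorphism F -> F}) (rho rho' : I -> I).
Hypotheses (sigmaK : cancel sigma sigma') (sigma'K : cancel sigma' sigma).
Hypotheses (rhoK : cancel rho rho') (rho'K : cancel rho' rho).
Hypothesis sigma_P : map_poly sigma P = P.
Hypothesis sigma_root : forall i, sigma (root_of i) = root_of (rho i).
Local Notation fl := (sigma q != q).

Lemma sigma'_P : map_poly sigma' P = P.
Proof.
rewrite -{1}sigma_P -map_poly_comp map_poly_id // => c _ /=; exact: sigmaK.
Qed.

Lemma sigma'_root i : sigma' (root_of i) = root_of (rho' i).
Proof. by rewrite -{1}(rho'K i) -sigma_root sigmaK. Qed.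

Lemma sigma'_fix : (sigma' q != q) = fl.
Proof. by rewrite -(inj_eq (can_inj sigmaK)) sigma'K eq_sym. Qed.

(** The image of a curve has its valuation composed with [psi], the inverse of [phi]. On boundary
    curves it is known explicitly; any other curve is a combination of these modulo the divisor of a
    function, which the automorphism carries to another principal divisor. *)
Lemma bar_image (C : curve P) : exists2 C' : curve P,
  (forall f, C' (bar P q sigma f) = C f) &
  pic_act fl rho (curve_class C) = curve_class C'.
Proof.
have [phi phiE phi_bar] := bar_rmorphism q sigma.
have [psi _ psi_bar] := bar_rmorphism q sigma'; rewrite sigma'_fix in psi_bar.
have phiK : cancel phi psi :=
  bar_cancel ev_neq0 ev_fraction P_neq0 sigma'_P sigmaK phi_bar psi_bar.
have psiK : cancel psi phi :=
  bar_cancel ev_neq0 ev_fraction P_neq0 sigma_P sigma'K psi_bar phi_bar.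
have imP (D : curve P) : surface_curve ev_neq0 ev_fraction root_of (D \o psi).
  exact: (surface_curve_bar P_fact P_neq0 root_inj sigma'_root rhoK psi_bar
    phi_bar psiK phiK (curve_surface D)).
have imP' (D : curve P) : surface_curve ev_neq0 ev_fraction root_of (D \o phi).
  exact: (surface_curve_bar P_fact P_neq0 root_inj sigma_root rho'K phi_bar
    psi_bar phiK psiK (curve_surface D)).
pose im D := make_curve (imP D); pose im' D := make_curve (imP' D).
have im'K : cancel im' im.
  by move=> D; apply: curve_inj; apply/funext=> z /=; rewrite psiK.
have imK : cancel im im'.
  by move=> D; apply: curve_inj; apply/funext=> z /=; rewrite phiK.
exists (im C) => [f|]; first by rewrite -phiE /= phiK.
have im_boundary b : curve_class (im (boundary_curve b)) = image_class fl rho b.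
  case flE: fl (psi_bar) => psi_bar'; case: b => [[i|m]|]; congr curve_class.
  - apply: fiber_curve_uniq.
    apply: (bar_E_flip (tofrac_neq0 := ev_neq0) (fraction_ex := ev_fraction)
      P_fact P_neq0 root_inj sigma'_root psi_bar') => //; by rewrite rhoK.
  - apply: curve_inj => /=.
    by rewrite -(bar_W_flip ev_neq0 ev_fraction P_fact P_neq0 psi_bar' (rev_ord m)) // rev_ordK.
  - apply: zero_curve_uniq.
    exact: (bar_U_flip (tofrac_neq0 := ev_neq0) (fraction_ex := ev_fraction)
      (root_of := root_of) P_neq0 psi_bar').
  - apply: curve_inj => /=.
    by rewrite -(bar_E ev_neq0 ev_fraction sigma'_root psi_bar' (rho i)) // rhoK.
  - by apply: curve_inj; apply: (bar_W ev_neq0 ev_fraction root_of psi_bar').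
  - by apply: curve_inj; apply: (bar_U ev_neq0 ev_fraction root_of psi_bar').
apply/eqP; rewrite eq_sym -subr_eq0 /pic_act.
under eq_bigr => b _ do rewrite -im_boundary.
(* The image of [curve_relation C], hence the divisor of [phi (equation C)]. *)
pose D : Div P := << im C >> -
  \sum_b << im (boundary_curve b) >> *~ pic_coord b (curve_class C).
have -> : curve_class (im C) - \sum_b curve_class (im (boundary_curve b)) *~
    pic_coord b (curve_class C) = (\pi_(Pic P) D)%qT.
  rewrite /D raddfB /= pi_sum; congr (_ - _); apply: eq_bigr => b _.
  by rewrite raddfMz.
rewrite -(raddf0 (\pi_(Pic P))%qT) -Quotient.idealrBE subr0.
apply/asboolP; exists (phi (equation C)) => [|C'].
  by apply: fraction_neq0; rewrite fmorph_eq0 equation_neq0.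
have -> : C' (phi (equation C)) = im' C' (equation C) by [].
rewrite -coeff_curve_relation /D /curve_relation !raddfB /= !raddf_sum /=.
have coeff_im C0 : coeff C' << im C0 >> = coeff (im' C') << C0 >> :> int.
  by rewrite !coeffU (can2_eq imK im'K).
rewrite coeff_im; congr (_ + _); apply: eq_bigr => b _.
by rewrite !raddfMz /= coeff_im.
Qed.

End Image.
End Curves.
End Surface.
(** * The Galois group of the splitting field *)

Lemma adjoin_degree_gt0 (k : fieldType) (l : fieldExtType k) (U : {vspace l}) (y : l) :
  (0 < adjoin_degree U y)%N.
Proof. by []. Qed.

Lemma irreducible_minPoly (k : fieldType) (l : fieldExtType k) (q : {poly k}) (y : l) :
    irreducible_poly q -> root (map_poly (in_alg l) q) y ->
  map_poly (in_alg l) q %= minPoly 1 y.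
Proof.
move=> [_ irr] qy.
have q1 : map_poly (in_alg l) q \is a polyOver 1%VS by apply/polyOver1P; exists q.
have := minPoly_dvdp (K := 1%AS) q1 qy.
have /polyOver1P[d dE] := minPolyOver 1%VS y.
rewrite dE dvdp_map eqp_map eqp_sym; apply: irr.
have := size_minPoly 1%VS y; rewrite dE size_map_poly => ->.
by rewrite eqSS -lt0n adjoin_degree_gt0.
Qed.

Lemma irreducible_minPoly_subvs (k : fieldType) (l : fieldExtType k)
    (K : {subfield l}) (q : {poly k}) (y : l) :
    irreducible_poly (map_poly (in_alg (subvs_of K)) q) ->
    root (map_poly (in_alg l) q) y ->
  map_poly (in_alg l) q %= minPoly K y.
Proof.
set qK := map_poly _ q => -[_ irr].
have -> : map_poly (in_alg l) q = map_poly vsval qK.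
  by rewrite -map_poly_comp; apply: eq_map_poly => c /=; rewrite algid1.
move=> qy; have qO : map_poly vsval qK \is a polyOver K by apply/polyOver_subvs; exists qK.
have := minPoly_dvdp qO qy; have /polyOver_subvs[d dE] := minPolyOver K y.
rewrite dE dvdp_map eqp_map eqp_sym; apply: irr.
have := size_minPoly K y; rewrite dE size_map_poly => ->.
by rewrite eqSS -lt0n adjoin_degree_gt0.
Qed.

Lemma prod_separable (k : fieldType) (r' : nat) (p : 'I_r' -> {poly k}) :
    (forall m, irreducible_poly (p m)) -> (forall m n, m != n -> ~~ (p m %= p n)) ->
    (forall m, separable_poly (p m)) ->
  separable_poly (\prod_(m < r') p m).
Proof.
move=> irr dist sep.
have cop m n : m != n -> coprimep (p m) (p n).
  move=> mn; rewrite irreducible_poly_coprime //; apply: contra (dist _ _ mn).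
  by case: (irr n) (irr m) => _ irrn [sm _] /irrn; apply; rewrite gtn_eqF.
rewrite -big_enum; elim: (enum _) (enum_uniq 'I_r') => [|m s IH] /=.
  by rewrite big_nil separable_poly.unlock coprime1p.
case/andP=> ms us; rewrite big_cons separable_mul sep IH //=.
rewrite big_seq; elim/big_ind: _ => [|q q'|n ns]; first exact: coprimep1.
  by rewrite coprimepMr => -> ->.
by apply: cop; apply: contraNneq ms => ->.
Qed.

Lemma inverse_rmorphism (A : fieldType) (sigma : {rmorphism A -> A}) :
  bijective sigma -> exists sigma' : {rmorphism A -> A},
    cancel sigma sigma' /\ cancel sigma' sigma.
Proof.
case=> tau sK tK.
have tB : zmod_morphism tau.
  by move=> y z; apply: (can_inj sK); rewrite rmorphB !tK.
have tM : monoid_morphism tau.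
  by split=> [|y z]; apply: (can_inj sK); rewrite ?rmorph1 ?rmorphM !tK.
pose t : {rmorphism A -> A} := HB.pack tau
  (GRing.isZmodMorphism.Build _ _ tau tB) (GRing.isMonoidMorphism.Build _ _ tau tM).
by exists t.
Qed.

Lemma gal_alg (k : fieldType) (l : splittingFieldType k) (g : gal_of {:l}) (c : k) :
  g c%:A = c%:A.
Proof. by rewrite linearZ rmorph1. Qed.

Lemma gal_map_alg (k : fieldType) (l : splittingFieldType k) (g : gal_of {:l})
    (q : {poly k}) :
  map_poly g (map_poly (in_alg l) q) = map_poly (in_alg l) q.
Proof. by rewrite -map_poly_comp; apply: eq_map_poly => c /=; apply: gal_alg. Qed.

Lemma gal_sqrt (k : fieldType) (l : splittingFieldType k) (a : k) (z : l)
    (g : gal_of {:l}) : z ^+ 2 = a%:A -> g z = z \/ g z = - z.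
Proof.
move=> zE; have /eqP : (g z) ^+ 2 = z ^+ 2 by rewrite -rmorphXn /= zE gal_alg.
by rewrite eqf_sqr => /orP[] /eqP; [left | right].
Qed.

Lemma gal_flipM (k : fieldType) (l : splittingFieldType k) (a : k) (z : l)
    (g h : gal_of {:l}) : z ^+ 2 = a%:A ->
  ((g * h)%g z != z) = (g z != z) (+) (h z != z).
Proof.
move=> zE; rewrite galM ?memvf //.
have [gz|/eqP gz] := eqVneq (g z) z; first by rewrite gz.
have [//|gzN] := gal_sqrt g zE; rewrite gzN rmorphN /=.
have [hz|/eqP hz] := eqVneq (h z) z; first by rewrite hz -gzN; apply/eqP.
by have [//|->] := gal_sqrt h zE; rewrite opprK eqxx.
Qed.

(* [sqrta] outside [k(y)] is equivalent to [q] staying irreducible over *)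
(* [k(sqrta)]: compare the degrees of [k(sqrta, y)] over [k].           *)
Lemma stabilizer_flip (k : fieldType) (l : splittingFieldType k) (z y : l)
    (q : {poly k}) :
    galois 1%AS {:l}%AS -> z \notin 1%VS -> irreducible_poly q ->
    irreducible_poly (map_poly (in_alg (subvs_of <<1%AS; z>>%AS)) q) ->
    root (map_poly (in_alg l) q) y ->
  exists g : gal_of {:l}, [/\ g \in 'Gal({:l} / 1%AS)%g, g y = y & g z != z].
Proof.
move=> gal z1 irr irrz qy.
have d1 := eqp_size (irreducible_minPoly irr qy).
have dz := eqp_size (irreducible_minPoly_subvs irrz qy).
rewrite size_minPoly in d1; rewrite d1 size_minPoly in dz.
have galy : galois <<1%AS; y>>%AS {:l}%AS.
  by apply: galoisS gal; rewrite subv_adjoin subvf.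
have zy : z \notin <<1%AS; y>>%VS.
  apply/negP=> zy.
  have : (<<<<1%AS; z>>%AS; y>>%VS <= <<1%AS; y>>%VS)%VS.
    apply/FadjoinP; split; last exact: memv_adjoin.
    by apply/FadjoinP; split=> //; exact: subv_adjoin.
  move/dimvS; rewrite !dim_Fadjoin dimv1 !muln1 -(succn_inj dz).
  rewrite leqNgt -[X in (X < _)%N]muln1 ltn_pmul2l ?adjoin_degree_gt0 //.
  by rewrite ltn_neqAle adjoin_degree_gt0 andbT eq_sym adjoin_deg_eq1 z1.
rewrite -(galois_fixedField galy) in zy.
have [g Gg gz] : exists2 g, g \in 'Gal({:l} / <<1%AS; y>>%AS)%g & g z != z.
  apply: contrapT => nex; case/negP: zy; apply/fixedFieldP; first exact: memvf.
  by move=> g Gg; apply/eqP; apply/negP=> /negP gz; apply: nex; exists g.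
exists g; split=> //; first by apply: subsetP Gg; apply: galS; apply: sub1v.
by apply: (fixed_gal _ Gg); rewrite ?subvf ?memv_adjoin.
Qed.

(** * The action of the Galois group on the roots, and its cohomology *)

Theorem theorem1p2
  (k : fieldType) (a : k) (P : {poly k})
  (a_nonsquare : forall b : k, b ^+ 2 <> a)
  (deg_P : (3 <= (size P).-1)%N)
  (r' : nat) (p : 'I_r' -> {poly k})
  (P_prod : P = \prod_(m < r') p m)
  (p_irr : forall m, irreducible_poly (p m))
  (p_distinct : forall m n, m != n -> ~~ (p m %= p n))
  (l : splittingFieldType k)
  (l_split : splittingFieldFor 1%VS (map_poly (in_alg l) P) {:l}%VS)
  (sqrta : l) (sqrta_sq : sqrta ^+ 2 = a%:A)
  (p_irr_sqrta : forall m,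
     irreducible_poly (map_poly (in_alg (subvs_of <<1%AS; sqrta>>%AS)) (p m)))
  (char_k : 2%N \notin [pchar k])
  (p_sep : forall m, separable_poly (p m))
  (kbar : closedFieldType) (i : {rmorphism l -> kbar})
  (kbar_alg : forall z : kbar, algebraicOver (fun c : k => i c%:A) z) :
  let Pbar := map_poly (fun c : k => i c%:A) P in
  let j := if odd (size P).-1 then (r' - 1)%N
           else if [forall m, ~~ odd (size (p m)).-1] then (r' - 1)%N
           else (r' - 2)%N in
  exists act : gmodule 'Gal({:l} / 1%AS) (Pic Pbar),
    natural_action i (i sqrta) act /\ zmod_isom (H1 act) 'rV['Z_2]_j.
Proof.
move=> Pbar j.
have P0 : P != 0 by rewrite -size_poly_gt0; case: (size P) deg_P.
have sepP : separable_poly P by rewrite P_prod; apply: prod_separable.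
set Pl := map_poly (in_alg l) P in l_split.
have galois_l : galois 1%AS {:l}%AS.
  apply/splitting_galoisField; exists Pl.
  by rewrite separable_map; split=> //; apply/polyOver1P; exists P.
have [rs Pl_eqp _] := l_split.
have rs_uniq : uniq rs.
  by rewrite -separable_prod_XsubC -(eqp_separable Pl_eqp) separable_map.
(* The index set of the distinct roots of P; its cardinality is the degree of P. *)
pose I : finType := 'I_(size rs); pose y (t : I) : l := rs`_t.
have y_inj : injective y.
  by move=> t t' /eqP; rewrite nth_uniq // => /eqP/val_inj.
have Pl_fact : Pl = lead_coef Pl *: \prod_(t : I) ('X - (y t)%:P).
  have -> : \prod_(t : I) ('X - (y t)%:P) = \prod_(z <- rs) ('X - z%:P).
    by rewrite (big_nth 0) big_mkord.
  case/eqpP: Pl_eqp => -[c d] /= /andP[c0 d0] cd.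
  have PlE : Pl = (d / c) *: \prod_(z <- rs) ('X - z%:P).
    by rewrite mulrC -scalerA -cd scalerK.
  by rewrite {2}PlE lead_coefZ (monicP (monic_prod_XsubC _ _ _)) mulr1.
have PbarE : Pbar = map_poly i Pl by rewrite /Pl -map_poly_comp.
pose root_of (t : I) : kbar := i (y t).
have root_inj : injective root_of by move=> t t' /fmorph_inj/y_inj.
have Pbar0 : Pbar != 0 by rewrite PbarE !map_poly_eq0.
have Pbar_fact : Pbar = lead_coef Pbar *: \prod_t ('X - (root_of t)%:P).
  rewrite PbarE lead_coef_map {1}Pl_fact map_polyZ rmorph_prod /=.
  by congr (_ *: _); apply: eq_bigr => t _; rewrite rmorphB /= map_polyX map_polyC.
have sizeP : (size P).-1 = #|I|.
  by rewrite -(size_P Pbar_fact Pbar0) PbarE !size_map_poly.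
have mem_rs z : (z \in rs) = root Pl z by rewrite (eqp_root Pl_eqp) root_prod_XsubC.
have index_root z : root Pl z -> {t : I | y t = z}.
  rewrite -mem_rs -index_mem => zs; exists (Ordinal zs).
  by rewrite /y /= nth_index // -index_mem.
have gal_root (g : gal_of {:l}) t : root Pl (g (y t)).
  have -> : Pl = map_poly g Pl by rewrite gal_map_alg.
  by rewrite fmorph_root -mem_rs mem_nth.
pose rho (g : gal_of {:l}) t := sval (index_root _ (gal_root g t)).
have rhoE g t : y (rho g t) = g (y t) by rewrite /rho; case: (index_root _ _).
have rho_inj g : injective (rho g).
  by move=> t t' /(congr1 y); rewrite !rhoE => /fmorph_inj/y_inj.
have rho1 : rho 1%g = id by apply/funext=> t; apply: y_inj; rewrite rhoE gal_id.
have rhoM g h : rho (g * h)%g = rho h \o rho g.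
  by apply/funext=> t; apply: y_inj; rewrite /= !rhoE galM ?memvf.
pose flip (g : gal_of {:l}) := g sqrta != sqrta.
have flipM g h : flip (g * h)%g = flip g (+) flip h := gal_flipM g h sqrta_sq.
have flip1 : flip 1%g = false by rewrite /flip gal_id eqxx.
pose pact (g : gal_of {:l}) : Pic Pbar -> Pic Pbar :=
  pic_act Pbar_fact Pbar0 (flip g) (rho g).
have pactB : {in 'Gal({:l} / 1%AS)%g, forall g, {morph pact g : X Y / X - Y}}.
  by move=> g _; apply: pic_act_zmod_morphism.
have pact1 X : pact 1%g X = X by rewrite /pact flip1 rho1 pic_act_id.
have pactM : {in 'Gal({:l} / 1%AS)%g &,
    forall g h X, pact (g * h)%g X = pact h (pact g X)}.
  by move=> g h _ _ X; rewrite /pact pic_act_comp // flipM rhoM.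
exists (GModule pactB pact1 pactM); split.
  move=> sigma g sigma_bij sigma_k _ sigma_g C.
  have [sigma' [sK s'K]] := inverse_rmorphism sigma_bij.
  have sigma_P : map_poly sigma Pbar = Pbar.
    by rewrite -map_poly_comp; apply: eq_map_poly => c /=; apply: sigma_k.
  have sigma_root t : sigma (root_of t) = root_of (rho g t).
    by rewrite /root_of sigma_g rhoE.
  have [C' C'P actC] := bar_image Pbar_fact Pbar0 root_inj (i sqrta) sK s'K
    (invF_f (rho_inj g)) (f_invF (rho_inj g)) sigma_P sigma_root C.
  exists C' => //; rewrite -actC /=; congr pic_act.
  by rewrite sigma_g (inj_eq (fmorph_inj i)).
have root_p m z : root (map_poly (in_alg l) (p m)) z -> root Pl z.
  by move=> pz; rewrite /Pl P_prod (bigD1 m) //= rmorphM rootM pz.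
(* A root is labelled by the irreducible factor it annihilates; by [orb_uniq] there is only one. *)
have orb_ex t : {m : 'I_r' | root (map_poly (in_alg l) (p m)) (y t)}.
  apply: sigW; have : root Pl (y t) by rewrite -mem_rs mem_nth.
  by rewrite /Pl P_prod rmorph_prod rootE horner_prod => /prodf_eq0[m]; exists m.
pose orb t := sval (orb_ex t).
have orbP t : root (map_poly (in_alg l) (p (orb t))) (y t) by rewrite /orb; case: (orb_ex _).
have orb_uniq t m : root (map_poly (in_alg l) (p m)) (y t) -> orb t = m.
  move=> pm; apply/eqP; apply: contraT => /p_distinct/negP[].
  rewrite -(eqp_map (in_alg l)).
  have := irreducible_minPoly (p_irr m) pm; rewrite eqp_sym.
  exact: eqp_trans (irreducible_minPoly (p_irr _) (orbP t)).
have p_roots m : exists zs,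
    [/\ uniq zs, map_poly (in_alg l) (p m) %= \prod_(z <- zs) ('X - z%:P)
      & {subset zs <= rs}].
  have : map_poly (in_alg l) (p m) %| \prod_(z <- rs) ('X - z%:P).
    rewrite -(eqp_dvdr _ Pl_eqp) /Pl P_prod rmorph_prod /= (bigD1 m) //=.
    exact: dvdp_mulIl.
  case/dvdp_prod_XsubC=> msk pE; exists (mask msk rs).
  by split=> //; [apply: mask_uniq | move=> z; apply: mem_mask].
have b_ex m : {t : I | root (map_poly (in_alg l) (p m)) (y t)}.
  apply: sigW; have [[|z zs] [_ pE zs_rs]] := p_roots m.
    have := eqp_size pE; rewrite big_nil size_map_poly size_poly1.
    by case: (p_irr m) => + _ => /[swap] ->.
  have pz : root (map_poly (in_alg l) (p m)) z.
    by rewrite (eqp_root pE) root_prod_XsubC mem_head.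
  by have [t yt] := index_root z (root_p m z pz); exists t; rewrite yt.
pose b m := sval (b_ex m).
have bP m : root (map_poly (in_alg l) (p m)) (y (b m)).
  by rewrite /b; case: (b_ex _).
have orb_b m : orb (b m) = m by apply: orb_uniq.
have orb_rho g t : orb (rho g t) = orb t.
  by apply: orb_uniq; rewrite rhoE -(gal_map_alg g) fmorph_root.
(* In a normal extension the roots of a minimal polynomial are the conjugates of any one of them. *)
have orb_trans t : exists2 g, g \in 'Gal({:l} / 1%AS)%g & rho g (b (orb t)) = t.
  have /and3P[_ _ normal_l] := galois_l.
  have [|g Gg gb] := normalField_root_minPoly (sub1v _) normal_l 
      (memvf (y (b (orb t)))) (b := y t).
    rewrite -(eqp_root (irreducible_minPoly (p_irr (orb t)) (bP _))).
    exact: orbP.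
  by exists g => //; apply: y_inj; rewrite rhoE.
have sqrta1 : sqrta \notin 1%VS.
  apply/vlineP=> -[c sqrtaE]; apply: (a_nonsquare c).
  by apply: (fmorph_inj (in_alg l)); rewrite rmorphXn /= -sqrtaE.
have tau_ex m : {g : gal_of {:l} | [/\ g \in 'Gal({:l} / 1%AS)%g, rho g (b m) = b m & flip g]}.
  apply: cid.
  have [g [Gg gb gz]] := stabilizer_flip galois_l sqrta1 (p_irr m) (p_irr_sqrta m) (bP m).
  by exists g; split=> //; apply: y_inj; rewrite rhoE.
pose tau m := sval (tau_ex m).
have tauP m : [/\ tau m \in 'Gal({:l} / 1%AS)%g, rho (tau m) (b m) = b m & flip (tau m)].
  by rewrite /tau; case: (tau_ex _).
have r'_gt0 : (0 < r')%N.
  (* With no factor the product would be the constant 1, against the bound on the degree. *)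
  case: r' p P_prod {p_irr p_distinct p_irr_sqrta p_sep j root_p orb_ex orb orbP orb_uniq
    p_roots b_ex b bP orb_b orb_rho orb_trans tau_ex tau tauP} => // p' PE.
  by move: deg_P; rewrite PE big_ord0 size_poly1.
(* Each factor splits over [l] into distinct linear factors, so its orbit has as many elements as
   its degree. *)
have orbit_size m : #|[set t | orb t == m]| = (size (p m)).-1.
  have [zs [zs_uniq pE zs_rs]] := p_roots m.
  have := eqp_size pE; rewrite size_map_poly size_prod_XsubC => -> /=.
  rewrite cardE -(size_map y); apply/perm_size/uniq_perm=> //.
    by rewrite map_inj_uniq ?enum_uniq.
  move=> z; rewrite -[z \in zs]root_prod_XsubC -(eqp_root pE); apply/mapP/idP.
    by case=> t; rewrite mem_enum inE => /eqP <- ->.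
  move=> pz; have [t yt] := index_root z (root_p m z pz).
  by exists t => //; rewrite mem_enum inE; apply/eqP/orb_uniq; rewrite yt.
rewrite /j sizeP -(eq_forallb (fun m => congr1 (fun n => ~~ odd n) (orbit_size m))).
pose q c := pic_coord Pbar_fact Pbar0 c.
apply: (@picard_H1 _ _ _ _ I (fun t => q (Some (inl t))) (fun m => q (Some (inr m)))
  (q None) _ _ flip rho _ _ _ _ _ r' orb b tau).
- by move=> X Y; apply: pic_coord_inj3.
- exact: pic_coord_surj.
- by move=> g h _ _; apply: flipM.
- by move=> g _; apply: rho_inj.
- by move=> g _ X t; apply: e_act.
- by move=> g _ X m; apply: w_act.
- by move=> g _ X; apply: s_act.
- exact: r'_gt0.
- by move=> g _ t; apply: orb_rho.
- exact: orb_trans.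
- exact: orb_b.
- by move=> m; case: (tauP m).
- by move=> m; case: (tauP m).
- by move=> m; case: (tauP m).
Qed.
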